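(* Let $n$ be an odd positive integer. Consider the Eulerian formal Dirichlet series $$D_{A^*;n}(s):=\sum_{S\in\mathbb{N}}\frac{A^*_n(S)}{S^s},\qquad D_{B^*;n}(s):=\sum_{S\in\mathbb{N}}\frac{B^*_n(S)}{S^s},$$ and write each as a formal Euler product $\prod_pE_p(p^{-s})$ over primes $p$, with $E_p(X)\in\mathbb{C}[[X]]$ and with $E_p$ having constant term $1$ for every odd $p$. Then for every prime $p$ the Euler factor $E_p(p^{-s})$ of each of these two series is a rational function in $p^{-s}$.
   Context: All quadratic forms are non-degenerate. For a quadratic form $Q(x_1,\dots,x_n)$ the Hessian matrix is $(\partial^2Q/\partial x_i\partial x_j)$, the Gram matrix is half of it, and $\det_H(Q)$ is the determinant of the Hessian matrix. Let $p$ be a prime. A form over $\mathbb{Z}_p$ is $\mathbb{Z}_p$-valued if it takes values in $\mathbb{Z}_p$ on $\mathbb{Z}_p^n$, and primitive if moreover its values generate $\mathbb{Z}_p$. A local genus at $p$ is a $\mathbb{Z}_p$-equivalence class of such forms; $\det_H$ of a local genus is well defined in $\mathbb{Q}_p^\times/(\mathbb{Z}_p^\times)^2$. If $Q\sim a_1x_1^2+\cdots+a_nx_n^2$ over $\mathbb{Q}_p$, the Hasse invariant is $c_p(Q)=\prod_{i<j}(a_i,a_j)_p$ (Hilbert symbols). The local density of a form $Q$ with Gram matrix $G$ is $$\beta_p(Q)=\tfrac12\lim_{U\to\{G\}}\frac{\mathrm{Vol}\{X\in M_n(\mathbb{Z}_p): {}^tXGX\in U\}}{\mathrm{Vol}(U)},$$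 where $U$ runs over open neighborhoods of $G$ in $\mathrm{Sym}_n(\mathbb{Q}_p)$ shrinking to $G$, and Haar measures are normalized so that $M_n(\mathbb{Z}_p)$ and $\mathrm{Sym}_n(\mathbb{Z}_p)$ have volume $1$. It depends only on the local genus. For $n$ odd, $\beta_{n,p}$ denotes $\beta_p(G_p)$ for a primitive $\mathbb{Z}_p$-valued local genus $G_p$ of rank $n$ with $\mathrm{ord}_p(\det_H(G_p))=\mathrm{ord}_p(2)$; for $n$ odd such a genus exists for each determinant squareclass of this valuation, is unique for that squareclass, and its density does not depend on the squareclass. For $S\in\mathbb{N}$ and $\varepsilon\in\{\pm1\}$ let $\widetilde M^{*,\varepsilon}_{p;n}(S)=\sum_{G_p}\beta_{n,p}/\beta_p(G_p)$, the sum over primitive $\mathbb{Z}_p$-valued rank $n$ local genera $G_p$ with $\det_H(G_p)=S\,(\mathbb{Z}_p^\times)^2$ and $c_p(G_p)=\varepsilon$. Put $A^*_{p;n}(S)=\widetilde M^{*,+}_{p;n}(S)+\widetilde M^{*,-}_{p;n}(S)$, $B^*_{p;n}(S)=\widetilde M^{*,+}_{p;n}(S)-\widetilde M^{*,-}_{p;n}(S)$, $A^*_n(S)=\prod_pA^*_{p;n}(S)$, $B^*_n(S)=\prod_pB^*_{p;n}(S)$ (all but finitely many factors equal $1$). *)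

(* Defs.v *)
From HB Require Import structures.
From mathcomp Require Import all_boot all_order all_algebra.
From mathcomp Require Import fraction generic_quotient complex.
From mathcomp Require Import all_classical all_reals all_analysis.

Set Implicit Arguments.
Unset Strict Implicit.
Unset Printing Implicit Defensive.

Import Order.TTheory GRing.Theory Num.Theory.
Import numFieldNormedType.Exports.

Local Open Scope classical_set_scope.
Local Open Scope ring_scope.
Local Open Scope quotient_scope.

Record prime_nat := PrimeNat { prime_val :> nat ; primeP : prime prime_val }.

HB.instance Definition _ := [isSub for prime_val].
HB.instance Definition _ := [Countable of prime_nat by <:].

Section PadicInt.
Variable p : prime_nat.

(* Z_p as the inverse limit of the Z / p^k: the k-th term is the representative
   in {0, ..., p^k - 1} of the residue modulo p^k. *)
Record padic_int := PadicInt {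
  residue :> nat -> nat ;
  residueP : forall k, residue k = (residue k.+1 %% p ^ k)%N }.

HB.instance Definition _ := gen_eqMixin padic_int.
HB.instance Definition _ := gen_choiceMixin padic_int.

Lemma padic_intP (x y : padic_int) : (forall k, x k = y k) -> x = y.
Proof.
case: x y => [x xP] [y yP] /= /funext xy; move: xP yP; rewrite xy => xP yP.
by congr PadicInt; apply: Prop_irrelevance.
Qed.

Let pk_gt0 k : (0 < p ^ k)%N.
Proof. by rewrite expn_gt0 prime_gt0 ?primeP. Qed.

Lemma residue_mod (x : padic_int) k l : (k <= l)%N -> (x l %% p ^ k)%N = x k.
Proof.
move=> /subnKC <-; elim: (l - k)%N => [|d IHd].
  by rewrite addn0 residueP modn_mod.
rewrite addnS -[RHS]IHd [in RHS]residueP modn_dvdm //.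
by rewrite dvdn_exp2l ?leq_addr.
Qed.

Lemma residue_modS (x : padic_int) k : (x k.+1 %% p ^ k)%N = x k.
Proof. by rewrite residue_mod. Qed.

Lemma residue_id (x : padic_int) k : (x k %% p ^ k)%N = x k.
Proof. by rewrite residue_mod. Qed.

Let dvd_pS k : (p ^ k %| p ^ k.+1)%N.
Proof. by rewrite dvdn_exp2l. Qed.

Let pi_subproof n k : (n %% p ^ k)%N = ((n %% p ^ k.+1) %% p ^ k)%N.
Proof. by rewrite modn_dvdm. Qed.
Definition padic_of_nat n := PadicInt (pi_subproof n).

Let add_subproof (x y : padic_int) k :
  ((x k + y k) %% p ^ k)%N = (((x k.+1 + y k.+1) %% p ^ k.+1) %% p ^ k)%N.
Proof. by rewrite modn_dvdm // -[in RHS]modnDm !residue_modS. Qed.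
Definition padic_add x y := PadicInt (add_subproof x y).

Let mul_subproof (x y : padic_int) k :
  ((x k * y k) %% p ^ k)%N = (((x k.+1 * y k.+1) %% p ^ k.+1) %% p ^ k)%N.
Proof. by rewrite modn_dvdm // -[in RHS]modnMm !residue_modS. Qed.
Definition padic_mul x y := PadicInt (mul_subproof x y).

Let opp_subproof (x : padic_int) k :
  ((p ^ k - x k) %% p ^ k)%N = (((p ^ k.+1 - x k.+1) %% p ^ k.+1) %% p ^ k)%N.
Proof.
have lt_x l : (x l <= p ^ l)%N by rewrite ltnW // -residue_id ltn_mod.
rewrite modn_dvdm //; apply/eqP; rewrite -(eqn_modDr (x k.+1)) subnK //.
rewrite -modnDmr residue_modS subnK // modnn eq_sym; exact: dvd_pS.
Qed.
Definition padic_opp x := PadicInt (opp_subproof x).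

Fact padic_addA : associative padic_add.
Proof. by move=> x y z; apply: padic_intP => k /=; rewrite modnDmr modnDml addnA. Qed.

Fact padic_addC : commutative padic_add.
Proof. by move=> x y; apply: padic_intP => k /=; rewrite addnC. Qed.

Fact padic_add0 : left_id (padic_of_nat 0) padic_add.
Proof. by move=> x; apply: padic_intP => k /=; rewrite mod0n residue_id. Qed.

Fact padic_addN : left_inverse (padic_of_nat 0) padic_opp padic_add.
Proof.
move=> x; apply: padic_intP => k /=; rewrite modnDml subnK ?modnn ?mod0n //.
by rewrite ltnW // -residue_id ltn_mod.
Qed.

HB.instance Definition _ :=
  GRing.isZmodule.Build padic_int padic_addA padic_addC padic_add0 padic_addN.

Fact padic_mulA : associative padic_mul.
Proof. by move=> x y z; apply: padic_intP => k /=; rewrite modnMmr modnMml mulnA. Qed.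

Fact padic_mulC : commutative padic_mul.
Proof. by move=> x y; apply: padic_intP => k /=; rewrite mulnC. Qed.

Fact padic_mul1 : left_id (padic_of_nat 1) padic_mul.
Proof. by move=> x; apply: padic_intP => k /=; rewrite modnMml mul1n residue_id. Qed.

Fact padic_mulD : left_distributive padic_mul padic_add.
Proof.
by move=> x y z; apply: padic_intP => k /=; rewrite modnMml modnDm mulnDl.
Qed.

Fact padic_one_neq0 : padic_of_nat 1 != 0.
Proof.
apply/eqP => /(congr1 (fun x : padic_int => x 1%N)) /=.
by rewrite mod0n modn_small // expn1 prime_gt1 // primeP.
Qed.

HB.instance Definition _ := GRing.Zmodule_isComNzRing.Build padic_int
  padic_mulA padic_mulC padic_mul1 padic_mulD padic_one_neq0.

Definition padic_unit : pred padic_int := [pred x | `[< exists y, y * x = 1 >]].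
Definition padic_inv (x : padic_int) : padic_int := xget x [set y | y * x = 1].

Fact padic_mulV : {in padic_unit, left_inverse 1 padic_inv *%R}.
Proof. by move=> x /asboolP [y yx]; rewrite /padic_inv; case: xgetP => // /(_ y). Qed.

Fact padic_unitP (x y : padic_int) : y * x = 1 -> padic_unit x.
Proof. by move=> yx; apply/asboolP; exists y. Qed.

Fact padic_inv_out : {in [predC padic_unit], padic_inv =1 id}.
Proof.
move=> x /negP nx; rewrite /padic_inv; case: xgetP => // y _ yx.
by case: nx; apply: padic_unitP yx.
Qed.

HB.instance Definition _ := GRing.ComNzRing_hasMulInverse.Build padic_int
  padic_mulV padic_unitP padic_inv_out.

Fact padic_idomain (x y : padic_int) : x * y = 0 -> (x == 0) || (y == 0).
Proof.
move=> xy0; apply/contraT; rewrite negb_or => /andP [x0 y0].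
have nz (z : padic_int) : z != 0 -> exists k, z k != 0%N.
  move=> z0; apply: contrapT => /forallNP zk; case/eqP: z0; apply: padic_intP => k.
  by have /negP := zk k; rewrite negbK => /eqP ->; rewrite /= mod0n.
have [[k xk] [l yl]] := (nz x x0, nz y y0).
have xkl : ~~ (p ^ k %| x (k + l)%N)%N.
  by rewrite /dvdn residue_mod ?leq_addr.
have ykl : ~~ (p ^ l %| y (k + l)%N)%N.
  by rewrite /dvdn residue_mod ?leq_addl.
have pos a b : ~~ (p ^ a %| b)%N -> (0 < b)%N by case: b => //; rewrite dvdn0.
have : (p ^ (k + l) %| x (k + l) * y (k + l))%N.
  have /(congr1 (fun z : padic_int => z (k + l)%N)) /= := xy0.
  by rewrite mod0n /dvdn => ->.
have pp := primeP p.
have [x_gt0 y_gt0] := (pos _ _ xkl, pos _ _ ykl).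
move: xkl ykl; rewrite !pfactor_dvdn ?muln_gt0 ?x_gt0 ?y_gt0 // lognM // -!ltnNge.
by move=> lx ly; rewrite leqNgt -addnS leq_add // ltnW.
Qed.

HB.instance Definition _ :=
  GRing.ComUnitRing_isIntegral.Build padic_int padic_idomain.

End PadicInt.

Section Padic.
Variable p : prime_nat.

Definition padic := {fraction padic_int p}.

HB.instance Definition _ := GRing.Field.on padic.
HB.instance Definition _ := isPointed.Build padic 0.

Definition padic_of_int (x : padic_int p) : padic := tofrac x.

HB.instance Definition _ := GRing.RMorphism.copy padic_of_int (@tofrac (padic_int p)).

Definition padicZ : set padic := range padic_of_int.

Definition padicZ_units : set padic := padic_of_int @` [set u | u \is a GRing.unit].

(* The integer k such that x is p^k times a unit; the value at 0 is junk. *)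
Definition padic_ord (x : padic) : int :=
  xget 0 [set k : int | exists2 u, padicZ_units u & x = (p : nat)%:R ^ k * u].

Definition padic_ball (x : padic) (k : nat) : set padic :=
  [set y | exists2 z, padicZ z & y = x + (p : nat)%:R ^+ k * z].

Definition padic_nbhs (x : padic) : set_system padic :=
  filter_from [set: nat] (padic_ball x).

HB.instance Definition _ := hasNbhs.Build padic padic_nbhs.

Lemma padicZD (x y : padic) : padicZ x -> padicZ y -> padicZ (x + y).
Proof. by move=> [a _ <-] [b _ <-]; exists (a + b) => //; rewrite rmorphD. Qed.

Lemma padicZM (x y : padic) : padicZ x -> padicZ y -> padicZ (x * y).
Proof. by move=> [a _ <-] [b _ <-]; exists (a * b) => //; rewrite rmorphM. Qed.

Lemma padicZ_nat m : padicZ m%:R.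
Proof. by exists m%:R => //; rewrite rmorph_nat. Qed.

Lemma padic_ball_center x k : padic_ball x k x.
Proof. by exists 0; [exact: (padicZ_nat 0) | rewrite mulr0 addr0]. Qed.

Lemma padic_ballS x k l : (k <= l)%N -> padic_ball x l `<=` padic_ball x k.
Proof.
move=> /subnKC <- y [z Zz ->]; exists ((p : nat)%:R ^+ (l - k) * z).
  by apply: padicZM => //; rewrite -natrX; exact: padicZ_nat.
by rewrite mulrA -exprD.
Qed.

Lemma padic_ball_trans x y k : padic_ball x k y -> padic_ball y k `<=` padic_ball x k.
Proof.
move=> [z Zz ->] t [w Zw ->]; exists (z + w); first exact: padicZD.
by rewrite mulrDr addrA.
Qed.

Fact padic_nbhs_filter (x : padic) : ProperFilter (nbhs x).
Proof.
apply: filter_from_proper => [|k _]; last by exists x; exact: padic_ball_center.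
apply: filter_from_filter => [|k l _ _]; first by exists 0%N.
exists (maxn k l) => // y xy; split.
  exact: (padic_ballS (leq_maxl k l)).
exact: (padic_ballS (leq_maxr k l)).
Qed.

Fact padic_nbhs_singleton (x : padic) (A : set padic) : nbhs x A -> A x.
Proof. by case=> k _; apply; exact: padic_ball_center. Qed.

Fact padic_nbhs_nbhs (x : padic) (A : set padic) : nbhs x A -> nbhs x (nbhs^~ A).
Proof.
case=> k _ sA; exists k => // y xy; exists k => //.
exact: subset_trans (padic_ball_trans xy) sA.
Qed.

HB.instance Definition _ := Nbhs_isNbhsTopological.Build padic
  padic_nbhs_filter padic_nbhs_singleton padic_nbhs_nbhs.

End Padic.

Section QuadraticForms.
Variables (p : prime_nat) (n : nat).
Local Notation Qp := (padic p).
Local Notation toQp := (map_mx (@padic_of_int p)).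

(* The form Q(x) = x^T G x is given by its Gram matrix G; its matrix of second
   partial derivatives is then 2 G. *)
Record qform := QForm {
  gram :> 'M[Qp]_n ;
  gramP : (gram^T == gram) && (gram \in unitmx) }.

HB.instance Definition _ := [isSub for gram].
HB.instance Definition _ := [Choice of qform by <:].

Implicit Types Q : qform.

Definition qval Q (x : 'cV[Qp]_n) : Qp := (x^T *m Q *m x) ord0 ord0.

Definition hessian Q : 'M[Qp]_n := 2%:R *: (Q : 'M[Qp]_n).

Definition detH Q : Qp := \det (hessian Q).

Definition Zp_valued Q : Prop := forall x : 'cV[padic_int p]_n, padicZ (qval Q (toQp x)).

Definition value_span Q : set Qp :=
  [set y | exists (m : nat) (c : 'I_m -> padic_int p) (x : 'I_m -> 'cV[padic_int p]_n),
     y = \sum_(i < m) padic_of_int (c i) * qval Q (toQp (x i))].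

Definition primitive Q : Prop := Zp_valued Q /\ value_span Q = @padicZ p.

Definition Zp_equiv Q Q' : Prop :=
  exists2 U : 'M[padic_int p]_n, U \in unitmx & (Q' : 'M[Qp]_n) = (toQp U)^T *m Q *m toQp U.

Definition Zp_equivb Q Q' : bool := `[< Zp_equiv Q Q' >].

Fact Zp_equivb_refl : reflexive Zp_equivb.
Proof.
move=> Q; apply/asboolP; exists 1%:M; first exact: unitmx1.
by rewrite map_mx1 trmx1 mul1mx mulmx1.
Qed.

Fact Zp_equivb_sym : symmetric Zp_equivb.
Proof.
suff sym Q Q' : Zp_equiv Q Q' -> Zp_equiv Q' Q.
  by move=> Q Q'; apply/asboolP/asboolP; exact: sym.
move=> [U Uu e]; exists (invmx U); first by rewrite unitmx_inv.
rewrite e !mulmxA -trmx_mul -!mulmxA -map_mxM (mulmxV Uu) map_mx1.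
by rewrite trmx1 mul1mx mulmx1.
Qed.

Fact Zp_equivb_trans : transitive Zp_equivb.
Proof.
move=> Q2 Q1 Q3 /asboolP [U Uu e2] /asboolP [V Vu e3]; apply/asboolP.
exists (U *m V); first by rewrite unitmx_mul Uu.
by rewrite e3 e2 map_mxM trmx_mul !mulmxA.
Qed.

Canonical Zp_equiv_rel := EquivRel Zp_equivb Zp_equivb_refl Zp_equivb_sym Zp_equivb_trans.

(* Z_p-equivalence classes of all non-degenerate forms; the attributes of a
   class below (primitivity, detH up to unit squares, Hasse invariant, local
   density) are read off a representative. *)
Definition local_genus := {eq_quot Zp_equiv_rel}.
HB.instance Definition _ := Choice.on local_genus.

Definition hilbert (a b : Qp) : int :=
  if `[< exists x y z, (x, y, z) != (0, 0, 0) /\ z ^+ 2 = a * x ^+ 2 + b * y ^+ 2 >]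
  then 1 else -1.

Definition diagonalization Q : 'rV[Qp]_n :=
  xget 0 [set a | exists2 P, P \in unitmx & P^T *m Q *m P = diag_mx a].

Definition hasse Q : int :=
  let a := diagonalization Q in
  \prod_(i < n) \prod_(j < n | (i < j)%N) hilbert (a ord0 i) (a ord0 j).

End QuadraticForms.

Section LocalDensity.
Variables (R : realType) (p : prime_nat) (n : nat).
Local Notation Qp := (padic p).
Local Notation Mn := 'M[Qp]_n.
Local Notation borel := (g_sigma_algebraType (@open 'M[Qp]_n)).

(* Haar measure on a closed subgroup H of Mn normalized by mu K = 1, for K a
   compact open subgroup of H, viewed as a Borel measure on Mn carried by H. *)
Definition is_haar (H K : set Mn) (mu : {measure set borel -> \bar R}) : Prop :=
  [/\ mu (~` H) = 0%E,
      forall (h : Mn) (A : set borel), H h -> measurable A ->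
        mu [set h + x | x in (A : set Mn)] = mu A
    & mu K = 1%E].

Definition haar (H K : set Mn) : set Mn -> \bar R :=
  xget (fun _ : set Mn => 0%E)
    [set f : set Mn -> \bar R |
      exists2 mu : {measure set borel -> \bar R}, is_haar H K mu & f = mu].

Definition Mat_Zp : set Mn := [set X | forall i j, padicZ (X i j)].
Definition Sym_Qp : set Mn := [set X | X^T = X].
Definition Sym_Zp : set Mn := Sym_Qp `&` Mat_Zp.

Definition vol_Mat : set Mn -> \bar R := haar Mat_Zp Mat_Zp.
Definition vol_Sym : set Mn -> \bar R := haar Sym_Qp Sym_Zp.

Definition open_in_Sym : set (set Mn) :=
  [set U | exists2 V : set Mn, open V & U = V `&` Sym_Qp].

(* Open neighbourhoods of G in Sym_n(Q_p) shrinking to G. *)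
Definition shrinking_nbhs (G : Mn) : set_system (set Mn) :=
  within open_in_Sym (powerset_filter_from (within Sym_Qp (nbhs G))).

Definition local_density (Q : qform p n) : R :=
  2^-1 * lim (fine (vol_Mat [set X | Mat_Zp X /\ U (X^T *m Q *m X)])
              / fine (vol_Sym U) @[U --> shrinking_nbhs Q]).

(* beta_{n,p}; for n odd the set below is a singleton. *)
Definition std_density : R :=
  xget 0 [set b | exists Q : qform p n,
    [/\ primitive Q, padic_ord (detH Q) = padic_ord (2%:R : Qp) & b = local_density Q]].

Definition genera (S : nat) (e : int) : set (local_genus p n) :=
  [set g | let Q := repr g in
     [/\ primitive Q,
         exists2 u, padicZ_units u & detH Q = S%:R * u ^+ 2
       & hasse Q = e]].

Definition mass_sum (e : int) (S : nat) : R :=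
  \sum_(g \in genera S e) (std_density / local_density (repr g)).

Definition A_loc (S : nat) : R := mass_sum 1 S + mass_sum (-1) S.
Definition B_loc (S : nat) : R := mass_sum 1 S - mass_sum (-1) S.

End LocalDensity.

Definition A_glob (R : realType) (n S : nat) : R :=
  \big[*%R/1]_(p \in [set: prime_nat]) A_loc R p n S.

Definition B_glob (R : realType) (n S : nat) : R :=
  \big[*%R/1]_(p \in [set: prime_nat]) B_loc R p n S.

(* The series \sum_(S >= 1) a S / S^s; the value a 0 is irrelevant. *)
Definition dirichlet_series (C : Type) := nat -> C.

(* The power series \sum_k f k X^k. *)
Definition power_series (C : Type) := nat -> C.

Definition D_A (R : realType) (n : nat) : dirichlet_series R[i] :=
  fun S => (A_glob R n S)%:C%C.

Definition D_B (R : realType) (n : nat) : dirichlet_series R[i] :=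
  fun S => (B_glob R n S)%:C%C.

(* Expanding \prod_p E_p(p^-s), the coefficient of S^-s is the product over p
   of the coefficient of X^(ord_p S) in E_p; almost all factors are 1. *)
Definition is_euler_product (C : fieldType) (a : dirichlet_series C)
    (E : prime_nat -> power_series C) : Prop :=
  (forall p : prime_nat, odd p -> E p 0%N = 1) /\
  (forall S : nat, (0 < S)%N ->
     a S = \big[*%R/1]_(p \in [set: prime_nat]) E p (logn p S)).

Definition is_rational (C : fieldType) (f : power_series C) : Prop :=
  exists P Q : {poly C}, Q != 0 /\
    forall k, \sum_(i < k.+1) Q`_i * f (k - i)%N = P`_k.

(* Main.v *)
(** A primitive form is encoded by its Hessian H = L + L^T. Its local density is
    inversely proportional to the volume of its GL_n(Z_p)-orbit, so the mass sum for
    a Hasse invariant and a determinant S is the volume of the set of all primitive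
    Hessians with these invariants, divided by the volume of the orbit of the standard
    genus.

    Locally, fix a condition P on symmetric matrices over Q_p that is invariant under
    congruence, and let v(k) be the volume of the H with P(H) and ord (det H) = k.
    Split according to the residue class of H modulo p. In a nonzero class there is a
    unit minor of size 1 or 2, and Schur complements reduce to a smaller dimension; in
    the zero class H = p H', which relates v to its own shift by n and to the same
    count for the condition P(p H), and two such steps come back to P because scaling
    by p^2 is a congruence. Hence the series of v is rational.

    Globally, multiplying a form by a p-adic unit u multiplies the Hasse invariant by
    (u, u)^(n (n - 1) / 2), which is 1 for odd p and a quadratic character chi of u for
    p = 2. So A_p(S) depends only on ord_p S, whereas the Euler factor of B at an odd
    p picks up the constant chi(p). Each squareclass contains a single class of forms of
    minimal determinant, which gives the value 1 for p prime to 2 S and a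
    nonzero value for p = S = 2. The coefficients at 2^k and 2 p^k then determine the
    Euler factors. *)
Require Import Defs.
From mathcomp Require Import all_boot all_order all_algebra.
From mathcomp Require Import fingroup perm fraction generic_quotient complex.
From mathcomp Require Import all_classical all_reals all_analysis.
From mathcomp Require Import zify ring.

Set Implicit Arguments.
Unset Strict Implicit.
Unset Printing Implicit Defensive.

Import Order.TTheory GRing.Theory Num.Theory.
Import numFieldNormedType.Exports.

Local Open Scope classical_set_scope.
Local Open Scope ring_scope.

(** * p-adic integers *)

(** [haar] returns 0 unless a Haar measure exists, so one is constructed: Lebesgue measure on [0, 1)
    is transported along p-adic digit expansions and glued over the lattices p^-j K. Afterwards
    volumes are compared on unions of residue classes modulo p^k, where a translation invariant
    content is determined by counting classes; this takes the place of Jacobians. Orbits become such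
    unions by Hensel's lemma in the form: a symmetric matrix with determinant of order k is
    equivalent to every symmetric matrix congruent to it modulo p^(k + 3), for all p including 2.

    The condition P stays abstract because Schur complements turn it into another condition of the
    same kind, whatever the Hasse invariant does under orthogonal sums. That invariant is evaluated
    on an unspecified diagonalisation, so its values under scaling and on unimodular forms rest on
    Witt cancellation and on bimultiplicative Hilbert symbols.

    The Euler factor at 2 has no normalised constant term, and this term may vanish; hence the
    factor at p is isolated by the coefficients at 2 p^k and not by those at p^k. *)

Section PadicIntegers.
Variable p : prime_nat.
Implicit Types x y z : padic_int p.

Local Notation pr := ((p : nat)%:R : padic_int p).

Lemma p_gt0 : (0 < p)%N. Proof. by rewrite prime_gt0 ?Defs.primeP. Qed.
Lemma p_gt1 : (1 < p)%N. Proof. by rewrite prime_gt1 ?Defs.primeP. Qed.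
Lemma pX_gt0 k : (0 < p ^ k)%N. Proof. by rewrite expn_gt0 p_gt0. Qed.
Hint Resolve p_gt0 p_gt1 pX_gt0 : core.

Lemma residueD x y k : (x + y) k = ((x k + y k) %% p ^ k)%N.
Proof. by []. Qed.
Lemma residueM x y k : (x * y) k = ((x k * y k) %% p ^ k)%N.
Proof. by []. Qed.
Lemma residue0 k : (0 : padic_int p) k = 0%N.
Proof. by rewrite /= mod0n. Qed.
Lemma residue_nat m k : (m%:R : padic_int p) k = (m %% p ^ k)%N.
Proof.
elim: m => [|m IHm]; first by rewrite residue0 mod0n.
by rewrite mulrSr residueD IHm /= modnDm addn1.
Qed.
Lemma residue_lt x k : (x k < p ^ k)%N.
Proof. by rewrite -residue_id ltn_mod. Qed.

Lemma residue_nat_id x k : ((x k)%:R : padic_int p) k = x k.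
Proof. by rewrite residue_nat residue_id. Qed.

(** Coherence of the shifted residues x (j + k) / p^k, which are those of the quotient of x by
    p^k. *)
Lemma dvdpX_subproof x k (xk : x k = 0%N) j :
  (x (j + k)%N %/ p ^ k = (x (j.+1 + k)%N %/ p ^ k) %% p ^ j)%N.
Proof.
have dv l : (k <= l)%N -> (p ^ k %| x l)%N by move=> kl; rewrite /dvdn residue_mod // xk.
rewrite -[x (j + k)%N](residue_mod x (leqnSn (j + k))) -addSn.
move: (x (j.+1 + k)%N) (dv _ (leq_addl j.+1 k)) => m /dvdnP[q ->].
by rewrite expnD -muln_modl !mulnK.
Qed.

Lemma residue_eq0P x k : x k = 0%N <-> exists y, x = pr ^+ k * y.
Proof.
split=> [xk|[y ->]]; last first.
  by rewrite residueM -natrX residue_nat modnn mul0n mod0n.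
exists (PadicInt (dvdpX_subproof xk)); apply: padic_intP => j.
rewrite residueM -natrX residue_nat modnMml /=.
rewrite mulnC divnK; last by rewrite /dvdn residue_mod ?leq_addl // xk.
by rewrite residue_mod // leq_addr.
Qed.

Lemma residue_eqP x y k : x k = y k <-> exists z, x = y + pr ^+ k * z.
Proof.
have subE : (x - y) k = 0%N <-> x k = y k.
  rewrite residueD /=; split=> [/eqP|->]; last first.
    by rewrite modnDmr subnKC ?modnn // ltnW // residue_lt.
  rewrite modnDmr -[X in _ == X](mod0n (p ^ k)) -(eqn_modDr (y k)) add0n.
  rewrite -addnA subnK ?(ltnW (residue_lt _ _)) // modnDr !residue_id.
  by move=> /eqP.
rewrite -subE residue_eq0P; split=> [[z e]|[z ->]]; exists z; last by ring.
by rewrite -e; ring.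
Qed.

(** Completeness of Z_p, in the form that produces inverses, fixed points and digit expansions
    below. *)
Lemma residue_limit (f : nat -> padic_int p) :
  (forall k, f k.+1 k = f k k) -> exists x, forall k, x k = f k k.
Proof.
move=> fk.
have sub k : f k k = (f k.+1 k.+1 %% p ^ k)%N by rewrite -residueP fk.
by exists (PadicInt sub).
Qed.

Lemma residue_unitP x : reflect (x 1%N <> 0%N) (x \is a GRing.unit).
Proof.
apply: (iffP idP) => [xu x1|x1].
  have /(congr1 (fun z : padic_int p => z 1%N)) := mulrV xu.
  by rewrite residueM x1 mul0n mod0n /= expn1 modn_small.
have cop k : coprime (x k) (p ^ k).
  case: k => [|k]; first by rewrite coprimen1.
  rewrite coprimeXr // coprime_sym prime_coprime ?Defs.primeP // /dvdn.
  by rewrite -[X in (_ %% X)%N]expn1 residue_mod //; apply/eqP.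
(* Level k + 1 is used because the residue at level 0 is 0, whereas Bezout's identity is applied to
   a positive number. *)
have inv k : exists m, (m * x k.+1 = 1 %[mod p ^ k.+1])%N.
  have x0 : (0 < x k.+1)%N.
    case: (posnP (x k.+1)) => // xk; case: x1.
    by rewrite -(residue_mod x (ltn0Sn k)) xk mod0n.
  case: (egcdnP (p ^ k.+1) x0) => km kn e _.
  exists km; rewrite e addnC (eqP (cop _)).
  by rewrite -modnDmr modnMl addn0.
have [g gP] := choice inv.
(* The chosen inverses are coherent because an inverse modulo p^k is unique. *)
have [k|y yP] := @residue_limit (fun k => (g k)%:R).
  rewrite !residue_nat; apply/eqP.
  have cp : coprime (p ^ k) (x k.+1).
    have := cop k.+1; rewrite coprime_sym; apply: coprime_dvdl.
    by rewrite dvdn_exp2l.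
  rewrite -(eqn_modDr 0) !addn0.
  have e1 : (g k.+1 * x k.+1 = 1 %[mod p ^ k])%N.
    have := gP k.+1; move/(congr1 (modn^~ (p ^ k)%N)).
    rewrite !modn_dvdm ?dvdn_exp2l ?leqW // => <-.
    by rewrite -[LHS]modnMmr -[RHS]modnMmr !residue_mod // ltnW.
  have e2 : (g k * x k.+1 = 1 %[mod p ^ k])%N.
    have := gP k; move/(congr1 (modn^~ (p ^ k)%N)).
    by rewrite !modn_dvdm ?dvdn_exp2l.
  have mm a b : (a * x k.+1 = b * x k.+1 %[mod p ^ k] -> a = b %[mod p ^ k])%N.
    wlog ab : a b / (b <= a)%N => [W|].
      by case/orP: (leq_total b a) => ab // e; [apply: W|apply/esym; apply: W].
    move=> /eqP; rewrite eqn_mod_dvd ?leq_mul2r ?ab ?orbT //.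
    by rewrite -mulnBl Gauss_dvdl // -eqn_mod_dvd // => /eqP.
  by apply/eqP/mm; rewrite e1 e2.
apply/unitrP; exists y; have e : y * x = 1.
  apply: padic_intP => k; rewrite residueM yP residue_nat modnMml /=.
  have := gP k; move/(congr1 (modn^~ (p ^ k)%N)).
  rewrite !modn_dvdm ?dvdn_exp2l // => <-.
  by rewrite -[RHS]modnMmr residue_mod // modnMmr.
by split=> //; rewrite mulrC.
Qed.

Lemma pr_neq0 : pr != 0.
Proof.
apply/eqP => /(congr1 (fun x : padic_int p => x 2%N)).
rewrite residue_nat residue0 modn_small; first by have := p_gt0; case: (p : nat).
by rewrite -[X in (X < _)%N]expn1 ltn_exp2l.
Qed.
Hint Resolve pr_neq0 : core.

Lemma prX_neq0 k : pr ^+ k != 0.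
Proof. by rewrite expf_neq0. Qed.
Hint Resolve prX_neq0 : core.

Lemma nonunit_dvd x : x \isn't a GRing.unit -> exists y, x = pr * y.
Proof.
move=> /residue_unitP/contrapT/residue_eq0P[y ->].
by exists y; rewrite expr1.
Qed.

Lemma pr_nonunit x : pr * x \isn't a GRing.unit.
Proof. by apply/residue_unitP; apply; apply/residue_eq0P; exists x. Qed.

Lemma unit_cong x y : x 1%N = y 1%N -> (x \is a GRing.unit) = (y \is a GRing.unit).
Proof. by move=> e; apply/residue_unitP/residue_unitP; rewrite e. Qed.

Lemma unit_add_pr x y : (x + pr * y \is a GRing.unit) = (x \is a GRing.unit).
Proof. by apply: unit_cong; apply/residue_eqP; exists y; rewrite expr1. Qed.

Lemma zp_ordP x : x != 0 -> exists k, exists2 u, u \is a GRing.unit & x = pr ^+ k * u.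
Proof.
move=> x0; have [k xk] : exists k, x k != 0%N.
  apply: contrapT => /forallNP xk; case/eqP: x0; apply: padic_intP => k.
  by rewrite residue0; apply/eqP/negPn/negP; exact: xk.
elim: k x {x0} xk => [|k IHk] x xk.
  by case/negP: xk; have := residue_lt x 0; rewrite expn0; case: (x 0%N).
have [xu|/nonunit_dvd[y xy]] := boolP (x \is a GRing.unit).
  by exists 0%N, x; rewrite ?mul1r.
have [|l [u uu yu]] := IHk y; last by exists l.+1, u; rewrite // exprS -mulrA -yu.
apply: contra xk => /eqP /residue_eq0P[z yz]; apply/eqP/residue_eq0P.
by exists z; rewrite xy yz exprS mulrA.
Qed.

Lemma ord_uniq k l u v : u \is a GRing.unit -> v \is a GRing.unit ->
  pr ^+ k * u = pr ^+ l * v -> k = l.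
Proof.
wlog kl : k l u v / (k <= l)%N => [W uu vu e|].
  by case/orP: (leq_total k l) => kl; [apply: (W _ _ u v)|apply/esym/(W _ _ v u)].
move=> uu vu; rewrite -(subnKC kl) exprD -mulrA => /(mulfI (prX_neq0 k)) e.
case: (l - k)%N e => [|m]; first by rewrite addn0.
by rewrite exprS -mulrA => e; move: uu; rewrite e (negbTE (pr_nonunit _)).
Qed.

Lemma residue_cong_le x y k l : (k <= l)%N -> x l = y l -> x k = y k.
Proof. by move=> kl e; rewrite -(residue_mod x kl) e residue_mod. Qed.

End PadicIntegers.

#[global] Hint Resolve p_gt0 p_gt1 pX_gt0 pr_neq0 prX_neq0 : core.
Notation pz p := ((Defs.prime_val p)%:R : padic_int p).
Notation toQ := (map_mx (@padic_of_int _)).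

(** * The field of p-adic numbers *)

Section PadicField.
Variable p : prime_nat.
Implicit Types (x y u : padic_int p) (a b : padic p).

Lemma pQ_inj : injective (@padic_of_int p).
Proof. by move=> x y /eqP; rewrite tofrac_eq => /eqP. Qed.

Lemma pQM x y : padic_of_int (x * y) = padic_of_int x * padic_of_int y.
Proof. exact: rmorphM. Qed.
Lemma pQD x y : padic_of_int (x + y) = padic_of_int x + padic_of_int y.
Proof. exact: rmorphD. Qed.
Lemma pQN x : padic_of_int (- x) = - padic_of_int x.
Proof. exact: rmorphN. Qed.
Lemma pQB x y : padic_of_int (x - y) = padic_of_int x - padic_of_int y.
Proof. exact: rmorphB. Qed.
Lemma pQ1 : padic_of_int (1 : padic_int p) = 1.
Proof. exact: rmorph1. Qed.
Lemma pQ0 : padic_of_int (0 : padic_int p) = 0.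
Proof. exact: rmorph0. Qed.
Lemma pQX x k : padic_of_int (x ^+ k) = padic_of_int x ^+ k.
Proof. exact: rmorphXn. Qed.
Lemma pQ_nat k : padic_of_int (k%:R : padic_int p) = k%:R.
Proof. exact: rmorph_nat. Qed.

Lemma pQ_eq0 x : (padic_of_int x == 0) = (x == 0).
Proof. exact: tofrac_eq0. Qed.

Lemma pQ_pr k : padic_of_int (pz p ^+ k) = (p : nat)%:R ^+ k.
Proof. by rewrite pQX pQ_nat. Qed.

Lemma pq_neq0 : (p : nat)%:R != 0 :> padic p.
Proof. by rewrite -[X in X != 0]expr1 -pQ_pr pQ_eq0. Qed.
Hint Resolve pq_neq0 : core.

Lemma pqX_neq0 k : (p : nat)%:R ^+ k != 0 :> padic p.
Proof. by rewrite expf_neq0. Qed.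
Hint Resolve pqX_neq0 : core.

Lemma pQ_unitV u : u \is a GRing.unit -> padic_of_int u^-1 = (padic_of_int u)^-1.
Proof. by move=> uu; rewrite rmorphV. Qed.

Lemma padic_fracP a : exists x k, a = padic_of_int x / (p : nat)%:R ^+ k.
Proof.
have [x [y y0 ->]] : exists x, exists2 y : padic_int p, y != 0 & a = padic_of_int x / padic_of_int y.
  elim/quotW: a => f; exists (frac f).1, (frac f).2; first exact: denom_ratioP.
  apply: (canRL (mulfK _)); first by rewrite pQ_eq0 denom_ratioP.
  rewrite /padic_of_int; unlock FracField.tofrac; rewrite -[LHS]FracField.pi_mul.
  apply/eqmodP; rewrite /= FracField.equivfE /FracField.mulf.
  by rewrite !numden_Ratio ?(oner_neq0, mulf_neq0, mulr1, denom_ratioP) // mulrC.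
have [k [u uu ->]] := zp_ordP y0.
exists (x * u^-1), k; rewrite !pQM pQ_pr pQ_unitV // invfM.
by rewrite mulrCA mulrC.
Qed.

End PadicField.

(** * Congruences of matrices and Hensel's lemma *)

Section MatrixTranspose.
Variables (R : nzRingType) (m n : nat).
Implicit Types A B : 'M[R]_(m, n).
Lemma tr_mxD A B : (A + B)^T = A^T + B^T. Proof. exact: raddfD. Qed.
Lemma tr_mxN A : (- A)^T = - A^T. Proof. exact: raddfN. Qed.
Lemma tr_mxB A B : (A - B)^T = A^T - B^T. Proof. exact: raddfB. Qed.
Lemma tr_mxZ a A : (a *: A)^T = a *: A^T.
Proof. by apply/matrixP => i j; rewrite !mxE. Qed.
End MatrixTranspose.

Section Congruence.
Variable p : prime_nat.
Local Notation Zp := (padic_int p).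

Definition cong k m n (X Y : 'M[padic_int p]_(m, n)) : Prop :=
  forall i j, X i j k = Y i j k.

Lemma cong_refl k m n (X : 'M[Zp]_(m, n)) : cong k X X. Proof. by []. Qed.
Hint Resolve cong_refl : core.

Lemma cong_sym k m n (X Y : 'M[Zp]_(m, n)) : cong k X Y -> cong k Y X.
Proof. by move=> h i j; rewrite h. Qed.

Lemma cong_trans k m n (Y X Z : 'M[Zp]_(m, n)) : cong k X Y -> cong k Y Z -> cong k X Z.
Proof. by move=> h h' i j; rewrite h. Qed.

Lemma congP k m n (X Y : 'M[Zp]_(m, n)) : cong k X Y <-> exists Z, X = Y + pz p ^+ k *: Z.
Proof.
split=> [h|[Z ->] i j]; last by apply/residue_eqP; exists (Z i j); rewrite !mxE.
have /choice[Z hZ] : forall ij : 'I_m * 'I_n, exists z,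
    X ij.1 ij.2 = Y ij.1 ij.2 + pz p ^+ k * z.
  by move=> ij; apply/residue_eqP.
exists (\matrix_(i, j) Z (i, j)); apply/matrixP => i j; rewrite !mxE.
exact: (hZ (i, j)).
Qed.

Lemma cong_le k l m n (X Y : 'M[Zp]_(m, n)) : (k <= l)%N -> cong l X Y -> cong k X Y.
Proof. by move=> kl h i j; apply: residue_cong_le kl (h i j). Qed.

Lemma cong0 m n (X Y : 'M[Zp]_(m, n)) : cong 0 X Y.
Proof. by apply/congP; exists (X - Y); rewrite scale1r addrC subrK. Qed.

Lemma cong_eq m n (X Y : 'M[Zp]_(m, n)) : (forall k, cong k X Y) -> X = Y.
Proof. by move=> h; apply/matrixP => i j; apply: padic_intP => k; apply: h. Qed.

Lemma congD k m n (X Y X' Y' : 'M[Zp]_(m, n)) :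
  cong k X X' -> cong k Y Y' -> cong k (X + Y) (X' + Y').
Proof. by move=> h h' i j; rewrite !mxE !residueD h h'. Qed.

Lemma congZ k m n a (X Y : 'M[Zp]_(m, n)) : cong k X Y -> cong k (a *: X) (a *: Y).
Proof. by move=> h i j; rewrite !mxE !residueM h. Qed.

Lemma congN k m n (X Y : 'M[Zp]_(m, n)) : cong k X Y -> cong k (- X) (- Y).
Proof. by rewrite -!scaleN1r; apply: congZ. Qed.

Lemma congM k m n q (X X' : 'M[Zp]_(m, n)) (Y Y' : 'M[Zp]_(n, q)) :
  cong k X X' -> cong k Y Y' -> cong k (X *m Y) (X' *m Y').
Proof.
move=> h h' i j; rewrite !mxE.
apply: (big_ind2 (fun a b : padic_int p => a k = b k)) => //.
  by move=> a a' b b' ea eb; rewrite !residueD ea eb.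
by move=> l _; rewrite !residueM h h'.
Qed.

Lemma congT k m n (X Y : 'M[Zp]_(m, n)) : cong k X Y -> cong k X^T Y^T.
Proof. by move=> h i j; rewrite !mxE. Qed.

Lemma cong_pS k m n (X Y : 'M[Zp]_(m, n)) :
  cong k X Y -> cong k.+1 (pz p *: X) (pz p *: Y).
Proof.
move=> /congP[Z ->]; apply/congP; exists Z.
by rewrite scalerDr scalerA exprS.
Qed.

Lemma cong_det k n (X Y : 'M[Zp]_n) : cong k X Y -> (\det X) k = (\det Y) k.
Proof.
move=> h; rewrite /determinant.
apply: (big_ind2 (fun a b : padic_int p => a k = b k)) => //.
  by move=> a a' b b' ea eb; rewrite !residueD ea eb.
move=> s _; rewrite !residueM; congr (_ * _ %% _)%N.
apply: (big_ind2 (fun a b : padic_int p => a k = b k)) => //.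
by move=> a a' b b' ea eb; rewrite !residueM ea eb.
Qed.

Lemma unitmx_cong k n (X Y : 'M[Zp]_n) : (0 < k)%N -> cong k X Y ->
  (X \in unitmx) = (Y \in unitmx).
Proof.
by move=> k0 /(cong_le k0)/cong_det; rewrite !unitmxE; apply: unit_cong.
Qed.

(** Banach's fixed point theorem, for maps that gain one p-adic digit. The convergence of the
    iterates from 0 is recorded too, since algebraic identities are proved for the iterates and
    passed on to the limit. *)
Lemma cong_fixpoint m n (f : 'M[padic_int p]_(m, n) -> 'M[Zp]_(m, n)) :
  (forall k X Y, cong k X Y -> cong k.+1 (f X) (f Y)) ->
  exists2 X, X = f X & forall k, cong k X (iter k f 0).
Proof.
move=> fC; have it k : cong k (iter k.+1 f 0) (iter k f 0).
  by elim: k => [|k IHk]; [apply: cong0|apply: fC].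
have /choice[X XP] : forall ij : 'I_m * 'I_n, exists x : Zp,
    forall k, x k = (iter k f 0) ij.1 ij.2 k.
  by move=> ij; apply: residue_limit => k; apply: it.
have Xc k : cong k (\matrix_(i, j) X (i, j)) (iter k f 0).
  by move=> i j; rewrite mxE XP.
exists (\matrix_(i, j) X (i, j)) => //; apply: cong_eq => -[|k]; first exact: cong0.
by apply: cong_trans (Xc _) _; apply/fC/cong_sym.
Qed.

Definition zequiv n (H H' : 'M[padic_int p]_n) : Prop :=
  exists2 U, U \in unitmx & H' = U^T *m H *m U.

Lemma zequiv_refl n (H : 'M[Zp]_n) : zequiv H H.
Proof. by exists 1%:M; rewrite ?unitmx1 // trmx1 mul1mx mulmx1. Qed.

Lemma zequiv_trans n (H2 H1 H3 : 'M[Zp]_n) : zequiv H1 H2 -> zequiv H2 H3 -> zequiv H1 H3.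
Proof.
move=> [U Uu ->] [V Vu ->]; exists (U *m V); first by rewrite unitmx_mul Uu.
by rewrite trmx_mul !mulmxA.
Qed.

Lemma zequiv_sym n (H1 H2 : 'M[Zp]_n) : zequiv H1 H2 -> zequiv H2 H1.
Proof.
move=> [U Uu ->]; exists (invmx U); first by rewrite unitmx_inv.
by rewrite !mulmxA -trmx_mul mulmxV // trmx1 mul1mx -mulmxA mulmxV // mulmx1.
Qed.

Lemma zequiv_det n (H H' : 'M[Zp]_n) : zequiv H H' ->
  exists2 u, u \is a GRing.unit & \det H' = \det H * u ^+ 2.
Proof.
move=> [U Uu ->]; exists (\det U) => //.
by rewrite !det_mulmx det_tr; ring.
Qed.

Lemma zequiv_sym_mx n (H H' : 'M[Zp]_n) : zequiv H H' -> H^T = H -> H'^T = H'.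
Proof. by move=> [U Uu ->] e; rewrite !trmx_mul trmxK e mulmxA. Qed.

(** Lets Hensel's lemma treat all primes alike: 4 is p^2 for p = 2 and a unit otherwise. *)
Lemma four_dvd_p2 : exists c, pz p ^+ 2 = 4%:R * c.
Proof.
have [p2|p2] := eqVneq (p : nat) 2%N.
  by exists 1; rewrite mulr1 -natrX p2.
have u4 : 4%:R \is a @GRing.unit (padic_int p).
  apply/residue_unitP; rewrite residue_nat expn1 => /eqP; rewrite -/(dvdn _ _).
  by rewrite -[4%N]/(2 ^ 2)%N Euclid_dvdX ?Defs.primeP // andbT dvdn_prime2 ?Defs.primeP // (negbTE p2).
by exists (4%:R^-1 * pz p ^+ 2); rewrite mulrA divrr // mul1r.
Qed.

(** The equivalence is sought as X = 1 + 2 p Y with Y self-adjoint for H, so that X^T H X = H X^2 =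
    H + 4 p H (Y + p Y^2). Solving Y + p Y^2 = N reduces the claim to 4 p H N = p^(k + 3) S. Of the
    3 extra digits, two absorb the factor 4 and one makes the equation for Y contracting. *)
Lemma hensel_orbit n (H H' : 'M[padic_int p]_n) k u :
  H^T = H -> H'^T = H' -> u \is a GRing.unit -> \det H = pz p ^+ k * u ->
  cong (k + 3) H' H -> zequiv H H'.
Proof.
move=> Hs Hs' uu dH /congP[S eH'].
have Ss : S^T = S.
  have : (pz p ^+ (k + 3) *: S)^T = pz p ^+ (k + 3) *: S.
    have -> : pz p ^+ (k + 3) *: S = H' - H by rewrite eH' addrC addKr.
    by rewrite tr_mxB Hs Hs'.
  rewrite tr_mxZ => /matrixP e; apply/matrixP => i j.
  by have := e i j; rewrite [LHS]mxE [RHS]mxE => /(mulfI (prX_neq0 p _)).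
have [c cP] := four_dvd_p2.
(* Since H times its adjugate is p^k u, this solves H N = p^k c S over Z_p, although H itself need
   not be invertible there. *)
pose N := u^-1 *: (\adj H *m (c *: S)).
have HN : H *m N = (pz p ^+ k * c) *: S.
  rewrite /N -scalemxAr mulmxA mul_mx_adj dH mul_scalar_mx !scalerA.
  by congr (_ *: _); rewrite mulrCA mulVr // mulr1.
have NH : N^T *m H = H *m N.
  by rewrite -[LHS]trmxK trmx_mul trmxK Hs HN tr_mxZ Ss.
clearbody N; pose f Y := N - pz p *: (Y *m Y).
have [k' X Y XY|Y fY Yit] := @cong_fixpoint _ _ f.
  by apply: congD (cong_refl _ _) _; apply/congN/cong_pS/congM.
(* Self-adjointness survives the iteration because N is self-adjoint for H and so is the square of a
   self-adjoint matrix. *)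
have adj j : H *m iter j f 0 = (iter j f 0)^T *m H.
  elim: j => [|j IHj]; first by rewrite /= trmx0 mulmx0 mul0mx.
  rewrite iterS {1 3}/f tr_mxB tr_mxZ trmx_mul mulmxBr mulmxBl NH.
  by rewrite -scalemxAr -scalemxAl mulmxA IHj -!mulmxA IHj.
have HY : H *m Y = Y^T *m H.
  apply: cong_eq => j; apply: (@cong_trans _ _ _ (H *m iter j f 0)).
    exact: congM.
  by rewrite adj; apply: congM => //; apply/congT/cong_sym.
pose X := 1%:M + (2%:R * pz p) *: Y.
have HX : X^T *m H = H *m X.
  rewrite /X tr_mxD tr_mxZ trmx1 mulmxDl mulmxDr mul1mx mulmx1.
  by rewrite -scalemxAl -scalemxAr HY.
exists X.
  rewrite (@unitmx_cong 1 _ _ 1%:M) ?unitmx1 //; apply/congP; exists (2%:R *: Y).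
  by rewrite scalerA expr1 mulrC.
rewrite HX -mulmxA.
have -> : X *m X = 1%:M + (4%:R * pz p) *: N.
  have -> : N = Y + pz p *: (Y *m Y) by rewrite {1}fY subrK.
  rewrite /X mulmxDl !mulmxDr !mul1mx !mulmx1 -scalemxAl -scalemxAr !scalerA.
  rewrite scalerDr scalerA -!addrA; congr (_ + _).
  rewrite addrA -scalerDl; congr (_ *: _ + _ *: _); ring.
rewrite mulmxDr mulmx1 -scalemxAr HN scalerA eH'; congr (_ + _ *: _).
rewrite exprD -[3%N]/(2 + 1)%N exprD cP; ring.
Qed.

End Congruence.
#[global] Hint Resolve cong_refl : core.

(** * Topology and finitely additive volumes *)

Section MatrixTopology.
Variables (p : prime_nat) (n : nat).
Local Notation Zp := (padic_int p).
Local Notation Qp := (padic p).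
Local Notation borel := (g_sigma_algebraType (@open 'M[Qp]_n)).

Definition mball (k : nat) (X : 'M[Qp]_n) : set 'M[Qp]_n :=
  [set Y | exists Z : 'M[Zp]_n, Y = X + toQ (pz p ^+ k *: Z)].

Lemma toQ_inj m q : injective (fun X : 'M[Zp]_(m, q) => toQ X).
Proof.
by move=> X Y /matrixP e; apply/matrixP => i j; have := e i j; rewrite !mxE => /pQ_inj.
Qed.

Lemma toQD m q (X Y : 'M[Zp]_(m, q)) : toQ (X + Y) = toQ X + toQ Y.
Proof. by apply/matrixP => i j; rewrite !mxE pQD. Qed.
Lemma toQN m q (X : 'M[Zp]_(m, q)) : toQ (- X) = - toQ X.
Proof. by apply/matrixP => i j; rewrite !mxE pQN. Qed.
Lemma toQZ m q a (X : 'M[Zp]_(m, q)) : toQ (a *: X) = padic_of_int a *: toQ X.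
Proof. by apply/matrixP => i j; rewrite !mxE pQM. Qed.
Lemma toQM m q l (X : 'M[Zp]_(m, q)) (Y : 'M[Zp]_(q, l)) : toQ (X *m Y) = toQ X *m toQ Y.
Proof. exact: map_mxM. Qed.
Lemma toQ0 m q : toQ (0 : 'M[Zp]_(m, q)) = 0.
Proof. by apply/matrixP => i j; rewrite !mxE pQ0. Qed.
Lemma toQT m q (X : 'M[Zp]_(m, q)) : toQ X^T = (toQ X)^T.
Proof. by rewrite map_trmx. Qed.

Lemma mball_sym k X Y : mball k X Y -> mball k Y X.
Proof. by move=> [Z ->]; exists (- Z); rewrite scalerN toQN addrK. Qed.

Lemma mball_trans k Y X Z : mball k X Y -> mball k Y Z -> mball k X Z.
Proof.
by move=> [A ->] [B ->]; exists (A + B); rewrite scalerDr toQD addrA.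
Qed.

Lemma nbhs_mxP (X : 'M[Qp]_n) (A : set 'M[Qp]_n) :
  nbhs X A <-> exists k, mball k X `<=` A.
Proof.
split=> [[P PX PA]|[k kA]]; last first.
  exists (fun i j => padic_ball (X i j) k); first by move=> i j; exists k.
  move=> Y XY; apply: kA.
  have /choice[Z ZP] : forall ij : 'I_n * 'I_n, exists z : Zp,
      Y ij.1 ij.2 = X ij.1 ij.2 + (p : nat)%:R ^+ k * padic_of_int z.
    by move=> [i j] /=; have [_ [z _ <-] ->] := XY i j; exists z.
  exists (\matrix_(i, j) Z (i, j)); apply/matrixP => i j.
  by rewrite (ZP (i, j)) !mxE pQM pQ_pr.
have /choice[f fP] : forall ij : 'I_n * 'I_n, exists k,
    padic_ball (X ij.1 ij.2) k `<=` P ij.1 ij.2.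
  by move=> [i j]; have [k _ kP] := PX i j; exists k.
exists (\max_ij f ij) => Y [Z ->]; apply: PA => i j.
apply: (fP (i, j)); apply: padic_ballS (leq_bigmax (i, j)) _ _.
by exists (padic_of_int (Z i j)); [exists (Z i j)|rewrite !mxE pQM pQ_pr].
Qed.

Lemma mball_open k X : open (mball k X).
Proof.
rewrite openE => Y XY; apply/nbhs_mxP; exists k => Z; exact: mball_trans.
Qed.

Lemma open_mballP (U : set 'M[Qp]_n) :
  open U <-> forall X, U X -> exists k, mball k X `<=` U.
Proof. by rewrite openE; split=> h X /h /nbhs_mxP. Qed.

Lemma open_borel (U : set 'M[Qp]_n) : open U -> measurable (U : set borel).
Proof. by move=> oU; apply: sub_sigma_algebra. Qed.

Lemma padic_balls_disjoint (a b : Qp) : a != b ->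
  exists k, forall y z : Zp, a + (p : nat)%:R ^+ k * padic_of_int y <>
    b + (p : nat)%:R ^+ k * padic_of_int z.
Proof.
move=> ab; have [x [l e]] := padic_fracP (a - b).
have x0 : x != 0.
  by apply: contra_neq ab => x0; apply/eqP; rewrite -subr_eq0 e x0 pQ0 mul0r.
have [m [u uu eu]] := zp_ordP x0.
exists (m + 1)%N => y z h.
have : a - b = (p : nat)%:R ^+ (m + 1) * padic_of_int (z - y).
  by rewrite pQB -[a in LHS](addrK ((p : nat)%:R ^+ (m + 1) * padic_of_int y)) h; ring.
rewrite e => /(canRL (mulfVK (pqX_neq0 _ _))).
rewrite -!pQ_pr -!pQM => /pQ_inj; rewrite eu exprD -!mulrA.
move=> /(mulfI (prX_neq0 _ _)) e'; move: uu; rewrite e' expr1.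
by rewrite (negbTE (pr_nonunit _)).
Qed.

Lemma Sym_Qp_measurable : measurable (@Sym_Qp p n : set borel).
Proof.
rewrite -[X in measurable X]setCK; apply: measurableC; apply: open_borel.
apply/open_mballP => X /= nX.
have [i [j Xij]] : exists i j, X i j != X j i.
  apply: contrapT => h; apply: nX; apply/matrixP => i j; rewrite mxE.
  by apply/eqP/negPn/negP => hij; apply: h; exists j, i.
have [k kP] := padic_balls_disjoint Xij.
exists k => Y [Z ->] /matrixP /(_ j i); rewrite !mxE !pQM !pQ_pr.
exact: kP.
Qed.

End MatrixTopology.

Section Content.
Variables (p : prime_nat) (n : nat) (R : comNzRingType).
Local Notation Zp := (padic_int p).
Implicit Types (X Y : 'M[Zp]_n) (O W K : set 'M[Zp]_n) (mu nu : set 'M[Zp]_n -> R).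

(** Unions of residue classes modulo p^k, as seen within O; in the applications O is a lattice or an
    orbit. *)
Definition periodic k O W : Prop :=
  W `<=` O /\ forall X Y, O Y -> cong k X Y -> W X -> W Y.

Definition cls k O X : set 'M[Zp]_n := [set Y | O Y /\ cong k Y X].

(** Additivity is asked at one level k only, where finitely many classes are involved and all
    comparisons become counts. *)
Definition pcontent k O mu : Prop := forall A B, periodic k O A -> periodic k O B ->
  A `&` B = set0 -> mu (A `|` B) = mu A + mu B.

Lemma periodic_le k l O W : (k <= l)%N -> periodic k O W -> periodic l O W.
Proof. by move=> kl [WO h]; split=> // X Y OY /(cong_le kl) XY; apply: h. Qed.

Lemma periodicI k O A B : periodic k O A -> periodic k O B -> periodic k O (A `&` B).
Proof.
move=> [AO hA] [BO hB]; split=> [X [/AO]//|X Y OY XY [AX BX]].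
by split; [apply: hA XY AX|apply: hB XY BX].
Qed.

Lemma periodic0 k O : periodic k O set0.
Proof. by split. Qed.

Lemma periodic_full k O : periodic k O O.
Proof. by split. Qed.

Lemma periodic_cls k O X : periodic k O (cls k O X).
Proof.
split=> [Y []//|Y Z OZ YZ [OY YX]]; split=> //; apply: cong_trans YX; exact: cong_sym.
Qed.

Lemma periodic_trans k O W A : periodic k O W -> periodic k W A -> periodic k O A.
Proof.
move=> [WO hW] [AW hA]; split=> [X /AW/WO|X Y OY XY AX] //.
exact: hA X Y (hW X Y OY XY (AW X AX)) XY AX.
Qed.

Lemma pcontent0 k O mu : pcontent k O mu -> mu set0 = 0.
Proof.
move=> /(_ set0 set0 (periodic0 _ _) (periodic0 _ _)).
by rewrite set0I set0U => /(_ erefl) /eqP; rewrite -subr_eq subrr => /eqP <-.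
Qed.

Lemma pcontent_partition k O mu W (T : finType) (f : 'M[Zp]_n -> T) :
  pcontent k O mu -> periodic k O W ->
  (forall X Y, O X -> O Y -> cong k X Y -> f X = f Y) ->
  mu W = \sum_t mu (W `&` [set X | f X = t]).
Proof.
move=> muC WP fP.
have per (A : pred T) : periodic k O (W `&` [set X | A (f X)]).
  case: WP => WO hW; split=> [X [/WO]//|X Y OY XY [WX AX]].
  by split; [apply: hW XY WX|rewrite /= -(fP X Y)//; apply: WO].
suff step (s : seq T) : uniq s ->
    mu (W `&` [set X | f X \in s]) = \sum_(t <- s) mu (W `&` [set X | f X = t]).
  rewrite -[in RHS]big_enum -step ?enum_uniq //; congr mu.
  by apply/seteqP; split=> [X WX|X []//]; split=> //=; rewrite mem_enum.
elim: s => [_|t s IHs /= /andP[ts su]].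
  rewrite big_nil (_ : _ `&` _ = set0) ?(pcontent0 muC) //.
  by apply/seteqP; split=> X // [].
rewrite big_cons -IHs // -muC.
- congr mu; apply/seteqP; split=> X /=.
    by rewrite in_cons => -[WX /orP[/eqP|] ?]; [left|right].
  by rewrite in_cons => -[[WX ->]|[WX ->]]; rewrite ?eqxx ?orbT.
- have -> : [set X | f X = t] = [set X | pred1 t (f X)].
    by apply/seteqP; split=> X /= /eqP.
  exact: per.
- exact: per.
- apply/seteqP; split=> X //= [[_ fX] [_]]; rewrite fX (negbTE ts) //.
Qed.

Definition residue_mx k X : 'M['I_(p ^ k)]_n :=
  \matrix_(i, j) Ordinal (residue_lt (X i j) k).

Lemma residue_mxP k X Y : residue_mx k X = residue_mx k Y <-> cong k X Y.
Proof.
split=> [/matrixP h i j|h]; first by have := h i j; rewrite !mxE => -[].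
by apply/matrixP => i j; rewrite !mxE; apply: val_inj; apply: h.
Qed.

(** N is the number of classes modulo p^k contained in W. It is quantified before mu, so any two
    contents that are constant on classes are proportional. *)
Lemma pcontent_count k O W : periodic k O W ->
  exists N : nat, (W !=set0 -> (0 < N)%N) /\
    forall mu c, pcontent k O mu -> (forall X, O X -> mu (cls k O X) = c) ->
      mu W = c * N%:R.
Proof.
move=> WP; pose A t := `[< exists X, W X /\ residue_mx k X = t >].
exists #|[set t | A t]%SET|; split.
  move=> [X WX]; apply/card_gt0P; exists (residue_mx k X).
  by rewrite inE; apply/asboolP; exists X.
move=> mu c muC muc.
rewrite (pcontent_partition muC WP (f := residue_mx k)); last first.
  by move=> X Y _ _ /residue_mxP.
rewrite (bigID A) /= [X in _ + X]big1 ?addr0.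
  rewrite (eq_bigr (fun=> c)) => [|t /asboolP[X [WX Xt]]].
    by rewrite sumr_const mulr_natr; congr (_ *+ _); apply: eq_card => t; rewrite !inE.
  rewrite -(muc X); last exact: WP.1.
  congr mu; apply/seteqP; split=> Y /=.
    by move=> [WY]; rewrite -Xt => /residue_mxP YX; split=> //; apply: WP.1.
  move=> [OY YX]; split; first by apply: WP.2 OY (cong_sym YX) WX.
  by rewrite -Xt; apply/residue_mxP.
move=> t /asboolPn nA; rewrite (_ : _ `&` _ = set0) ?(pcontent0 muC) //.
by apply/seteqP; split=> // X [WX Xt]; case: nA; exists X.
Qed.

Lemma pcontent_uniq k O W mu nu c d : periodic k O W ->
  pcontent k O mu -> pcontent k O nu ->
  (forall X, O X -> mu (cls k O X) = c) -> (forall X, O X -> nu (cls k O X) = d) ->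
  mu W * nu O = mu O * nu W.
Proof.
move=> /pcontent_count[N [_ hN]] muC nuC muc nud.
have [M [_ hM]] := pcontent_count (periodic_full k O).
by rewrite (hN mu c) // (hN nu d) // (hM mu c) // (hM nu d) //; ring.
Qed.

Definition subgroup K : Prop :=
  [/\ K 0, forall X Y, K X -> K Y -> K (X + Y) & forall X, K X -> K (- X)].

Definition translate X W : set 'M[Zp]_n := [set X + Y | Y in W].

Lemma cls_translate k K X : subgroup K -> K X -> cls k K X = translate X (cls k K 0).
Proof.
move=> [K0 KD KN] KX; apply/seteqP; split=> Y.
  move=> [KY YX]; exists (Y - X); last by rewrite addrC subrK.
  split; first by apply: KD => //; apply: KN.
  by rewrite -(subrr X); apply: congD.
move=> [Z [KZ Z0] <-]; split; first exact: KD.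
by rewrite -{2}[X]addr0; apply: congD.
Qed.

Lemma pcontent_uniq_translate k K W mu nu : subgroup K -> periodic k K W ->
  pcontent k K mu -> pcontent k K nu ->
  (forall X A, K X -> periodic k K A -> mu (translate X A) = mu A) ->
  (forall X A, K X -> periodic k K A -> nu (translate X A) = nu A) ->
  mu W * nu K = mu K * nu W.
Proof.
move=> Kg WP muC nuC muS nuS.
apply: (@pcontent_uniq k K W mu nu (mu (cls k K 0)) (nu (cls k K 0))) => //.
  by move=> X KX; rewrite (cls_translate _ Kg KX) muS //; apply: periodic_cls.
by move=> X KX; rewrite (cls_translate _ Kg KX) nuS //; apply: periodic_cls.
Qed.

End Content.

Section ImageMeasurable.
Variables (p : prime_nat) (n : nat).
Local Notation Zp := (padic_int p).
Local Notation Qp := (padic p).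
Local Notation borel := (g_sigma_algebraType (@open 'M[Qp]_n)).

Definition Symz : set 'M[Zp]_n := [set X | X^T = X].

(* The lattices to which volumes apply are traces on the integral matrices of
   measurable linear subspaces. *)
Definition trace_lattice (K : set 'M[Zp]_n) : Prop :=
  exists H : set 'M[Qp]_n, [/\ measurable (H : set borel),
    forall X, K X <-> H (toQ X) & forall s X, s != 0 -> H (s *: X) <-> H X].

Lemma trace_latticeT : trace_lattice setT.
Proof. by exists setT; split. Qed.

Lemma trace_lattice_Sym : trace_lattice Symz.
Proof.
exists (@Sym_Qp p n); split=> [|X|s X s0]; first exact: Sym_Qp_measurable.
  split=> [e|]; first by rewrite /Sym_Qp /= -toQT e.
  by rewrite /Sym_Qp /= -toQT => /toQ_inj.
rewrite /Sym_Qp /= tr_mxZ; split=> [|-> //].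
move=> /matrixP e; apply/matrixP => i j; have := e i j.
by rewrite [LHS]mxE [RHS]mxE => /(mulfI s0).
Qed.

Definition emb (s : Qp) (W : set 'M[Zp]_n) : set 'M[Qp]_n := [set s *: toQ X | X in W].

Lemma emb_inj s : s != 0 -> injective (fun X : 'M[Zp]_n => s *: toQ X).
Proof.
move=> s0 X Y /matrixP e; apply: toQ_inj; apply/matrixP => i j; have := e i j.
by rewrite [LHS]mxE [RHS]mxE => /(mulfI s0).
Qed.

(** For symmetric matrices [emb s W] is not open in the ambient space. It is the intersection of the
    subspace H with the open union of the balls of radius s p^k around its points. *)
Lemma emb_measurable (s : Qp) k K W : s != 0 -> trace_lattice K -> periodic k K W ->
  measurable (emb s W : set borel).
Proof.
move=> s0 [H [mH KH Hs]] [WK Wp].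
have -> : emb s W = H `&` [set Y | exists X Z, W X /\ Y = s *: toQ (X + pz p ^+ k *: Z)].
  apply/seteqP; split=> Y.
    move=> [X WX <-]; split; first by apply/Hs => //; apply/KH/WK.
    by exists X, 0; rewrite scaler0 addr0.
  move=> [HY [X [Z [WX eY]]]]; exists (X + pz p ^+ k *: Z) => //.
  apply: Wp WX; first by apply/KH/(Hs s) => //; rewrite -eY.
  by apply: cong_sym; apply/congP; exists Z.
apply: measurableI => //; apply: open_borel; apply/open_mballP.
move=> _ [X [Z [WX ->]]]; have [x [l e]] := padic_fracP s^-1.
exists (k + l)%N => _ [Y ->]; exists X, (Z + x *: Y); split=> //.
rewrite scalerDr addrA [in RHS]toQD scalerDr; congr (_ + _).
rewrite !toQZ !scalerA; congr (_ *: _).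
rewrite !pQ_pr exprD -[padic_of_int x](mulfVK (pqX_neq0 p l)) -e.
by rewrite mulrAC -!mulrA mulVKf // mulrC.
Qed.

End ImageMeasurable.

(** * Existence of Haar measures *)

Section Lattices.
Variables (p : prime_nat) (n : nat).
Local Notation Zp := (padic_int p).

Definition lift_mx (d : 'M['I_(p ^ 1)]_n) : 'M[Zp]_n := \matrix_(i, j) (d i j)%:R.

Lemma lift_residue_mx X : cong 1 (lift_mx (residue_mx 1 X)) X.
Proof. by move=> i j; rewrite !mxE residue_nat_id. Qed.

Lemma residue_lift_mx d : residue_mx 1 (lift_mx d) = d.
Proof.
apply/matrixP => i j; rewrite !mxE; apply: val_inj => /=.
by rewrite residue_nat modn_small.
Qed.

(* A closed subgroup from which p can be divided out and which contains the
   standard representatives of its elements modulo p. *)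
Definition lattice (K : set 'M[Zp]_n) : Prop :=
  [/\ subgroup K, trace_lattice K, forall k X, K (pz p ^+ k *: X) <-> K X,
      forall X, K X -> K (lift_mx (residue_mx 1 X))
    & forall X, (forall k, exists2 Y, K Y & cong k X Y) -> K X].

Lemma lattice_setT : lattice setT.
Proof. by split=> //; apply: trace_latticeT. Qed.

Lemma subgroup_Symz : subgroup (@Symz p n).
Proof.
split=> [|X Y|X]; rewrite /Symz /= ?trmx0 //.
  by move=> eX eY; rewrite tr_mxD eX eY.
by move=> eX; rewrite tr_mxN eX.
Qed.

Lemma lattice_Symz : lattice (@Symz p n).
Proof.
split; [exact: subgroup_Symz|exact: trace_lattice_Sym|..].
- move=> k X; rewrite /Symz /= tr_mxZ; split=> [|->] //.
  move=> /matrixP e; apply/matrixP => i j; have := e i j.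
  by rewrite [LHS]mxE [RHS]mxE => /(mulfI (prX_neq0 _ _)).
- move=> X eX; rewrite /Symz /=; apply/matrixP => i j; rewrite !mxE /=.
  by have /matrixP/(_ i j) := eX; rewrite mxE => ->.
- move=> X h; apply: cong_eq => k; have [Y eY XY] := h k.
  by apply: (@cong_trans _ _ _ _ Y); rewrite -?[X in cong _ _ X]eY; [apply: congT|apply: cong_sym].
Qed.
End Lattices.

Section DigitMap.
Variables (R : realType) (p : prime_nat) (n : nat).
Local Notation Zp := (padic_int p).
Local Notation Qp := (padic p).
Local Notation borel := (g_sigma_algebraType (@open 'M[Qp]_n)).
Variable K : set 'M[Zp]_n.
Hypothesis KL : lattice K.

Definition digits : pred 'M['I_(p ^ 1)]_n := [pred d | `[< K (lift_mx d) >]].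
Definition ndigits := #|digits|.
Local Notation q := ndigits.

Definition digit (j : nat) : 'M[Zp]_n :=
  lift_mx (nth (residue_mx 1 0) (enum digits) j).

Lemma ndigits_gt0 : (0 < q)%N.
Proof.
have [[K0 _ _] _ _ Kd _] := KL.
by apply/card_gt0P; exists (residue_mx 1 0); apply/asboolP/Kd.
Qed.
Hint Resolve ndigits_gt0 : core.

Lemma digit_in j : K (digit j).
Proof.
have [[K0 _ _] _ _ Kd _] := KL.
have [jq|qj] := ltnP j q; last first.
  by rewrite /digit nth_default -?cardE //; apply: Kd.
have : nth (residue_mx 1 0) (enum digits) j \in digits.
  by rewrite -mem_enum mem_nth // -cardE.
by move/asboolP.
Qed.

Lemma digit_inj i j : (i < q)%N -> (j < q)%N -> cong 1 (digit i) (digit j) -> i = j.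
Proof.
move=> iq jq /residue_mxP; rewrite !residue_lift_mx => /eqP.
by rewrite nth_uniq ?enum_uniq -?cardE // => /eqP.
Qed.

Lemma digit_surj X : K X -> exists2 j, (j < q)%N & cong 1 X (digit j).
Proof.
have [_ _ _ Kd _] := KL.
move=> KX; have D : residue_mx 1 X \in digits by apply/asboolP/Kd.
exists (index (residue_mx 1 X) (enum digits)).
  by rewrite [X in (_ < X)%N]cardE index_mem mem_enum.
rewrite /digit nth_index ?mem_enum //; apply: cong_sym; exact: lift_residue_mx.
Qed.

(** The most significant digit of j in base q becomes the lowest p-adic digit, so that nested
    classes modulo p^k correspond to nested intervals of length q^-k. *)
Fixpoint digit_sum k j : 'M[Zp]_n :=
  if k is k'.+1 then digit_sum k' (j %/ q)%N + pz p ^+ k' *: digit (j %% q)%N else 0.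

Lemma digit_sum_in k j : K (digit_sum k j).
Proof.
have [[K0 KD _] _ KZ _ _] := KL.
by elim: k j => //= k IHk j; apply: KD => //; apply/KZ/digit_in.
Qed.

Lemma digit_sumS k j : cong k (digit_sum k.+1 j) (digit_sum k (j %/ q)%N).
Proof. by apply/congP; exists (digit (j %% q)%N). Qed.

Lemma cong_divp k m l (X Y : 'M[Zp]_(m, l)) r :
  cong (k + r) (pz p ^+ k *: X) (pz p ^+ k *: Y) -> cong r X Y.
Proof.
move=> /congP[Z e]; apply/congP; exists Z; apply/matrixP => i j.
move/matrixP/(_ i j): e; rewrite !mxE exprD -mulrA -mulrDr.
by move/(mulfI (prX_neq0 _ _)).
Qed.

Lemma digit_sum_inj k i j : (i < q ^ k)%N -> (j < q ^ k)%N ->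
  cong k (digit_sum k i) (digit_sum k j) -> i = j.
Proof.
elim: k i j => [|k IHk] i j; first by rewrite expn0; case: i j => [|?] [|?].
rewrite expnSr => iq jq c.
have eij : (i %/ q = j %/ q)%N.
  apply: IHk; rewrite ?ltn_divLR //.
  apply: cong_trans (cong_sym (digit_sumS _ _)) _.
  apply: cong_trans (digit_sumS _ _); exact: cong_le c.
rewrite (divn_eq i q) (divn_eq j q) eij; congr (_ + _)%N.
apply: digit_inj; rewrite ?ltn_mod //.
apply: (@cong_divp k); rewrite addn1.
move: c => /= /congD -/(_ _ _ (cong_refl _ (- digit_sum k (j %/ q)%N))).
by rewrite eij ![digit_sum _ _ + _]addrC !addrK.
Qed.

Lemma digit_sum_surj k X : K X -> exists2 j, (j < q ^ k)%N & cong k X (digit_sum k j).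
Proof.
have [[K0 KD KN] _ KZ _ _] := KL.
move=> KX; elim: k => [|k [j jq /congP[Z eX]]].
  by exists 0%N => //; apply: cong0.
have KY : K Z.
  apply/(KZ k); have -> : pz p ^+ k *: Z = X + - digit_sum k j by rewrite eX addrC addKr.
  by apply: KD => //; apply/KN/digit_sum_in.
have [i iq Zi] := digit_surj KY; exists (j * q + i)%N.
  rewrite expnSr; apply: (@leq_trans (j.+1 * q)); last by rewrite leq_mul2r jq orbT.
  by rewrite mulSn addnC ltn_add2r.
rewrite /= divnMDl // divn_small // addn0 modnMDl modn_small // eX.
apply: congD => //; move/congP: Zi => [V ->]; apply/congP; exists V.
by rewrite scalerDr scalerA expr1 exprSr.
Qed.

(** For x in [0, 1), the index of the interval of length q^-k that contains x. *)
Definition slot (k : nat) (x : R) : nat := Num.truncn (q%:R ^+ k * x).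

Lemma slotS k x : (slot k.+1 x %/ q)%N = slot k x.
Proof.
have h m : (slot k.+1 x %/ q <= m)%N = (slot k x <= m)%N.
  rewrite truncn_le_nat -ltnS ltn_divLR // -(prednK ndigits_gt0) mulnS.
  rewrite /= -/(addn _ _) addSn ltnS truncn_le_nat -addSn -mulnS prednK //.
  by rewrite exprS -mulrA natrM mulrC ltr_pM2r ?ltr0n.
by apply/eqP; rewrite eqn_leq h leqnn -h leqnn.
Qed.

Lemma slot_lt k x : x < 1 -> (slot k x < q ^ k)%N.
Proof.
move=> x1; rewrite -(prednK (_ : 0 < q ^ k)%N) ?expn_gt0 ?ndigits_gt0 // ltnS.
rewrite truncn_le_nat prednK ?expn_gt0 ?ndigits_gt0 // natrX.
by rewrite -[ltRHS]mulr1 ltr_pM2l // exprn_gt0 // ltr0n.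
Qed.

Lemma digit_limit_subproof x : exists X : 'M[Zp]_n,
  forall k, cong k X (digit_sum k (slot k x)).
Proof.
have /choice[X XP] : forall ij : 'I_n * 'I_n, exists z : Zp,
    forall k, z k = digit_sum k (slot k x) ij.1 ij.2 k.
  by move=> ij; apply: residue_limit => k; rewrite digit_sumS slotS.
by exists (\matrix_(i, j) X (i, j)) => k i j; rewrite mxE XP.
Qed.

Definition digit_limit x : 'M[Zp]_n := projT1 (cid (digit_limit_subproof x)).

Lemma digit_limitP x k : cong k (digit_limit x) (digit_sum k (slot k x)).
Proof. exact: (projT2 (cid (digit_limit_subproof x))). Qed.

Lemma digit_limit_in x : K (digit_limit x).
Proof.
have [_ _ _ _ Kc] := KL; apply: Kc => k.
by exists (digit_sum k (slot k x)); [exact: digit_sum_in|exact: digit_limitP].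
Qed.

Lemma slot_le_measurable k m : measurable ([set x | (slot k x <= m)%N] : set (measurableTypeR R)).
Proof.
rewrite (_ : [set _ | _] = `]-oo, (m.+1%:R / q%:R ^+ k)[%classic); first exact: measurable_itv.
apply/seteqP; split=> x /=; rewrite in_itv /= truncn_le_nat ltr_pdivlMr ?exprn_gt0 ?ltr0n // mulrC //.
Qed.

Lemma slot_measurable k (A : set nat) :
  measurable ([set x | A (slot k x)] : set (measurableTypeR R)).
Proof.
have eq_m m : measurable ([set x | slot k x = m] : set (measurableTypeR R)).
  case: m => [|m].
    rewrite (_ : [set _ | _] = [set x | (slot k x <= 0)%N]); first exact: slot_le_measurable.
    by apply/seteqP; split=> x /=; rewrite leqn0 => /eqP.
  rewrite (_ : [set _ | _] = [set x | (slot k x <= m.+1)%N] `\` [set x | (slot k x <= m)%N]).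
    by apply: measurableD; exact: slot_le_measurable.
  apply/seteqP; split=> x /= => [->|[]]; first by rewrite ltnn.
  by move=> h /negP; rewrite -ltnNge => h'; apply/eqP; rewrite eqn_leq h.
rewrite (_ : [set _ | _] = \bigcup_(m in A) [set x | slot k x = m]).
  by apply: bigcup_measurable => m _; apply: eq_m.
by apply/seteqP; split=> x /= => [Ax|[m Am ->] //]; exists (slot k x).
Qed.

(** Carries Lebesgue measure on [0, 1) to the Haar probability of K. It reads base q digits of a
    real number as p-adic digits of a matrix. *)
Definition digit_map (x : measurableTypeR R) : borel := toQ (digit_limit x).

Lemma digit_map_measurable : measurable_fun setT digit_map.
Proof.
apply: (@measurability _ _ (measurableTypeR R) borel setT digit_map (@open 'M[Qp]_n) erefl).
move=> _ [U oU <-]; rewrite setTI.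
rewrite (_ : _ @^-1` _ = \bigcup_k [set x |
    [set j | mball k (toQ (digit_sum k j)) `<=` U] (slot k x)]).
  by apply: bigcupT_measurable => k; apply: slot_measurable.
have sb k x : mball k (digit_map x) (toQ (digit_sum k (slot k x))).
  have /cong_sym/congP[Z ->] := digit_limitP x k.
  by exists Z; rewrite toQD.
apply/seteqP; split=> x /=.
  move/open_mballP: oU => oU /oU[k kU]; exists k => //= Y hY; apply: kU.
  exact: mball_trans (sb k x) hY.
by move=> [k _ /= kU]; apply: kU; apply: mball_sym.
Qed.

End DigitMap.

Lemma image_measure d d' (T : measurableType d) (T' : measurableType d') (R : realType)
  (m : {measure set T -> \bar R}) (f : T -> T') : measurable_fun setT f ->
  exists m' : {measure set T' -> \bar R}, forall A, m' A = m (f @^-1` A).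
Proof.
move=> mf.
by exists (measure_function_pushforward__canonical__measure_function_Measure m mf).
Qed.

Lemma restricted_measure d (T : measurableType d) (R : realType)
  (m : {measure set T -> \bar R}) (D : set T) : measurable D ->
  exists m' : {measure set T -> \bar R}, forall A, m' A = m (A `&` D).
Proof. by move=> mD; exists (mrestr m mD). Qed.

Lemma scaled_measure d (T : measurableType d) (R : realType)
  (m : {measure set T -> \bar R}) (r : R) : 0 <= r ->
  exists m' : {measure set T -> \bar R}, forall A, m' A = (r%:E * m A)%E.
Proof. by move=> r0; exists (mscale (NngNum r0) m). Qed.

Section LatticeMeasures.
Variables (R : realType) (p : prime_nat) (n : nat).
Local Notation Zp := (padic_int p).
Local Notation Qp := (padic p).
Local Notation borel := (g_sigma_algebraType (@open 'M[Qp]_n)).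
Implicit Types (K W U : set 'M[Zp]_n) (m : {measure set borel -> \bar R}).

Lemma measure_content m (s : Qp) k K : s != 0 -> trace_lattice K ->
  (m (emb s K) < +oo)%E -> pcontent k K (fun W => fine (m (emb s W))).
Proof.
move=> s0 KT mK A B pA pB AB.
have meas W : periodic k K W -> measurable (emb s W : set borel).
  exact: emb_measurable.
have fin W : periodic k K W -> m (emb s W) \is a fin_num.
  move=> pW; rewrite ge0_fin_numE ?measure_ge0 //; apply: le_lt_trans mK.
  apply: le_measure; rewrite ?inE.
  - exact: meas pW.
  - exact: meas (periodic_full k K).
  - by apply: image_subset; exact: pW.1.
rewrite -fineD ?fin // (_ : emb s (A `|` B) = emb s A `|` emb s B); last exact: image_setU.
congr fine; apply: measureU; [exact: meas pA|exact: meas pB|].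
apply/seteqP; split=> // Y [[X AX <-] [Z BZ]] /(emb_inj s0) eZ.
have : set0 Z by rewrite -AB; split; rewrite // eZ.
by [].
Qed.

(** The largest union of classes modulo p^k inside U. As k grows these exhaust an open set, which
    extends identities from periodic sets to open ones. *)
Definition core k K U : set 'M[Zp]_n :=
  [set X | K X /\ forall Y, K Y -> cong k Y X -> U Y].

Lemma core_periodic k K U : periodic k K (core k K U).
Proof.
split=> [X []//|X Y KY XY [KX XU]]; split=> // Z KZ ZY; apply: XU => //.
exact: cong_trans ZY (cong_sym XY).
Qed.

Lemma core_sub k K U : core k K U `<=` U.
Proof. by move=> X [KX]; apply. Qed.

Lemma core_le k l K U : (k <= l)%N -> core k K U `<=` core l K U.
Proof. by move=> kl X [KX h]; split=> // Y KY /(cong_le kl); apply: h. Qed.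

Lemma core_bigcup K U : (forall X, U X -> exists k, core k K U X) ->
  \bigcup_k core k K U = U.
Proof.
move=> h; apply/seteqP; split=> X; first by move=> [k _]; apply: core_sub.
by move=> /h[k kX]; exists k.
Qed.

Lemma core_cvg m s K U : s != 0 -> trace_lattice K ->
  (forall X, U X -> exists k, core k K U X) ->
  measurable (emb s U : set borel) /\
  m (emb s (core k K U)) @[k --> \oo] --> m (emb s U).
Proof.
move=> s0 KT oU.
have e : emb s U = \bigcup_k emb s (core k K U).
  by rewrite -image_bigcup core_bigcup.
have meas k : measurable (emb s (core k K U) : set borel).
  apply: (emb_measurable s0 KT); exact: core_periodic.
have mU : measurable (emb s U : set borel) by rewrite e; apply: bigcupT_measurable.
split=> //; rewrite e; apply: nondecreasing_cvg_mu => //; first by rewrite -e.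
move=> k l kl; apply/subsetPset; apply: image_subset; exact: core_le.
Qed.

Lemma core_of_open s K (V : set 'M[Qp]_n) X : open V -> K X -> V (s *: toQ X) ->
  exists k, core k K [set X | K X /\ V (s *: toQ X)] X.
Proof.
move=> /open_mballP oV KX /oV[k kV].
have [x [l e]] := padic_fracP s.
exists (k + l)%N; split=> // Y KY /congP[Z eY]; split=> //; apply: kV.
exists (x *: Z); rewrite eY toQD scalerDr; congr (_ + _).
rewrite !toQZ !scalerA; congr (_ *: _).
by rewrite e !pQ_pr exprD [_ ^+ k * _]mulrC mulrA divfK ?pqX_neq0 // mulrC.
Qed.

Lemma emb_open_trace s K (V : set 'M[Qp]_n) :
  V `&` emb s K = emb s [set X | K X /\ V (s *: toQ X)].
Proof.
apply/seteqP; split=> Y; first by move=> [VY [X KX eX]]; exists X => //; rewrite /= eX.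
by move=> [X [KX VX] <-]; split=> //; exists X.
Qed.

Variable K : set 'M[Zp]_n.
Hypothesis KL : lattice K.
Local Notation q := (ndigits K).

(* The Haar probability of the lattice K, viewed on the ambient matrices. *)
Definition uniform m : Prop := m (~` emb 1 K) = 0%E /\
  forall k X, K X -> m (emb 1 (cls k K X)) = ((q%:R ^+ k)^-1)%:E.

Let KT : trace_lattice K. Proof. by case: KL. Qed.

Lemma emb_lattice_measurable (s : Qp) : s != 0 -> measurable (emb s K : set borel).
Proof. by move=> s0; apply: (emb_measurable s0 KT (periodic_full 0 K)). Qed.

Lemma cls0 X : cls 0 K X = K.
Proof. by apply/seteqP; split=> Y => [[]//|KY]; split=> //; apply: cong0. Qed.

Lemma uniform_total m : uniform m -> m (emb 1 K) = 1%E.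
Proof.
move=> [_ h]; have [[K0 _ _] _ _ _ _] := KL.
by rewrite -(cls0 0) h // expr0 invr1.
Qed.

Lemma uniform_carried m (A : set borel) : uniform m -> measurable A ->
  m A = m (A `&` emb 1 K).
Proof.
move=> [h _] mA; have mK := emb_lattice_measurable (oner_neq0 _).
rewrite [in LHS](_ : A = (A `&` emb 1 K) `|` (A `&` ~` emb 1 K)); last first.
  by rewrite -setIUr setUv setIT.
rewrite measureU; [|exact: measurableI|apply: measurableI => //; exact: measurableC|]; last first.
  by rewrite setIACA setICr setI0.
rewrite [X in (_ + X)%E](_ : _ = 0%E) ?adde0 //; apply/eqP; rewrite eq_le measure_ge0 andbT.
rewrite -h; apply: le_measure; rewrite ?inE; last exact: subIsetr.
  by apply: measurableI => //; exact: measurableC.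
exact: measurableC.
Qed.

Lemma uniform_fin m (A : set borel) : uniform m -> measurable A -> m A \is a fin_num.
Proof.
move=> mu mA; rewrite (uniform_carried mu mA) ge0_fin_numE ?measure_ge0 //.
apply: (@le_lt_trans _ _ (m (emb 1 K))); last by rewrite uniform_total // ltry.
have mK := emb_lattice_measurable (oner_neq0 _).
by apply: le_measure; rewrite ?inE //; exact: measurableI.
Qed.

(** Agreement holds on periodic sets by counting classes, on open sets by exhausting them with
    cores, and on Borel sets because the open sets are stable under intersection and generate
    them. *)
Lemma uniform_unique m1 m2 : uniform m1 -> uniform m2 ->
  forall A : set borel, measurable A -> m1 A = m2 A.
Proof.
move=> u1 u2.
have per k W : periodic k K W -> m1 (emb 1 W) = m2 (emb 1 W).
  move=> pW; have mW := emb_measurable (oner_neq0 Qp) KT pW.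
  rewrite -(fineK (uniform_fin u1 mW)) -(fineK (uniform_fin u2 mW)); congr (_%:E).
  have cont m : uniform m -> pcontent k K (fun W => fine (m (emb 1 W))).
    by move=> u; apply: measure_content; rewrite ?oner_eq0 // uniform_total // ltry.
  have [N [_ hN]] := pcontent_count R pW.
  have cl m : uniform m -> forall X, K X -> fine (m (emb 1 (cls k K X))) = (q%:R ^+ k)^-1.
    by move=> [_ u] X KX; rewrite u.
  by rewrite (hN _ _ (cont _ u1) (cl _ u1)) (hN _ _ (cont _ u2) (cl _ u2)).
have op (V : set borel) : open V -> m1 V = m2 V.
  move=> oV; have mV := open_borel oV.
  rewrite (uniform_carried u1 mV) (uniform_carried u2 mV) emb_open_trace.
  set U := [set X | _].
  have oU X : U X -> exists k, core k K U X.
    by move=> [KX VX]; apply: core_of_open.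
  have [_ c1] := core_cvg m1 (oner_neq0 Qp) KT oU.
  have [_ c2] := core_cvg m2 (oner_neq0 Qp) KT oU.
  have e : (fun k => m1 (emb 1 (core k K U))) = (fun k => m2 (emb 1 (core k K U))).
    by apply/funext => k; apply: (per k); exact: core_periodic.
  by rewrite e in c1; exact: cvg_unique c1 c2.
move=> A mA.
apply: (@g_sigma_algebra_measure_unique _ _ borel (@open 'M[Qp]_n) _ (fun=> setT)) => //.
- by move=> V oV; exact: open_borel.
- by move=> _; exact: openT.
- by rewrite bigcup_const //; exists 0%N.
- by move=> V W; exact: openI.
- by move=> _; rewrite -ge0_fin_numE ?measure_ge0 //; apply: uniform_fin.
Qed.

Lemma uniform_exists : exists m, uniform m.
Proof.
have q0 : (0 < q)%N := ndigits_gt0 KL.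
have m01 : measurable (`[0, 1[%classic : set (measurableTypeR R)) by exact: measurable_itv.
have [l lE] := restricted_measure (@lebesgue_measure R) m01.
have [m mE] := image_measure l (@digit_map_measurable R p n K KL).
exists m; split=> [|k X KX].
  rewrite mE lE (_ : _ `&` _ = set0) ?measure0 //; apply/seteqP; split=> // x [h _].
  by apply: h; exists (digit_limit KL x); rewrite ?scale1r //; apply: digit_limit_in.
have [j jq Xj] := digit_sum_surj KL k KX.
have qk0 : 0 < q%:R ^+ k :> R by rewrite exprn_gt0 // ltr0n.
(* The expansion of x falls into the class of X exactly when x lies in the j-th interval of level k,
   because [digit_sum k] is injective on indices below q^k. *)
rewrite mE lE (_ : _ `&` _ = `[j%:R / q%:R ^+ k, j.+1%:R / q%:R ^+ k[%classic).
  apply: (etrans (lebesgue_measure_itv `[j%:R / q%:R ^+ k, j.+1%:R / q%:R ^+ k[)).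
  rewrite /= lte_fin ltr_pM2r ?invr_gt0 // ltr_nat ltnSn.
  by rewrite -EFinB -mulrBl -natrB ?leqnSn // subSnn mul1r.
apply/seteqP; split=> x /=; rewrite in_itv /= ?in_itv /= ler_pdivrMr // ltr_pdivlMr // ![x * _]mulrC.
  move=> [[Y [KY YX]]]; rewrite scale1r => /toQ_inj eY /andP[x0 x1].
  have : slot K k x = j.
    apply: (digit_sum_inj KL (slot_lt KL k x1) jq).
    apply: cong_trans (cong_sym (digit_limitP KL x k)) _; rewrite -eY.
    exact: cong_trans YX Xj.
  by move=> <-; apply: truncn_itv; apply: mulr_ge0 => //; exact: ltW.
move=> /andP[jx xj].
have x0 : 0 <= x by rewrite -(pmulr_rge0 _ qk0); apply: le_trans jx.
split; last first.
  rewrite x0 -(ltr_pM2l qk0) mulr1; apply: lt_le_trans xj _.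
  by rewrite -natrX ler_nat.
have sj : slot K k x = j by apply: truncn_def; rewrite jx.
exists (digit_limit KL x); last by rewrite scale1r.
split; first exact: digit_limit_in.
apply: cong_trans (digit_limitP KL x k) _; rewrite sj; exact: cong_sym.
Qed.

End LatticeMeasures.

Section HaarMeasures.
Variables (R : realType) (p : prime_nat) (n : nat).
Local Notation Zp := (padic_int p).
Local Notation Qp := (padic p).
Local Notation borel := (g_sigma_algebraType (@open 'M[Qp]_n)).
Implicit Types (m : {measure set borel -> \bar R}) (A B : set borel).

Lemma affine_measurable (a : Qp) (H : 'M[Qp]_n) :
  measurable_fun setT ((fun X : 'M[Qp]_n => a *: X + H) : borel -> borel).
Proof.
apply: (@measurability _ _ borel borel setT _ (@open 'M[Qp]_n) erefl).
move=> _ [U /open_mballP oU <-]; rewrite setTI; apply: open_borel.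
apply/open_mballP => X /oU[k kU].
have [x [l e]] := padic_fracP a.
exists (k + l)%N => _ [Z ->]; apply: kU; exists (x *: Z).
rewrite scalerDr addrAC; congr (_ + _).
rewrite !toQZ !scalerA; congr (_ *: _).
by rewrite e !pQ_pr exprD [_ ^+ k * _]mulrC mulrA divfK ?pqX_neq0 // mulrC.
Qed.

Lemma affine_preimage_measurable (a : Qp) (H : 'M[Qp]_n) A : measurable A ->
  measurable ((fun X : 'M[Qp]_n => a *: X + H) @^-1` A : set borel).
Proof. by move=> mA; rewrite -[X in measurable X]setTI; apply: affine_measurable. Qed.

Lemma translate_preimage (H : 'M[Qp]_n) A :
  [set H + X | X in (A : set 'M[Qp]_n)] = (fun X => 1 *: X + - H) @^-1` A.
Proof.
apply/seteqP; split=> X /=; first by move=> [Y AY <-]; rewrite scale1r addrAC subrr add0r.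
by rewrite scale1r => AX; exists (X - H) => //; rewrite addrC subrK.
Qed.

Lemma translate_measurable (H : 'M[Qp]_n) A : measurable A ->
  measurable ([set H + X | X in (A : set 'M[Qp]_n)] : set borel).
Proof. by move=> mA; rewrite translate_preimage; apply: affine_preimage_measurable. Qed.

Variable K : set 'M[Zp]_n.
Hypothesis KL : lattice K.
Local Notation q := (ndigits K).
Local Notation pq := ((p : nat)%:R : Qp).

Let qX_neq0 j : (q%:R : R) ^+ j != 0.
Proof. by rewrite expf_neq0 // pnatr_eq0 -lt0n ndigits_gt0. Qed.

Lemma uniform_translate m H A : uniform K m -> K H -> measurable A ->
  m [set toQ H + X | X in (A : set 'M[Qp]_n)] = m A.
Proof.
move=> um KH mA; have [[K0 KD KN] _ _ _ _] := KL.
have [m' m'E] := image_measure m (affine_measurable 1 (- toQ H)).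
rewrite translate_preimage -m'E; apply: (uniform_unique KL) => //.
have sub (W : set 'M[Zp]_n) : (fun X : 'M[Qp]_n => 1 *: X - toQ H) @^-1` emb 1 W =
    emb 1 (translate H W).
  rewrite -translate_preimage; apply/seteqP; split=> X /=.
    move=> [_ [Y WY <-] <-]; exists (H + Y); first by exists Y.
    by rewrite !scale1r toQD.
  move=> [_ [Y WY <-] <-]; exists (toQ Y); first by exists Y; rewrite ?scale1r.
  by rewrite scale1r toQD.
case: um => um1 um2; split=> [|k X KX]; rewrite m'E.
  rewrite -preimage_setC sub (_ : translate H K = K) //.
  apply/seteqP; split=> X; first by move=> [Y KY <-]; apply: KD.
  move=> KX; exists (X + - H); first by apply/KD/KN.
  by rewrite addrC subrK.
rewrite sub (cls_translate k (And3 K0 KD KN) KX) -(um2 k (H + X)); last exact: KD.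
congr (m (emb 1 _)); rewrite (cls_translate _ (And3 K0 KD KN) (KD _ _ KH KX)).
apply/seteqP; split=> Y; first by move=> [_ [Z cZ <-] <-]; exists Z; rewrite ?addrA.
by move=> [Z cZ <-]; exists (X + Z); [exists Z|rewrite addrA].
Qed.

(** The sublattice p K has index q in K, so the left-hand side, as a function of A, is again
    uniform; uniqueness concludes. *)
Lemma uniform_scale m A : uniform K m -> measurable A ->
  (q%:R%:E * m ((fun X : 'M[Qp]_n => (pq^-1 *: X)%R) @^-1` (A `&` emb 1%R K)))%E = m A.
Proof.
move=> um mA; have [K0 _ KZ _ _] := KL.
have mK := emb_lattice_measurable KL (oner_neq0 Qp).
have mf := affine_measurable pq^-1 0.
have [m1 m1E] := image_measure m mf.
have [m2 m2E] := restricted_measure m1 mK.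
have eqf (B : set 'M[Qp]_n) : (fun X : 'M[Qp]_n => pq^-1 *: X + 0) @^-1` B =
    (fun X : 'M[Qp]_n => pq^-1 *: X) @^-1` B.
  by apply/seteqP; split=> X /=; rewrite addr0.
have [m' m'E] : exists m' : {measure set borel -> \bar R}, forall B, m' B =
    (q%:R%:E * m ((fun X : 'M[Qp]_n => (pq^-1 *: X)%R) @^-1` (B `&` emb 1%R K)))%E.
  have [m' m'E] := scaled_measure m2 (ler0n R q).
  by exists m' => B; rewrite m'E m2E m1E eqf.
rewrite -m'E; apply: (uniform_unique KL) => //.
case: um => um1 um2; split=> [|k X KX]; rewrite m'E.
  by rewrite setICl preimage_set0 measure0 mule0.
rewrite (_ : _ @^-1` _ = emb 1 (cls k.+1 K (pz p *: X))).
  rewrite um2; last by rewrite -[pz p]expr1; apply/KZ.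
  rewrite exprS invfM -EFinM mulrA mulfV ?mul1r //.
  by have := qX_neq0 1; rewrite expr1.
have scK (Y : 'M[Qp]_n) (Z : 'M[Zp]_n) : pq^-1 *: Y = 1 *: toQ Z <-> Y = 1 *: toQ (pz p *: Z).
  rewrite !scale1r toQZ pQ_nat; split=> [<-|->]; first by rewrite scalerA mulfV ?pq_neq0 ?scale1r.
  by rewrite scalerA mulVf ?pq_neq0 ?scale1r.
apply/seteqP; split=> Y /=.
  move=> [[Z [KZ' ZX] /esym/scK ->] _]; exists (pz p *: Z) => //.
  by split; [rewrite -[pz p]expr1; apply/KZ|apply: cong_pS].
move=> [Z [KZ' /congP[V eZ]] eY].
have eZ' : Z = pz p *: (X + pz p ^+ k *: V) by rewrite eZ scalerDr scalerA exprS.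
have KXV : K (X + pz p ^+ k *: V) by apply/(KZ 1%N); rewrite expr1 -eZ'.
have eY' : pq^-1 *: Y = 1 *: toQ (X + pz p ^+ k *: V) by apply/scK; rewrite -eZ' eY.
split; exists (X + pz p ^+ k *: V) => //; split=> //.
by apply/congP; exists V.
Qed.

(** The union of the lattices p^-j K is cut into shells, and mu is the series of the measures of
    these shells. Countable additivity then comes for free, and the partial sums telescope to
    [S j]. *)
Lemma haar_extension : exists mu : {measure set borel -> \bar R},
  [/\ mu (~` \bigcup_j emb (pq^-1 ^+ j) K) = 0%E,
      forall j (H : 'M[Qp]_n) A, emb (pq^-1 ^+ j) K H -> measurable A ->
        mu [set H + X | X in (A : set 'M[Qp]_n)] = mu A
    & mu (emb 1 K) = 1%E].
Proof.
have [[K0 KD KN] _ KZ _ _] := KL.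
have [m um] := uniform_exists R KL.
have s0 j : pq^-1 ^+ j != 0 by rewrite expf_neq0 // invr_eq0 pq_neq0.
have mK j : measurable (emb (pq^-1 ^+ j) K : set borel) := emb_lattice_measurable KL (s0 j).
(* The Haar measure of p^-j K, normalised so that K keeps mass 1. *)
pose S j A := ((q%:R ^+ j)%:E * m ((fun X : 'M[Qp]_n => (pq^-1 ^+ j *: X)%R) @^-1` A))%E.
pose D j : set borel := if j is j'.+1 then ~` emb (pq^-1 ^+ j') K else setT.
have mD j : measurable (D j) by case: j => [|j] //=; apply: measurableC.
have pre j A : (fun X : 'M[Qp]_n => pq^-1 ^+ j *: X + 0) @^-1` A =
    (fun X : 'M[Qp]_n => (pq^-1 ^+ j *: X)%R) @^-1` A.
  by apply/seteqP; split=> X /=; rewrite addr0.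
have mpre j A : measurable A ->
    measurable ((fun X : 'M[Qp]_n => (pq^-1 ^+ j *: X)%R) @^-1` A : set borel).
  by move=> mA; rewrite -pre; apply: affine_preimage_measurable.
have measS j : exists mS : {measure set borel -> \bar R}, forall A, mS A = S j A.
  have [m1 m1E] := image_measure m (affine_measurable (pq^-1 ^+ j) 0).
  have [m' m'E] := scaled_measure m1 (exprn_ge0 j (ler0n R q)).
  by exists m' => A; rewrite m'E m1E pre.
have /choice[nu nuE] : forall j, exists mS : {measure set borel -> \bar R},
    forall A, mS A = S j (A `&` D j).
  move=> j; have [m1 m1E] := measS j.
  by have [m2 m2E] := restricted_measure m1 (mD j); exists m2 => A; rewrite m2E m1E.
have SI j A : measurable A -> S j.+1 (A `&` emb (pq^-1 ^+ j) K) = S j A.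
  move=> mA; rewrite /S exprSr EFinM -muleA; congr (_ * _)%E.
  rewrite -(uniform_scale um (mpre j A mA)); congr (_ * m _)%E.
  apply/seteqP; split=> X /=; rewrite exprSr -scalerA => -[AX [Y KY eY]].
    split=> //; exists Y => //; rewrite scale1r; apply: (scalerI (s0 j)) eY.
  by split=> //; exists Y => //; rewrite -eY scale1r.
have SU j A : measurable A -> S j.+1 A = (S j A + nu j.+1 A)%E.
  move=> mA; rewrite -[in RHS]SI // nuE; have [mS mSE] := measS j.+1.
  rewrite -!mSE -measureU.
  - by rewrite -setIUr /= setUv setIT.
  - exact: measurableI.
  - exact: measurableI.
  - by rewrite setIACA /= setICr setI0.
have sumS j A : measurable A -> (\sum_(0 <= i < j.+1) nu i A)%E = S j A.
  move=> mA; elim: j => [|j IHj]; first by rewrite big_nat1 nuE /= setIT.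
  by rewrite big_nat_recr //= IHj SU.
pose mu := mseries nu 0.
have muS A : measurable A -> S j A @[j --> \oo] --> mu A.
  move=> mA; have : cvgn (fun j => (\sum_(0 <= i < j) nu i A)%E).
    by apply: is_cvg_nneseries => i _ _; apply: measure_ge0.
  rewrite /mu /mseries => c.
  have -> : (fun j => S j A) = [sequence (\sum_(0 <= i < j.+1) nu i A)%E]_j.
    by apply/funext => j; rewrite /= sumS.
  by rewrite (cvg_shiftS (fun j => (\sum_(0 <= i < j) nu i A)%E)).
have embS j : emb (pq^-1 ^+ j) K `<=` emb (pq^-1 ^+ j.+1) K.
  move=> _ [X KX <-]; exists (pz p *: X); first by rewrite -[pz p]expr1; apply/KZ.
  by rewrite toQZ pQ_nat scalerA exprSr -mulrA mulVf ?pq_neq0 ?mulr1.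
have emb_le j k : (j <= k)%N -> emb (pq^-1 ^+ j) K `<=` emb (pq^-1 ^+ k) K.
  move=> /subnK <-; elim: (k - j)%N => [|i IHi]; first by rewrite add0n.
  by rewrite addSn; apply: subset_trans IHi (embS _).
exists mu; split.
- have mU : measurable (~` \bigcup_j emb (pq^-1 ^+ j) K : set borel).
    by apply: measurableC; apply: bigcupT_measurable.
  have e : (fun j => S j (~` \bigcup_j emb (pq^-1 ^+ j) K)) = (fun=> 0%E).
    apply/funext => j; rewrite /S (uniform_carried KL um (mpre j _ mU)).
    rewrite (_ : _ `&` _ = set0) ?measure0 ?mule0 //.
    apply/seteqP; split=> // X [/= h [Y KY eY]]; apply: h; exists j => //.
    by exists Y; rewrite // -eY scale1r.
  have c := muS _ mU; rewrite e in c.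
  have c0 : (fun=> 0%E : \bar R) @ \oo --> 0%E by exact: cvg_cst.
  exact: cvg_unique c c0.
- move=> j H A [X KX eH] mA.
  have c1 := muS _ (translate_measurable H mA); have c2 := muS _ mA.
  (* A translation by an element of p^-j K preserves [S i] only from i = j on, so the first j terms
     are dropped before passing to the limit. *)
  rewrite -(cvg_shiftn j) in c1; rewrite -(cvg_shiftn j) in c2.
  suff e : [sequence S (i + j)%N [set H + X | X in (A : set 'M[Qp]_n)]]_i = [sequence S (i + j)%N A]_i.
    by rewrite e in c1; exact: cvg_unique c1 c2.
  apply/funext => i /=; rewrite /S; congr (_ * _)%E.
  have [Y KY eHY] : emb (pq^-1 ^+ (i + j)) K H by apply: (emb_le j); [exact: leq_addl|exists X].
  rewrite -(uniform_translate um KY (mpre _ _ mA)); congr (m _).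
  rewrite [in RHS]translate_preimage [in LHS]translate_preimage.
  by apply/seteqP; split=> V /=; rewrite -eHY !scale1r scalerBr.
- have e j : S j (emb 1 K) = 1%E.
    elim: j => [|j IHj].
      rewrite /S expr0 mul1e -(uniform_total KL um); congr (m _).
      by apply/seteqP; split=> X /=; rewrite scale1r.
    rewrite -IHj -[RHS]SI; last by have := mK 0%N; rewrite expr0.
    congr (S _ _); by rewrite setIidl //; have := emb_le 0%N j (leq0n j); rewrite expr0.
  have c := muS _ (mK 0%N); rewrite expr0 in c.
  have e' : (fun j => S j (emb 1 K)) = (fun=> 1%E) by apply/funext.
  rewrite e' in c; have c1 : (fun=> 1%E : \bar R) @ \oo --> 1%E by exact: cvg_cst.
  exact: cvg_unique c c1.
Qed.

End HaarMeasures.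

(** * Volumes and local densities *)

Section Volumes.
Variables (R : realType) (p : prime_nat) (n : nat).
Local Notation Zp := (padic_int p).
Local Notation Qp := (padic p).
Local Notation Mn := 'M[Qp]_n.
Local Notation borel := (g_sigma_algebraType (@open 'M[Qp]_n)).

Implicit Types (W : set 'M[Zp]_n).

Lemma Mat_ZpE : @Mat_Zp p n = emb 1 setT.
Proof.
apply/seteqP; split=> X.
  move=> ZX; have /choice[Z ZP] : forall ij : 'I_n * 'I_n, exists z : Zp,
      X ij.1 ij.2 = padic_of_int z.
    by move=> [i j]; have [z _ <-] := ZX i j; exists z.
  exists (\matrix_(i, j) Z (i, j)) => //; apply/matrixP => i j.
  by rewrite scale1r !mxE -ZP.
by move=> [Y _ <-] i j; exists (Y i j); rewrite // scale1r mxE.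
Qed.

Lemma Sym_ZpE : @Sym_Zp p n = emb 1 (@Symz p n).
Proof.
rewrite /Sym_Zp Mat_ZpE; apply/seteqP; split=> X.
  move=> [eX [Y _ eY]]; exists Y => //; apply: toQ_inj.
  by rewrite toQT -(scale1r (toQ Y)) eY.
by move=> [Y eY <-]; split; [rewrite /Sym_Qp /= scale1r -toQT eY|exists Y].
Qed.

Lemma mx_fracP (X : Mn) : exists j Y, X = (p : nat)%:R^-1 ^+ j *: toQ Y.
Proof.
have /choice[f fP] : forall ij : 'I_n * 'I_n, exists z : Zp * nat,
    X ij.1 ij.2 = padic_of_int z.1 / (p : nat)%:R ^+ z.2.
  by move=> [i j]; have [x [k e]] := padic_fracP (X i j); exists (x, k).
pose k := \max_ij (f ij).2; exists k.
exists (\matrix_(i, j) (pz p ^+ (k - (f (i, j)).2) * (f (i, j)).1)).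
apply/matrixP => i j; rewrite !mxE pQM pQ_pr (fP (i, j)) exprVn.
have le : ((f (i, j)).2 <= k)%N by exact: (leq_bigmax (i, j)).
rewrite -[in LHS](mulKf (pqX_neq0 p (k - (f (i, j)).2)) (padic_of_int _)).
by rewrite [X in X / _]mulrC -mulrA -invfM -exprD subnK // mulrC.
Qed.

Lemma Sym_QpE : @Sym_Qp p n = \bigcup_j emb ((p : nat)%:R^-1 ^+ j) (@Symz p n).
Proof.
have [_ [H [_ KH Hs]] _ _ _] := lattice_Symz p n.
apply/seteqP; split=> X.
  move=> eX; have [j [Y eY]] := mx_fracP X; exists j => //; exists Y => //.
  apply: toQ_inj; have s0 : (p : nat)%:R^-1 ^+ j != 0 :> Qp.
    by rewrite expf_neq0 // invr_eq0 pq_neq0.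
  by rewrite toQT; apply: (scalerI s0); rewrite -tr_mxZ -eY.
by move=> [j _ [Y eY <-]]; rewrite /Sym_Qp /= tr_mxZ -toQT eY.
Qed.

(** Existence rules out the default value 0 of [haar]; what follows relies only on the invariance
    and normalisation of the measure that was chosen. *)
Lemma haarP (H K : set Mn) : (exists mu : {measure set borel -> \bar R}, is_haar H K mu) ->
  exists2 mu : {measure set borel -> \bar R}, is_haar H K mu & haar R H K = mu.
Proof.
move=> [mu muH]; rewrite /haar; case: xgetP => [f -> [mu' h e]|].
  by exists mu'.
by move=> /(_ (mu : set Mn -> \bar R)); case; exists mu.
Qed.

Lemma vol_MatP : exists2 mu : {measure set borel -> \bar R},
  is_haar (@Mat_Zp p n) (@Mat_Zp p n) mu & @vol_Mat R p n = mu.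
Proof.
apply: haarP; have L := lattice_setT p n.
have [m um] := uniform_exists R L; exists m; rewrite Mat_ZpE.
split; [exact: um.1| |exact: uniform_total um].
by move=> h A [X _ <-] mA; rewrite scale1r (uniform_translate L um).
Qed.

Lemma vol_SymP : exists2 mu : {measure set borel -> \bar R},
  is_haar (@Sym_Qp p n) (@Sym_Zp p n) mu & @vol_Sym R p n = mu.
Proof.
apply: haarP; have L := lattice_Symz p n.
have [m [m1 m2 m3]] := haar_extension R L; exists m; rewrite Sym_QpE Sym_ZpE.
by split=> // h A [j _ jh] mA; apply: m2 jh mA.
Qed.

Definition volM (W : set 'M[Zp]_n) : R := fine (vol_Mat R (emb 1 W)).

(** The scale a is 2 for Gram matrices, which are halves of integral Hessians, and 1 for the
    Hessians themselves. *)
Definition volS (a : Zp) (W : set 'M[Zp]_n) : R :=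
  fine (vol_Sym R (emb (padic_of_int a)^-1 W)).

Let pQa_neq0 (a : Zp) : a != 0 -> (padic_of_int a)^-1 != 0.
Proof. by move=> a0; rewrite invr_eq0 pQ_eq0. Qed.

Lemma emb_translate (s : Qp) (H : 'M[Zp]_n) W :
  emb s (translate H W) = [set s *: toQ H + X | X in emb s W].
Proof.
apply/seteqP; split=> X.
  move=> [_ [Y WY <-] <-]; exists (s *: toQ Y); first by exists Y.
  by rewrite toQD scalerDr.
move=> [_ [Y WY <-] <-]; exists (H + Y); first by exists Y.
by rewrite toQD scalerDr.
Qed.

Lemma emb_set0 (s : Qp) : emb s (set0 : set 'M[Zp]_n) = set0.
Proof. exact: image_set0. Qed.

Lemma volM_fin k W : periodic k setT W -> vol_Mat R (emb 1 W) \is a fin_num.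
Proof.
have [mu [_ _ mK] ->] := vol_MatP => pW; rewrite Mat_ZpE in mK.
rewrite ge0_fin_numE ?measure_ge0 //; apply: (@le_lt_trans _ _ (mu (emb 1 setT))).
  apply: le_measure; rewrite ?inE.
  - exact: emb_measurable (oner_neq0 Qp) (trace_latticeT p n) pW.
  - exact: emb_measurable (oner_neq0 Qp) (trace_latticeT p n) (periodic_full 0 _).
  - exact: image_subset.
by rewrite mK ltry.
Qed.

Lemma volM_pcontent k : pcontent k setT volM.
Proof.
have [mu [_ _ mK] e] := vol_MatP; rewrite /volM e.
apply: measure_content; [exact: oner_neq0|exact: trace_latticeT|].
by rewrite -Mat_ZpE mK ltry.
Qed.

Lemma volM_translate H k W : periodic k setT W -> volM (translate H W) = volM W.
Proof.
have [mu [_ mT _] e] := vol_MatP; rewrite /volM e => pW.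
rewrite emb_translate mT //; first by rewrite Mat_ZpE; exists H.
exact: emb_measurable (oner_neq0 Qp) (trace_latticeT p n) pW.
Qed.

Lemma volM_total : volM setT = 1.
Proof. by have [mu [_ _ mK] e] := vol_MatP; rewrite /volM e -Mat_ZpE mK. Qed.

Lemma volM_ge0 W : 0 <= volM W.
Proof. by have [mu _ e] := vol_MatP; rewrite /volM e fine_ge0. Qed.

Lemma volS_meas (a : Zp) k W : a != 0 -> periodic k (@Symz p n) W ->
  measurable (emb (padic_of_int a)^-1 W : set borel).
Proof.
by move=> a0 pW; apply: (emb_measurable _ (trace_lattice_Sym p n) pW); apply: pQa_neq0.
Qed.

(** With 1 / a = x / p^k, each residue class modulo p^k embeds into one translate of the integral
    symmetric matrices, which have volume 1, and there are finitely many classes. *)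
Lemma volS_total_fin (a : Zp) : a != 0 -> (vol_Sym R (emb (padic_of_int a)^-1%R (@Symz p n)) < +oo)%E.
Proof.
move=> a0; have [mu [_ mT mK] ->] := vol_SymP; rewrite Sym_ZpE in mK.
have [x [k e]] := padic_fracP (padic_of_int a)^-1.
set s := _^-1 in e *.
have s0 : s != 0 := pQa_neq0 a0.
have per (A : pred 'M['I_(p ^ k)]_n) :
    periodic k (@Symz p n) (@Symz p n `&` [set X | A (residue_mx k X)]).
  split=> [X []//|X Y SY /residue_mxP XY [_ AX]]; split=> //=.
  by rewrite -XY.
have meas (A : pred 'M['I_(p ^ k)]_n) : measurable (emb s (@Symz p n `&` [set X | A (residue_mx k X)]) : set borel).
  exact: volS_meas (per A).
suff h (l : seq 'M['I_(p ^ k)]_n) :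
    (mu (emb s (@Symz p n `&` [set X | residue_mx k X \in l])) < +oo)%E.
  rewrite (_ : @Symz p n = @Symz p n `&` [set X | residue_mx k X \in enum setT]) //.
  by apply/seteqP; split=> [X SX|X []//]; split=> //=; rewrite mem_enum inE.
elim: l => [|t l IHl].
  rewrite [X in emb s X](_ : _ = set0) ?emb_set0 ?measure0 //.
  by apply/seteqP; split=> X [].
rewrite (_ : emb s _ = emb s (@Symz p n `&` [set X | pred1 t (residue_mx k X)])
   `|` emb s (@Symz p n `&` [set X | residue_mx k X \in l])); last first.
  rewrite /emb -image_setU -setIUr; congr (emb s (_ `&` _)).
  apply/seteqP; split=> X /=; rewrite in_cons; first by move=> /orP[]; [left|right].
  by move=> [] ->; rewrite ?orbT.
apply: (le_lt_trans (measureU2 mu (meas (pred1 t)) (meas (fun t => t \in l)))).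
apply: lte_add_pinfty => //.
have [[X [SX /eqP Xt]]|nX] :=
  pselect (exists X, Symz X /\ residue_mx k X == t); last first.
  rewrite [X in emb s X](_ : _ = set0) ?emb_set0 ?measure0 //.
  apply/seteqP; split=> // Y [SY Yt].
  by apply: nX; exists Y.
have mS : measurable (emb 1 (@Symz p n) : set borel).
  exact: emb_measurable (oner_neq0 Qp) (trace_lattice_Sym p n) (periodic_full 0 _).
apply: (@le_lt_trans _ _ (mu [set s *: toQ X + Y | Y in emb 1 (@Symz p n)])).
  apply: le_measure; rewrite ?inE; [exact: meas|exact: translate_measurable|].
  move=> _ [Y [SY /eqP Yt] <-].
  have /congP[Z eY] : cong k Y X by apply/residue_mxP; rewrite Yt Xt.
  exists (toQ (x *: Z)).
    exists (x *: Z); rewrite ?scale1r // /Symz /= tr_mxZ; congr (_ *: _).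
    have [_ _ KZ _ _] := lattice_Symz p n; apply/(KZ k).
    have -> : pz p ^+ k *: Z = Y - X by rewrite eY addrC addKr.
    by rewrite /Symz /= tr_mxB SY SX.
  rewrite eY toQD scalerDr; congr (_ + _); rewrite !toQZ scalerA; congr (_ *: _).
  by rewrite e pQ_pr divfK ?pqX_neq0.
rewrite mT // ?mK ?ltry // /Sym_Qp /= tr_mxZ -toQT SX //.
Qed.

Lemma volS_fin (a : Zp) k W : a != 0 -> periodic k (@Symz p n) W ->
  vol_Sym R (emb (padic_of_int a)^-1 W) \is a fin_num.
Proof.
move=> a0 pW; have := volS_total_fin a0; have [mu [_ _ mK] ->] := vol_SymP.
rewrite ge0_fin_numE ?measure_ge0 //; apply: le_lt_trans.
apply: le_measure; rewrite ?inE.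
- exact: volS_meas pW.
- exact: volS_meas (periodic_full 0 _).
- by apply: image_subset; exact: pW.1.
Qed.

Lemma volS_pcontent (a : Zp) k : a != 0 -> pcontent k (@Symz p n) (volS a).
Proof.
move=> a0; have := volS_total_fin a0; have [mu [_ _ mK] e] := vol_SymP.
rewrite /volS e => fin.
by apply: measure_content => //; [exact: pQa_neq0|exact: trace_lattice_Sym].
Qed.

Lemma volS_translate (a : Zp) H k W : a != 0 -> Symz H -> periodic k (@Symz p n) W ->
  volS a (translate H W) = volS a W.
Proof.
move=> a0 SH pW; have [mu [_ mT _] e] := vol_SymP; rewrite /volS e.
rewrite emb_translate mT //; first by rewrite /Sym_Qp /= tr_mxZ -toQT SH.
exact: volS_meas pW.
Qed.

Lemma volS_ge0 a W : 0 <= volS a W.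
Proof. by have [mu _ e] := vol_SymP; rewrite /volS e fine_ge0. Qed.

Lemma volS_total1 : volS 1 (@Symz p n) = 1.
Proof.
have [mu [_ _ mK] e] := vol_SymP.
by rewrite /volS e pQ1 invr1 -Sym_ZpE mK.
Qed.

Lemma volS_cls (a : Zp) k X : a != 0 -> Symz X ->
  volS a (cls k (@Symz p n) X) = volS a (cls k (@Symz p n) 0).
Proof.
move=> a0 SX; rewrite (cls_translate k (subgroup_Symz p n) SX).
by rewrite (@volS_translate _ _ k) //; exact: periodic_cls.
Qed.

Lemma volS_cls_gt0 (a : Zp) k X : a != 0 -> Symz X -> 0 < volS a (cls k (@Symz p n) X).
Proof.
move=> a0 SX; rewrite volS_cls // lt_neqAle volS_ge0 andbT eq_sym.
have [N [_ hN]] := pcontent_count R (periodic_full k (@Symz p n)).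
have e1 := hN _ _ (volS_pcontent a0) (fun X => @volS_cls a k X a0).
suff : volS a (@Symz p n) != 0 by rewrite e1; apply: contra_neq => ->; rewrite mul0r.
apply: lt0r_neq0; have [mu [_ _ mK] e] := vol_SymP; rewrite Sym_ZpE in mK.
apply: (@lt_le_trans _ _ (fine (mu (emb 1 (@Symz p n))))); first by rewrite mK.
rewrite /volS -e fine_le //.
- by have := volS_fin (oner_neq0 _) (periodic_full 0 (@Symz p n)); rewrite pQ1 invr1.
- exact: volS_fin a0 (periodic_full 0 _).
rewrite e; apply: le_measure; rewrite ?inE.
- exact: emb_measurable (oner_neq0 Qp) (trace_lattice_Sym p n) (periodic_full 0 _).
- exact: volS_meas (periodic_full 0 _).
move=> _ [Y SY <-]; exists (a *: Y); first by rewrite /Symz /= tr_mxZ SY.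
by rewrite toQZ scalerA mulVf ?pQ_eq0.
Qed.

Lemma volS_unique (a : Zp) k W mu : a != 0 -> periodic k (@Symz p n) W ->
  pcontent k (@Symz p n) mu ->
  (forall X A, Symz X -> periodic k (@Symz p n) A -> mu (translate X A) = mu A) ->
  mu W * volS a (@Symz p n) = mu (@Symz p n) * volS a W.
Proof.
move=> a0 pW muC muT.
apply: (pcontent_uniq_translate (subgroup_Symz p n) pW muC (volS_pcontent a0) muT).
by move=> X A SX pA; apply: volS_translate pA.
Qed.

Lemma volM_unique k W mu : periodic k setT W -> pcontent k setT mu ->
  (forall X A, periodic k setT A -> mu (translate X A) = mu A) ->
  mu W = mu setT * volM W.
Proof.
move=> pW muC muT; rewrite -[LHS]mulr1 -volM_total.
apply: (@pcontent_uniq_translate _ _ _ k) => //.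
- exact: volM_pcontent.
- by move=> X A _; apply: muT.
- by move=> X A _; apply: volM_translate.
Qed.

End Volumes.

(** * Local densities as inverse orbit volumes *)

Section Density.
Variables (R : realType) (p : prime_nat) (n : nat).
Local Notation Zp := (padic_int p).
Local Notation Qp := (padic p).
Local Notation Mn := 'M[Qp]_n.
Local Notation borel := (g_sigma_algebraType (@open 'M[Qp]_n)).
Local Notation Sz := (@Symz p n).
Local Notation volM := (@volM R p n).
Local Notation volS := (@volS R p n).
Implicit Types (W : set 'M[Zp]_n) (H X Y U : 'M[Zp]_n).

Definition orb H : set 'M[Zp]_n := [set H' | zequiv H H'].

Definition pull H W : set 'M[Zp]_n := [set X | W (X^T *m H *m X)].

Lemma orb_sub H : Sz H -> orb H `<=` Sz.
Proof. by move=> SH H' /zequiv_sym_mx; apply. Qed.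

Lemma orb_refl H : orb H H. Proof. exact: zequiv_refl. Qed.

Lemma orb_periodic H k u : Sz H -> u \is a GRing.unit -> \det H = pz p ^+ k * u ->
  periodic (k + 3) Sz (orb H).
Proof.
move=> SH uu dH; split=> [|X Y SY XY HX]; first exact: orb_sub.
have [v vu dX] := zequiv_det HX.
apply: zequiv_trans (HX) _; apply: (@hensel_orbit _ _ _ _ k (u * v ^+ 2)) => //.
- exact: orb_sub HX.
- by rewrite unitrM uu unitrX.
- by rewrite dX dH -mulrA.
Qed.

Lemma pull_periodic k H W O : Sz H -> periodic k O W -> O `<=` Sz ->
  (forall X Y, O X -> Sz Y -> cong k X Y -> O Y) -> periodic k setT (pull H W).
Proof.
move=> SH [WO Wp] OS Op; split=> // X Y _ XY WX.
have c : cong k (X^T *m H *m X) (Y^T *m H *m Y) by do !apply: congM => //; apply: congT.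
apply: (Wp _ _ _ c WX); apply: (Op _ _ _ _ c) => //; first exact: WO.
by rewrite /Symz /= !trmx_mul trmxK SH mulmxA.
Qed.

Definition rmul g W : set 'M[Zp]_n := [set Y | W (Y *m invmx g)].

Lemma rmul_periodic k g W : periodic k setT W -> periodic k setT (rmul g W).
Proof. by move=> [_ Wp]; split=> // X Y _ XY; apply: Wp => //; apply: congM. Qed.

Lemma volM_rmul k g W : g \in unitmx -> periodic k setT W -> volM (rmul g W) = volM W.
Proof.
move=> gu pW.
rewrite (@volM_unique R p n k W (fun A => volM (rmul g A))) //.
- by rewrite (_ : rmul g setT = setT) ?volM_total ?mul1r //; apply/seteqP.
- move=> A B pA pB AB.
  rewrite (_ : rmul g (A `|` B) = rmul g A `|` rmul g B) //.
  apply: (@volM_pcontent R p n k); [exact: rmul_periodic|exact: rmul_periodic|].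
  apply/seteqP; split=> // Y [h1 h2].
  by have : (A `&` B) (Y *m invmx g) by []; rewrite AB.
- move=> X A pA; rewrite -(volM_translate R (X *m g) (rmul_periodic g pA)).
  congr volM; apply/seteqP; split=> Y /=.
    move=> [Z AZ eZ]; exists (Z *m g); first by rewrite /rmul /= mulmxK.
    by rewrite -mulmxDl eZ mulmxKV.
  by move=> [Z AZ <-]; exists (Z *m invmx g); rewrite // mulmxDl mulmxK.
Qed.

Lemma volS_neq0 (a : Zp) : a != 0 -> volS a Sz != 0.
Proof.
by move=> a0; rewrite -(cls0 Sz 0) lt0r_neq0 // volS_cls_gt0 //; case: (subgroup_Symz p n).
Qed.

Definition cpull g W : set 'M[Zp]_n := [set Y | Sz Y /\ W (g^T *m Y *m g)].

Lemma cpull_periodic k g W : periodic k Sz W -> periodic k Sz (cpull g W).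
Proof.
move=> [WS Wp]; split=> [X []//|X Y SY XY [SX WX]]; split=> //.
apply: Wp WX; first by rewrite /Symz /= !trmx_mul trmxK SY mulmxA.
by do !apply: congM.
Qed.

(** The volume of the preimage under congruence by g is again a translation invariant content with
    the same total mass, so uniqueness shows that the Jacobian is 1. *)
Lemma volS_cpull (a : Zp) k g W : a != 0 -> g \in unitmx -> periodic k Sz W ->
  volS a (cpull g W) = volS a W.
Proof.
move=> a0 gu pW; have v0 := volS_neq0 a0; apply: (mulIf v0).
have gS Y : Sz (g^T *m Y *m g) <-> Sz Y.
  rewrite /Symz /= !trmx_mul trmxK -mulmxA; split=> [e|-> //].
  have gTu : g^T \in unitmx by rewrite unitmx_tr.
  by move: e => /(congr1 (mulmx (invmx g^T))); rewrite !mulKmx // => /(congr1 (mulmx^~ (invmx g)));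
    rewrite !mulmxK.
rewrite (@volS_unique R p n a k W (fun A => volS a (cpull g A))) //.
- rewrite mulrC; congr (_ * volS _ _); apply/seteqP; split=> Y; first by case.
  by move=> SY; split=> //; apply/gS.
- move=> A B pA pB AB.
  rewrite (_ : cpull g (A `|` B) = cpull g A `|` cpull g B); last first.
    apply/seteqP; split=> Y; first by move=> [SY []]; [left|right].
    by move=> [] [SY h]; split=> //; [left|right].
  apply: (@volS_pcontent R p n a k a0); [exact: cpull_periodic|exact: cpull_periodic|].
  apply/seteqP; split=> // Y [[_ h1] [_ h2]].
  by have : (A `&` B) (g^T *m Y *m g) by []; rewrite AB.
- move=> X A SX pA.
  pose X' := (invmx g)^T *m X *m invmx g.
  have eX : g^T *m X' *m g = X.
    by rewrite /X' !mulmxA -trmx_mul mulVmx // trmx1 mul1mx mulmxKV.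
  have SX' : Sz X' by apply/gS; rewrite eX.
  rewrite -(volS_translate R a0 SX' (cpull_periodic g pA)).
  have [S0 SD SN] := subgroup_Symz p n.
  congr (volS a); apply/seteqP; split=> Y /=.
    move=> [SY [Z AZ eZ]]; exists (- X' + Y); last by rewrite addrA subrr add0r.
    split; first by apply: SD => //; apply: SN.
    by rewrite mulmxDr mulmxDl mulmxN mulNmx eX -eZ addrA addNr add0r.
  move=> [Z [SZ AZ] <-]; split; first exact: SD.
  by exists (g^T *m Z *m g); rewrite // mulmxDr mulmxDl eX.
Qed.

(** If X^T H X lies in the orbit of H, comparing determinants makes det X squared the square of a
    unit. *)
Lemma pull_orb H : \det H != 0 -> pull H (orb H) = [set X | X \in unitmx].
Proof.
move=> dH; apply/seteqP; split=> X; last by move=> Xu; exists X.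
move=> /zequiv_det[u uu]; rewrite /= !det_mulmx det_tr => e.
have /(mulfI dH) eX : \det H * (\det X ^+ 2) = \det H * u ^+ 2 by rewrite -e; ring.
by rewrite unitmxE -(unitrX_pos _ (_ : 0 < 2)%N) // eX unitrX.
Qed.

(* Both volumes are invariant under the transitive action of GL_n(Z_p) on the
   orbit, which permutes the residue classes it consists of. *)
Lemma vol_pull (a : Zp) H k u j W : a != 0 -> Sz H -> u \is a GRing.unit ->
  \det H = pz p ^+ k * u -> (k + 3 <= j)%N -> periodic j Sz W -> W `<=` orb H ->
  volM (pull H W) * volS a (orb H) = volM [set X | X \in unitmx] * volS a W.
Proof.
move=> a0 SH uu dH kj pW WO.
have H0 : \det H != 0.
  by rewrite dH mulf_eq0 negb_or prX_neq0 //=; apply: contraTneq uu => ->; rewrite unitr0.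
have pO : periodic j Sz (orb H) := periodic_le kj (orb_periodic SH uu dH).
have pull_per A : periodic j (orb H) A -> periodic j setT (pull H A).
  move=> pA; apply: (pull_periodic SH pA); first exact: orb_sub.
  by move=> X Y OX SY XY; apply: pO.2 XY OX.
have pWO : periodic j (orb H) W.
  by split=> // X Y OY XY WX; apply: pW.2 XY WX; apply: orb_sub OY.
rewrite -(pull_orb H0).
have clsE X : orb H X -> cls j (orb H) X = cls j Sz X.
  move=> OX; apply/seteqP; split=> Y [OY YX]; split=> //; first exact: orb_sub OY.
  by apply: pO.2 (cong_sym YX) OX.
apply: (@pcontent_uniq _ _ _ j (orb H) W (fun A => volM (pull H A)) (volS a)
    (volM (pull H (cls j (orb H) H))) (volS a (cls j Sz 0))) => //.
- move=> A B pA pB AB; apply: (@volM_pcontent R p n j); [exact: pull_per|exact: pull_per|].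
  apply/seteqP; split=> // Y [h1 h2].
  by have : (A `&` B) (Y^T *m H *m Y) by []; rewrite AB.
- move=> A B pA pB; apply: (@volS_pcontent R p n a j a0); exact: periodic_trans pO _.
- move=> X [g gu eX].
  rewrite -(volM_rmul gu (pull_per _ (periodic_cls j (orb H) H))).
  congr volM; apply/seteqP; split=> Y.
    move=> [OY YX]; split.
      apply: zequiv_trans OY _; exists (invmx g); first by rewrite unitmx_inv.
      by rewrite trmx_mul !mulmxA.
    have e1 : (Y *m invmx g)^T *m H *m (Y *m invmx g) =
        (invmx g)^T *m (Y^T *m H *m Y) *m invmx g by rewrite trmx_mul !mulmxA.
    have e2 : H = (invmx g)^T *m (g^T *m H *m g) *m invmx g.
      by rewrite !mulmxA -trmx_mul mulmxV // trmx1 mul1mx mulmxK.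
    by rewrite e1 {2}e2 -eX; do !apply: congM.
  move=> [OY YH]; have e : Y^T *m H *m Y =
      g^T *m ((Y *m invmx g)^T *m H *m (Y *m invmx g)) *m g.
    by rewrite trmx_mul !mulmxA -trmx_mul mulVmx // trmx1 mul1mx mulmxKV.
  split; first by rewrite e; apply: zequiv_trans OY _; exists g.
  by rewrite eX e; do !apply: congM.
- by move=> X OX; rewrite clsE // volS_cls //; apply: orb_sub OX.
Qed.

End Density.

Section LocalDensityValue.
Variables (R : realType) (p : prime_nat) (n : nat).
Local Notation Zp := (padic_int p).
Local Notation Qp := (padic p).
Local Notation Mn := 'M[Qp]_n.
Local Notation borel := (g_sigma_algebraType (@open 'M[Qp]_n)).
Local Notation Sz := (@Symz p n).
Local Notation volM := (@volM R p n).
Local Notation volS := (@volS R p n).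

Lemma within_Sym_proper (G : Mn) : Sym_Qp G ->
  ProperFilter (within (@Sym_Qp p n) (nbhs G)).
Proof.
move=> SG; apply: Build_ProperFilter_ex => P /nbhs_singleton PG; exists G; exact: PG.
Qed.

Lemma shrinking_nbhs_proper (G : Mn) : Sym_Qp G -> ProperFilter (shrinking_nbhs G).
Proof.
move=> SG; have PF := within_Sym_proper SG.
have GF := powerset_filter_from_filter PF.
apply: Build_ProperFilter_ex => P [M [MF Mdown [E ME]] MP].
have [k kE] : exists k, mball k G `<=` [set X | Sym_Qp X -> E X].
  by apply/nbhs_mxP; exact: MF.
pose U := mball k G `&` @Sym_Qp p n.
have oU : open_in_Sym U by exists (mball k G) => //; exact: mball_open.
exists U; apply: MP => //; apply: (Mdown E) => //.
  apply/nbhs_mxP; exists k => X kX SX; by split.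
by move=> X [kX SX]; apply: kE.
Qed.

Lemma two_neq0 : 2%:R != 0 :> Zp.
Proof.
apply/eqP => /(congr1 (fun x : Zp => x 2%N)); rewrite residue_nat residue0 modn_small //.
by rewrite -[2%N]/(2 ^ 1)%N (@leq_trans (2 ^ 2)) // leq_exp2r ?p_gt1.
Qed.

Lemma trmx_nondeg m (B : 'M[Zp]_m) : \det B != 0 -> toQ B \in unitmx.
Proof. by move=> B0; rewrite unitmxE det_map_mx unitfE pQ_eq0. Qed.

Lemma volS_le (a : Zp) j k A B : a != 0 -> periodic j Sz A -> periodic k Sz B ->
  A `<=` B -> volS a A <= volS a B.
Proof.
move=> a0 pA pB AB; have [fA fB] := (volS_fin R a0 pA, volS_fin R a0 pB).
apply: fine_le => //; have [mu _ ->] := vol_SymP R p n; apply: le_measure; rewrite ?inE.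
- exact: volS_meas a0 pA.
- exact: volS_meas a0 pB.
- exact: image_subset.
Qed.

Lemma volS_gt0 (a : Zp) k A X : a != 0 -> periodic k Sz A -> A X -> 0 < volS a A.
Proof.
move=> a0 pA AX; have SX := pA.1 X AX.
apply: (lt_le_trans (volS_cls_gt0 R k a0 SX)).
apply: (volS_le a0 (periodic_cls k Sz X) pA) => Y [SY YX].
by apply: pA.2 (cong_sym YX) AX.
Qed.

Local Notation half := ((padic_of_int (2%:R : Zp))^-1).

(** Once U lies in the class of H modulo p^(k + 3) it lies in the orbit, where the quotient of
    volumes is constant; the limit is that of an eventually constant function. *)
Lemma local_densityE (Q : qform p n) (H : 'M[Zp]_n) k u :
  Sz H -> u \is a GRing.unit -> \det H = pz p ^+ k * u ->
  (Q : Mn) = half *: toQ H ->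
  local_density R Q = 2^-1 * (volM [set X | X \in unitmx] / volS 2%:R (orb H)).
Proof.
move=> SH uu dH eQ; rewrite /local_density; congr (_ * _).
have h0 : half != 0 by rewrite invr_eq0 pQ_eq0 two_neq0.
have SQ : Sym_Qp (Q : Mn) by rewrite /Sym_Qp /= eQ tr_mxZ -toQT SH.
have PF := shrinking_nbhs_proper SQ.
pose C := emb half (cls (k + 3) Sz H).
have FC : within (@Sym_Qp p n) (nbhs (Q : Mn)) C.
  apply/nbhs_mxP; exists (k + 3)%N => X [Z eX] SX.
  have eH : half *: toQ (H + pz p ^+ (k + 3) *: (2%:R *: Z)) = X.
    rewrite eX eQ toQD scalerDr; congr (_ + _); rewrite !toQZ !scalerA !pQ_pr.
    by congr (_ *: _); rewrite mulrCA mulVf ?mulr1 // pQ_eq0 two_neq0.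
  exists (H + pz p ^+ (k + 3) *: (2%:R *: Z)) => //.
  split; last by apply/congP; exists (2%:R *: Z).
  by apply: toQ_inj; apply: (scalerI h0); rewrite toQT -tr_mxZ eH SX.
apply: (lim_near_cst (@Rhausdorff R)).
rewrite /shrinking_nbhs; near_simpl.
have GF := powerset_filter_from_filter (within_Sym_proper SQ).
have := powerset_filter_fromP FC; apply: filterS => U [FU UC] [V oV eU].
have UQ : U (Q : Mn) by apply: (nbhs_singleton FU).
pose U' := [set X | Sz X /\ V (half *: toQ X)].
have SemB X : Sz X -> Sym_Qp (half *: toQ X).
  by move=> SX; rewrite /Sym_Qp /= tr_mxZ -toQT SX.
have U'U : U = emb half U'.
  rewrite -emb_open_trace eU; apply/seteqP; split=> X [VX SX]; split=> //.
    have /UC[Y [SY _] <-] : U X by rewrite eU.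
    by exists Y.
  by case: SX => Y SY <-; apply: SemB.
have U'cls : U' `<=` cls (k + 3) Sz H.
  move=> X [SX VX]; have : U (half *: toQ X) by rewrite U'U; exists X.
  by move=> /UC [Y cY /(emb_inj h0) <-].
have pO := orb_periodic SH uu dH.
have U'O : U' `<=` orb H.
  by move=> X /U'cls[SX /cong_sym XH]; apply: pO.2 XH (orb_refl H).
have oU' X : U' X -> exists j, core j Sz U' X by move=> [SX VX]; apply: core_of_open.
have N_eq : [set X : Mn | Mat_Zp X /\ U (X^T *m Q *m X)] = emb 1 (pull H U').
  rewrite Mat_ZpE; apply/seteqP; split=> X.
    move=> [[Y _ <-]]; rewrite scale1r eQ -scalemxAr -scalemxAl -toQT -!toQM U'U.
    by move=> [Z UZ /(emb_inj h0) eZ]; exists Y; rewrite ?scale1r // /pull /= -eZ.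
  move=> [Y UY <-]; split; first by exists Y.
  rewrite scale1r eQ -scalemxAr -scalemxAl -toQT -!toQM U'U.
  by exists (Y^T *m H *m Y).
have ratio j : volM (pull H (core (k + 3 + j) Sz U')) * volS 2%:R (orb H) =
    volM [set X | X \in unitmx] * volS 2%:R (core (k + 3 + j) Sz U').
  apply: (@vol_pull R p n _ H k u (k + 3 + j)) => //; first exact: two_neq0.
  - exact: leq_addr.
  - exact: core_periodic.
  - by apply: subset_trans U'O; exact: core_sub.
have vO : 0 < volS 2%:R (orb H) := volS_gt0 two_neq0 pO (orb_refl H).
set c := volM _ / _.
have eqc : vol_Mat R (emb 1 (pull H U')) = (c%:E * vol_Sym R (emb half U'))%E.
  have [muM _ eM] := vol_MatP R p n; have [muS _ eS] := vol_SymP R p n.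
  have [mU cS] := core_cvg muS h0 (trace_lattice_Sym p n) oU'.
  have pullU : emb 1 (pull H U') = \bigcup_j emb 1 (pull H (core (k + 3 + j) Sz U')).
    apply/seteqP; split=> X.
      move=> [Y UY <-]; have [j jY] := oU' _ UY; exists j => //; exists Y => //.
      by apply: core_le jY; exact: leq_addl.
    by move=> [j _ [Y jY <-]]; exists Y => //; apply: core_sub jY.
  have perN j : periodic (k + 3 + j) setT (pull H (core (k + 3 + j) Sz U')).
    by apply: (pull_periodic SH (core_periodic _ _ _)).
  have mN j : measurable (emb 1 (pull H (core (k + 3 + j) Sz U')) : set borel).
    exact: emb_measurable (oner_neq0 Qp) (trace_latticeT p n) (perN j).
  have cM : muM (emb 1 (pull H (core (k + 3 + j) Sz U'))) @[j --> \oo] --> muM (emb 1 (pull H U')).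
    rewrite pullU; apply: nondecreasing_cvg_mu => //; first exact: bigcupT_measurable.
    move=> i j ij; apply/subsetPset; apply: image_subset => X.
    by apply: core_le; rewrite leq_add2l.
  have cS' : (c%:E * muS (emb half (core (k + 3 + j) Sz U')))%E @[j --> \oo] -->
      (c%:E * muS (emb half U'))%E.
    apply: cvgeZl => //; rewrite -(cvg_shiftn (k + 3)) in cS.
    by under eq_fun do rewrite addnC.
  have e : (fun j => muM (emb 1 (pull H (core (k + 3 + j) Sz U')))) =
      (fun j => c%:E * muS (emb half (core (k + 3 + j) Sz U')))%E.
    apply/funext => j; rewrite -eM -eS.
    rewrite -(fineK (volM_fin R (perN j))) -(fineK (volS_fin R two_neq0 (core_periodic (k + 3 + j) Sz U'))).
    rewrite -EFinM; congr (_%:E); have := ratio j; rewrite /volM /volS => er.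
    by rewrite /c mulrAC -er mulfK // lt0r_neq0.
  by rewrite eM eS; rewrite e in cM; exact: cvg_unique cM cS'.
rewrite N_eq eqc -U'U.
have [muS _ eS] := vol_SymP R p n.
have Ufin : vol_Sym R U \is a fin_num.
  have fC : vol_Sym R C \is a fin_num := volS_fin R two_neq0 (periodic_cls _ _ _).
  have [mU _] := core_cvg muS h0 (trace_lattice_Sym p n) oU'.
  move: fC; rewrite eS !ge0_fin_numE ?measure_ge0 //; apply: le_lt_trans.
  apply: le_measure; rewrite ?inE //; first by rewrite U'U.
  exact: volS_meas two_neq0 (periodic_cls _ _ _).
have Upos : 0 < fine (vol_Sym R U).
  have [j jH] : exists j, core j Sz U' H.
    by apply: oU'; split=> //; have := UQ; rewrite eU eQ => -[].
  apply: (@lt_le_trans _ _ (volS 2%:R (cls j Sz H))); first exact: volS_cls_gt0 two_neq0 SH.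
  have [mU _] := core_cvg muS h0 (trace_lattice_Sym p n) oU'.
  rewrite /volS fine_le //; first exact: volS_fin two_neq0 (periodic_cls _ _ _).
  rewrite eS; apply: le_measure; rewrite ?inE.
  - exact: volS_meas two_neq0 (periodic_cls _ _ _).
  - by rewrite U'U.
  - by rewrite U'U; apply: image_subset => X [SX XH]; apply: jH.2.
by rewrite -(fineK Ufin) -EFinM /= mulfK // lt0r_neq0.
Unshelve. all: by end_near. Qed.

End LocalDensityValue.

(** * Primitive Hessians and mass sums *)

Lemma mulmx_solve (F : comUnitRingType) n (P V : 'M[F]_n) : P \in unitmx ->
  exists W, P *m W = V.
Proof. by move=> Pu; exists (invmx P *m V); rewrite mulKVmx. Qed.

Section EvenForms.
Variables (p : prime_nat) (n : nat).
Local Notation Zp := (padic_int p).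
Local Notation Qp := (padic p).
Local Notation Mn := 'M[Qp]_n.
Local Notation Sz := (@Symz p n).
Local Notation half := ((padic_of_int (2%:R : Zp))^-1).
Implicit Types (H L U : 'M[Zp]_n) (Q : qform p n).

(* Hessian matrices of the Z_p-valued forms: L is the matrix of x |-> x^T L x. *)
Definition Ev : set 'M[Zp]_n := [set H | exists L, H = L + L^T].

Definition Pr : set 'M[Zp]_n :=
  [set H | Ev H /\ ~ exists2 H', Ev H' & H = pz p *: H'].

Lemma Ev_sym : Ev `<=` Sz.
Proof. by move=> _ [L ->]; rewrite /Symz /= tr_mxD trmxK addrC. Qed.

Lemma Pr_sym : Pr `<=` Sz.
Proof. by move=> H [/Ev_sym]. Qed.

Lemma Ev_congr U H : Ev H -> Ev (U^T *m H *m U).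
Proof.
move=> [L ->]; exists (U^T *m L *m U).
by rewrite mulmxDr mulmxDl !trmx_mul trmxK mulmxA.
Qed.

Lemma Pr_zequiv H H' : zequiv H H' -> Pr H -> Pr H'.
Proof.
move=> HH' [EH nH]; have [V Vu eH] := zequiv_sym HH'.
have [U Uu eH'] := HH'; split; first by rewrite eH'; apply: Ev_congr.
move=> [H1 EH1 e]; apply: nH; exists (V^T *m H1 *m V); first exact: Ev_congr.
by rewrite eH e -scalemxAr -scalemxAl.
Qed.

Lemma add_tr_mxE (A : 'M[Zp]_1) : (A + A^T) ord0 ord0 = 2%:R * A ord0 ord0.
Proof. by rewrite !mxE; ring. Qed.

Lemma qval_even Q L (x : 'cV[Zp]_n) : (Q : Mn) = half *: toQ (L + L^T) ->
  qval Q (toQ x) = padic_of_int ((x^T *m L *m x) ord0 ord0).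
Proof.
move=> eQ; rewrite /qval eQ -scalemxAr -scalemxAl -toQT -!toQM mxE mxE.
have -> : x^T *m (L + L^T) *m x = x^T *m L *m x + (x^T *m L *m x)^T.
  by rewrite mulmxDr mulmxDl !trmx_mul trmxK mulmxA.
by rewrite add_tr_mxE pQM mulKf // pQ_eq0 two_neq0.
Qed.

Lemma cV_form (a : 'M[Zp]_n) i j :
  ((delta_mx i 0 : 'cV_n)^T *m a *m (delta_mx j 0 : 'cV_n)) ord0 ord0 = a i j.
Proof. by rewrite trmx_delta -rowE -colE !mxE. Qed.

Lemma cV_form2 (a : 'M[Zp]_n) i j :
  let x := (delta_mx i 0 + delta_mx j 0 : 'cV_n) in
  (x^T *m a *m x) ord0 ord0 = a i i + a j j + (a i j + a j i).
Proof.
rewrite /= tr_mxD mulmxDl !mulmxDr !mulmxDl mxE [in X in X + _]mxE [in X in _ + X]mxE.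
by rewrite !cV_form; ring.
Qed.

Lemma half_scale_inj : injective (fun H => half *: toQ H).
Proof. by apply: emb_inj; rewrite invr_eq0 pQ_eq0 two_neq0. Qed.

Lemma half_two (x : Qp) : 2%:R * (half * x) = x.
Proof. by rewrite -pQ_nat mulrA mulfV ?mul1r // pQ_eq0 two_neq0. Qed.

Lemma delta_toQ (i : 'I_n) : (delta_mx i 0 : 'cV[Qp]_n) = toQ (delta_mx i 0 : 'cV[Zp]_n).
Proof. by apply/matrixP => a b; rewrite !mxE; case: (_ && _); rewrite ?pQ1 ?pQ0. Qed.

Lemma cV_formQ (a : 'M[Qp]_n) i j :
  ((delta_mx i 0 : 'cV_n)^T *m a *m (delta_mx j 0 : 'cV_n)) ord0 ord0 = a i j.
Proof. by rewrite trmx_delta -rowE -colE !mxE. Qed.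

Lemma Zp_valued_even Q : Zp_valued Q -> exists2 H, Ev H & (Q : Mn) = half *: toQ H.
Proof.
have [/eqP SQ _] := andP (gramP Q).
move=> ZQ.
have diag i : exists z : Zp, (Q : Mn) i i = padic_of_int z.
  by have := ZQ (delta_mx i 0); rewrite /qval -delta_toQ cV_formQ => -[z _ <-]; exists z.
have off i j : exists z : Zp, 2%:R * (Q : Mn) i j = padic_of_int z.
  have := ZQ (delta_mx i 0 + delta_mx j 0); rewrite /qval toQD -!delta_toQ.
  rewrite tr_mxD mulmxDl !mulmxDr !mulmxDl mxE [in X in X + _]mxE [in X in _ + X]mxE !cV_formQ.
  have -> : (Q : Mn) j i = (Q : Mn) i j by rewrite -[in LHS]SQ mxE.
  have [a ea] := diag i; have [b eb] := diag j; rewrite ea eb => -[z _ e].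
  by exists (z - a - b); rewrite !pQB e; ring.
have /choice[d dP] := diag.
have /choice[f fP] : forall ij : 'I_n * 'I_n, exists z : Zp,
    2%:R * (Q : Mn) ij.1 ij.2 = padic_of_int z by move=> [i j]; apply: off.
(* A triangular L is the matrix of the quadratic polynomial itself: symmetrising it doubles the
   diagonal and copies each mixed coefficient once. *)
pose L : 'M[Zp]_n := \matrix_(i, j) if (j < i)%N then f (i, j) else if i == j then d i else 0.
exists (L + L^T); first by exists L.
have sQ i j : (Q : Mn) j i = (Q : Mn) i j by rewrite -[in LHS]SQ mxE.
apply/matrixP => i j; apply: (mulfI (_ : 2%:R != 0 :> Qp)); first by rewrite -pQ_nat pQ_eq0 two_neq0.
rewrite [in RHS]mxE half_two !mxE eq_sym; case: (ltngtP j i) => ij.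
- by rewrite -val_eqE /= (ltn_eqF ij) addr0 -(fP (i, j)).
- by rewrite -val_eqE /= (gtn_eqF ij) add0r -(fP (j, i)) /= sQ.
- by move/val_inj: ij => <-; rewrite eqxx pQD -dP; ring.
Qed.

(** The values at basis vectors and at sums of two of them are the coefficients of the form up to
    subtraction, so p divides every coefficient. *)
Lemma even_dvd L : (forall x : 'cV[Zp]_n, (x^T *m L *m x) ord0 ord0 \isn't a GRing.unit) ->
  exists2 H', Ev H' & L + L^T = pz p *: H'.
Proof.
move=> nu.
have val (x : 'cV[Zp]_n) : exists z, (x^T *m L *m x) ord0 ord0 = pz p * z.
  by apply: nonunit_dvd.
have diag i : exists z, L i i = pz p * z.
  by have [z] := val (delta_mx i 0); rewrite cV_form; exists z.
have off (ij : 'I_n * 'I_n) : exists z, L ij.1 ij.2 + L ij.2 ij.1 = pz p * z.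
  have [z] := val (delta_mx ij.1 0 + delta_mx ij.2 0); rewrite cV_form2.
  have [a ->] := diag ij.1; have [b ->] := diag ij.2 => e.
  exists (z - a - b); rewrite !mulrBr -e; ring.
have /choice[d dP] := diag; have /choice[f fP] := off.
pose L' : 'M[Zp]_n := \matrix_(i, j) if (j < i)%N then f (i, j) else if i == j then d i else 0.
exists (L' + L'^T); first by exists L'.
apply/matrixP => i j; rewrite !mxE eq_sym; case: (ltngtP j i) => ij.
- by rewrite -val_eqE /= (ltn_eqF ij) addr0 -(fP (i, j)).
- by rewrite -val_eqE /= (gtn_eqF ij) add0r -(fP (j, i)) addrC.
- by move/val_inj: ij => <-; rewrite eqxx mulrDr -dP.
Qed.

Lemma primitiveP Q : primitive Q <-> exists2 H, Pr H & (Q : Mn) = half *: toQ H.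
Proof.
split=> [[ZQ spanQ]|[H [[L eH] nH] eQ]].
  have [H EH eQ] := Zp_valued_even ZQ; exists H => //; split=> // -[_ [L ->] eH].
  have : padicZ (1 : Qp) by exists 1; rewrite ?pQ1.
  rewrite -spanQ => -[m [c [x e]]].
  have eQ' : (Q : Mn) = half *: toQ (pz p *: L + (pz p *: L)^T) by rewrite eQ eH tr_mxZ scalerDr.
  have : (1 : Zp) = pz p * \sum_(i < m) c i * ((x i)^T *m L *m x i) ord0 ord0.
    apply: (@pQ_inj p); rewrite pQ1 e pQM [in RHS](big_morph _ (@pQD p) (@pQ0 p)) mulr_sumr.
    apply: eq_bigr => i _; rewrite (qval_even _ eQ') -scalemxAr -scalemxAl mxE !pQM.
    by rewrite mulrCA.
  by move=> e1; have := pr_nonunit (\sum_(i < m) c i * ((x i)^T *m L *m x i) ord0 ord0);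
    rewrite -e1 unitr1.
rewrite eH in eQ; have ZQ : Zp_valued Q.
  by move=> x; rewrite (qval_even _ eQ); eexists.
split=> //; apply/seteqP; split=> [y [m [c [x ->]]]|_ [z _ <-]].
  exists (\sum_(i < m) c i * ((x i)^T *m L *m x i) ord0 ord0) => //.
  rewrite (big_morph _ (@pQD p) (@pQ0 p)); apply: eq_bigr => i _.
  by rewrite (qval_even _ eQ) pQM.
have [x xu] : exists x : 'cV[Zp]_n, (x^T *m L *m x) ord0 ord0 \is a GRing.unit.
  apply: contrapT => nx; apply: nH; rewrite eH; apply: even_dvd => x.
  by apply/negP => xu; apply: nx; exists x.
exists 1%N, (fun=> z * ((x^T *m L *m x) ord0 ord0)^-1), (fun=> x).
by rewrite big_ord1 (qval_even _ eQ) -pQM mulrVK.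
Qed.

Lemma qform_of_subproof H : Sz H -> \det H != 0 ->
  ((half *: toQ H)^T == half *: toQ H) && (half *: toQ H \in unitmx).
Proof.
move=> SH dH; rewrite tr_mxZ -toQT SH eqxx /=.
by rewrite unitmxZ ?trmx_nondeg // unitfE invr_eq0 pQ_eq0 two_neq0.
Qed.

Lemma qform_of H : Sz H -> \det H != 0 -> exists Q : qform p n, (Q : Mn) = half *: toQ H.
Proof. by move=> SH dH; exists (QForm (qform_of_subproof SH dH)). Qed.

Lemma detH_even Q H : (Q : Mn) = half *: toQ H -> detH Q = padic_of_int (\det H).
Proof.
move=> eQ; rewrite /detH /hessian eQ scalerA -pQ_nat mulfV ?pQ_eq0 ?two_neq0 // scale1r.
exact: det_map_mx.
Qed.

Lemma Zp_equivP Q Q' H H' : (Q : Mn) = half *: toQ H -> (Q' : Mn) = half *: toQ H' ->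
  Zp_equiv Q Q' <-> zequiv H H'.
Proof.
move=> eQ eQ'; split=> -[U Uu e]; exists U => //.
  apply: half_scale_inj; rewrite /= -eQ' e eQ.
  by rewrite !toQM toQT -scalemxAr -scalemxAl.
by rewrite eQ' eQ e !toQM toQT -scalemxAr -scalemxAl.
Qed.

Definition hasse_diag m (a : 'rV[Qp]_m) : int :=
  \prod_(i < m) \prod_(j < m | (i < j)%N) hilbert (a ord0 i) (a ord0 j).

(** The same [xget] as in [hasse], for matrices that are not packaged as forms, so that both agree
    by conversion. *)
Definition hasse_mx m (M : 'M[Qp]_m) : int :=
  hasse_diag (xget 0 [set a | exists2 P, P \in unitmx & P^T *m M *m P = diag_mx a]).

Lemma hasse_mxE m (Q : qform p m) : hasse_mx Q = hasse Q.
Proof. by []. Qed.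

(** Congruent matrices have the same set of diagonalisations, hence [xget] makes the same choice for
    both. *)
Lemma hasse_mx_congr m (P M : 'M[Qp]_m) : P \in unitmx ->
  hasse_mx (P^T *m M *m P) = hasse_mx M.
Proof.
move=> Pu; congr (hasse_diag (xget 0 _)); apply/seteqP; split=> a [V Vu e].
  exists (P *m V); first by rewrite unitmx_mul Pu.
  by rewrite -e trmx_mul !mulmxA.
have [W PW] := mulmx_solve V Pu; rewrite -PW in Vu e.
exists W; first by move: Vu; rewrite unitmx_mul Pu.
by rewrite -e trmx_mul !mulmxA.
Qed.

(* The primitive Hessians representing the genera counted by mass_sum. *)
Definition mass_set (e : int) (S : nat) : set 'M[Zp]_n :=
  [set H | [/\ Pr H, exists2 u : Zp, u \is a GRing.unit & \det H = S%:R * u ^+ 2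
             & hasse_mx (half *: toQ H) = e]].

Lemma mass_set_zequiv e S H H' : zequiv H H' -> mass_set e S H -> mass_set e S H'.
Proof.
move=> HH' [PH [u uu dH] hH]; split; first exact: Pr_zequiv HH' PH.
  have [v vu ->] := zequiv_det HH'; exists (u * v); first by rewrite unitrM uu.
  by rewrite dH exprMn -mulrA.
have [U Uu ->] := HH'; rewrite -hH.
have -> : half *: toQ (U^T *m H *m U) = (toQ U)^T *m (half *: toQ H) *m toQ U.
  by rewrite !toQM toQT -scalemxAr -scalemxAl.
apply: hasse_mx_congr; apply: trmx_nondeg; apply/eqP => U0.
by move: Uu; rewrite unitmxE U0 unitr0.
Qed.

Lemma natZ_neq0 (S : nat) : (0 < S)%N -> S%:R != 0 :> Zp.
Proof.
move=> S0; apply/eqP => /(congr1 (fun x : Zp => x S)).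
have lt : (S < p ^ S)%N := ltn_expl S (p_gt1 p).
by rewrite residue_nat residue0 (modn_small lt) => S00; rewrite S00 in S0.
Qed.

Lemma mass_set_ord S : (0 < S)%N -> exists k, forall e H, mass_set e S H ->
  exists2 u : Zp, u \is a GRing.unit & \det H = pz p ^+ k * u.
Proof.
move=> S0; have [k [s su eS]] := zp_ordP (natZ_neq0 S0).
exists k => e H [_ [u uu ->] _]; exists (s * u ^+ 2); first by rewrite unitrM su unitrX.
by rewrite eS -mulrA.
Qed.

End EvenForms.

Section MassSum.
Local Open Scope quotient_scope.
Variables (R : realType) (p : prime_nat) (n : nat).
Local Notation Zp := (padic_int p).
Local Notation Qp := (padic p).
Local Notation Mn := 'M[Qp]_n.
Local Notation Sz := (@Symz p n).
Local Notation half := ((padic_of_int (2%:R : Zp))^-1).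
Local Notation volM := (@volM R p n).
Local Notation volS := (@volS R p n).
Implicit Types (H : 'M[Zp]_n) (Q : qform p n) (g : local_genus p n).

Lemma genus_eq g g' : Zp_equiv (repr g) (repr g') -> g = g'.
Proof.
move=> h; rewrite -[g]reprK -[g']reprK; apply/eqmodP; exact/asboolP.
Qed.

Lemma genus_repr Q : Zp_equiv Q (repr (\pi_(local_genus p n) Q)).
Proof.
have /eqmodP/asboolP : Q = repr (\pi_(local_genus p n) Q) %[mod local_genus p n].
  by rewrite reprK.
by [].
Qed.

Definition genus_hessian g : 'M[Zp]_n :=
  xget 0 [set H | (repr g : Mn) = half *: toQ H].

Lemma genera_hessian S e g : genera S e g ->
  (repr g : Mn) = half *: toQ (genus_hessian g) /\ mass_set e S (genus_hessian g).
Proof.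
move=> [/primitiveP[H PH eH] [_ [u uu <-] eS] he].
have eG : (repr g : Mn) = half *: toQ (genus_hessian g).
  by rewrite /genus_hessian; case: xgetP => [H' ->|/(_ H)] //; case.
have HG : genus_hessian g = H by apply: (@half_scale_inj p n); rewrite /= -eG -eH.
split; first exact: eG.
rewrite HG; split; [exact: PH| |by rewrite -eH hasse_mxE].
exists u => //; apply: (@pQ_inj p).
by rewrite -(detH_even eH) eS pQM pQX pQ_nat.
Qed.

Lemma mass_set_genus S e H : (0 < S)%N -> mass_set e S H ->
  exists2 g, genera S e g & zequiv (genus_hessian g) H.
Proof.
move=> S0 MH; have [k kP] := mass_set_ord p n S0.
have [PH _ _] := MH; have SH := Pr_sym PH.
have H0 : \det H != 0.
  have [u uu ->] := kP _ _ MH; rewrite mulf_eq0 negb_or prX_neq0 /=.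
  by apply: contraTneq uu => ->; rewrite unitr0.
have [Q eQ] := qform_of SH H0.
pose g := \pi_(local_genus p n) Q.
have [U Uu eU] := genus_repr Q.
have eg : (repr g : Mn) = half *: toQ (U^T *m H *m U).
  by rewrite eU eQ !toQM toQT -scalemxAr -scalemxAl.
have HU : zequiv H (U^T *m H *m U) by exists U.
have [PU [u uu dU] hU] := mass_set_zequiv HU MH.
have gg : genera S e g.
  split; [by apply/primitiveP; exists (U^T *m H *m U)| |by rewrite -hasse_mxE eg].
  exists (padic_of_int u); first by exists u.
  by rewrite (detH_even eg) dU pQM pQX pQ_nat.
exists g => //; apply: zequiv_sym; have [eG _] := genera_hessian gg.
by apply/(Zp_equivP eQ eG); exact: genus_repr.
Qed.

Lemma genus_hessian_inj S e g g' : genera S e g -> genera S e g' ->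
  zequiv (genus_hessian g) (genus_hessian g') -> g = g'.
Proof.
move=> /genera_hessian[eg _] /genera_hessian[eg' _] h.
by apply: genus_eq; apply/(Zp_equivP eg eg').
Qed.

Lemma mass_set_periodic S e : (0 < S)%N -> exists k, periodic k Sz (mass_set e S).
Proof.
move=> S0; have [k kP] := mass_set_ord p n S0; exists (k + 3)%N.
split=> [H [/Pr_sym]//|X Y SY XY MX].
have [u uu dX] := kP _ _ MX; have [/Pr_sym SX _ _] := MX.
apply: mass_set_zequiv MX.
by apply: hensel_orbit SX SY uu dX _; exact: cong_sym.
Qed.

(** By Hensel's lemma a genus with these invariants is determined by its Hessian modulo p^(k + 3),
    which has finitely many values. *)
Lemma finite_genera S e : (0 < S)%N -> finite_set (@genera p n S e).
Proof.
move=> S0; have [k kP] := mass_set_ord p n S0.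
pose f g := residue_mx (k + 3) (genus_hessian g).
have [->|/set0P[g0 _]] := eqVneq (@genera p n S e) set0; first exact: finite_set0.
pose r (t : 'M['I_(p ^ (k + 3))]_n) := xget g0 [set g | genera S e g /\ f g = t].
apply: (@sub_finite_set _ _ (r @` setT)); last exact/finite_image/finite_finset.
move=> g gg; exists (f g) => //; rewrite /r; case: xgetP => [g' -> [gg' fg]|].
  apply: (genus_hessian_inj gg' gg); have [_ M1] := genera_hessian gg'.
  have [_ M2] := genera_hessian gg; have [u uu d1] := kP _ _ M1.
  apply: hensel_orbit uu d1 _.
  - by have [/Pr_sym] := M1.
  - by have [/Pr_sym] := M2.
  - by apply/residue_mxP.
by move=> /(_ g); case.
Qed.

Lemma volS_orbits S e (s : seq (local_genus p n)) : (0 < S)%N -> uniq s ->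
  (forall g, g \in s -> genera S e g) ->
  volS 1 [set H | exists2 g, g \in s & orb (genus_hessian g) H] =
    \sum_(g <- s) volS 1 (orb (genus_hessian g)).
Proof.
move=> S0; have [k kP] := mass_set_ord p n S0.
have per g : genera S e g -> periodic (k + 3) Sz (orb (genus_hessian g)).
  move=> /genera_hessian[_ M]; have [u uu d] := kP _ _ M.
  by apply: (orb_periodic _ uu d); have [/Pr_sym] := M.
elim: s => [|g s IHs] /=.
  move=> _ _; rewrite big_nil (_ : [set H | _] = set0) ?(pcontent0 (volS_pcontent R (k := 0) (oner_neq0 _))) //.
  by apply/seteqP; split=> // H [].
move=> /andP[gs su] hs; rewrite big_cons -IHs //; last first.
  by move=> g' g's; apply: hs; rewrite in_cons g's orbT.
have gg : genera S e g by apply: hs; rewrite mem_head.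
have pers : periodic (k + 3) Sz [set H | exists2 g, g \in s & orb (genus_hessian g) H].
  have hs' g' : g' \in s -> genera S e g' by move=> g's; apply: hs; rewrite in_cons g's orbT.
  split=> [H [g' g's oH]|X Y SY XY [g' g's oX]].
    exact: (per g' (hs' g' g's)).1 H oH.
  exists g'; first exact: g's.
  exact: (per g' (hs' g' g's)).2 X Y SY XY oX.
rewrite -(volS_pcontent R (oner_neq0 _) (per _ gg) pers).
  congr (volS 1); apply/seteqP; split=> H.
    move=> [g']; rewrite in_cons => /orP[/eqP ->|g's] oH; first by left.
    by right; exists g'.
  move=> [oH|[g' g's oH]]; first by exists g; rewrite ?mem_head.
  by exists g'; rewrite // in_cons g's orbT.
apply/seteqP; split=> // H [oH [g' g's oH']]; move: gs.
rewrite (_ : g = g') ?g's //; apply: (genus_hessian_inj gg).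
  by apply: hs; rewrite in_cons g's orbT.
exact: zequiv_trans oH (zequiv_sym oH').
Qed.

Lemma volS_mass_set S e : (0 < S)%N ->
  volS 1 (mass_set e S) = \sum_(g \in genera S e) volS 1 (orb (genus_hessian g)).
Proof.
move=> S0; have fin := finite_genera e S0; rewrite fsbig_finite //=.
rewrite -(@volS_orbits S e) //; [|exact: finmap.fset_uniq|]; last first.
  by move=> g; rewrite in_fset_set // inE.
congr (volS 1); apply/seteqP; split=> H.
  move=> /(mass_set_genus S0)[g gg gH]; exists g => //.
  by rewrite in_fset_set // inE.
move=> [g]; rewrite in_fset_set // inE => /genera_hessian[_ M] oH.
exact: mass_set_zequiv oH M.
Qed.

(** Gram and Hessian volumes differ by a constant, which cancels in quotients of densities. *)
Lemma volS_two k W : periodic k Sz W -> volS 2%:R W = volS 2%:R Sz * volS 1 W.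
Proof.
move=> pW; rewrite -[LHS]mulr1 -(volS_total1 R p n).
apply: (@volS_unique R p n 1 k W (volS 2%:R)) => //; first exact: oner_neq0.
  exact: (volS_pcontent R (two_neq0 p)).
by move=> X A SX pA; exact: (volS_translate R (two_neq0 p) SX pA).
Qed.

Lemma volM_units_gt0 : 0 < volM [set X | X \in unitmx].
Proof.
have pW : periodic 1 setT [set X : 'M[Zp]_n | X \in unitmx].
  by split=> // X Y _ XY /=; rewrite (unitmx_cong (ltn0Sn 0) XY).
have [N [N0 hN]] := pcontent_count R pW.
have [N' [_ hN']] := pcontent_count R (periodic_full 1 (setT : set 'M[Zp]_n)).
have c X : setT X -> volM (cls 1 setT X) = volM (cls 1 setT 0).
  move=> _; rewrite (cls_translate 1 (_ : subgroup setT)) //.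
  by rewrite (volM_translate R X (periodic_cls 1 setT 0)).
rewrite (hN _ _ (volM_pcontent R (k := 1)) c) mulr_gt0 //; last first.
  by rewrite ltr0n N0 //; exists 1%:M; rewrite /= unitmx1.
rewrite lt_neqAle volM_ge0 andbT eq_sym; apply/eqP => c0.
have := hN' _ _ (volM_pcontent R (k := 1)) c; rewrite volM_total c0 mul0r.
by move/eqP; rewrite oner_eq0.
Qed.

Lemma padic_ordE k (u : Zp) : u \is a GRing.unit ->
  padic_ord (padic_of_int (pz p ^+ k * u)) = k%:Z.
Proof.
move=> uu; rewrite /padic_ord; case: xgetP => [j _ [_ [v vu <-] e]|/(_ k%:Z)]; last first.
  by case; exists (padic_of_int u); [exists u|rewrite pQM pQ_pr].
case: j e => j; rewrite ?NegzE -?exprnP -?exprnN => e.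
  have kj : k = j by apply: (ord_uniq uu vu); apply: (@pQ_inj p); rewrite e pQM pQ_pr.
  by rewrite kj.
have : pz p ^+ (k + j.+1) * u = pz p ^+ 0 * v.
  apply: (@pQ_inj p); rewrite expr0 mul1r addnC exprD -mulrA pQM e pQ_pr mulVKf //.
  exact: pqX_neq0.
by move=> /(ord_uniq uu vu); rewrite addnS.
Qed.

Lemma padic_ord_assoc (x y : Zp) : x != 0 -> y != 0 ->
  padic_ord (padic_of_int x) = padic_ord (padic_of_int y) ->
  exists2 u, u \is a GRing.unit & x = y * u.
Proof.
move=> /zp_ordP[k [u uu ->]] /zp_ordP[l [v vu ->]].
rewrite !padic_ordE // => -[->]; exists (v^-1 * u); first by rewrite unitrM unitrV vu.
by rewrite -mulrA mulVKr.
Qed.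

(** [std_density] selects some genus, with Hessian H1; H0 shows that there is one to select. In a
    quotient of two densities the volume of GL_n(Z_p) and the Gram scaling cancel, which leaves a
    quotient of orbit volumes. *)
Lemma mass_sumE H0 u0 : Pr H0 -> u0 \is a GRing.unit -> \det H0 = 2%:R * u0 ->
  exists H1, [/\ Pr H1, exists2 u1, u1 \is a GRing.unit & \det H1 = 2%:R * u1,
    0 < volS 1 (orb H1) & forall e S, (0 < S)%N ->
      mass_sum R p n e S = volS 1 (mass_set e S) / volS 1 (orb H1)].
Proof.
move=> P0 uu0 d0.
have nz (u : Zp) : u \is a GRing.unit -> 2%:R * u != 0.
  move=> uu; rewrite mulf_eq0 negb_or two_neq0 /=.
  by apply: contraTneq uu => ->; rewrite unitr0.
have [Q0 eQ0] : exists Q : qform p n, (Q : Mn) = half *: toQ H0.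
  by apply: qform_of; [exact: Pr_sym|rewrite d0 nz].
have [k [c cu e2]] := zp_ordP (two_neq0 p).
have ord2 (u : Zp) : u \is a GRing.unit -> padic_ord (padic_of_int (2%:R * u)) = padic_ord (2%:R : Qp).
  move=> uu; rewrite -pQ_nat e2 -mulrA !padic_ordE //.
  by rewrite unitrM cu.
have [Q1 [PQ1 o1 std]] : exists Q : qform p n, [/\ primitive Q,
    padic_ord (detH Q) = padic_ord (2%:R : Qp) & std_density R p n = local_density R Q].
  rewrite /std_density; case: xgetP => [b -> [Q [? ? ?]]|]; first by exists Q.
  move=> /(_ (local_density R Q0)); case; exists Q0; split=> //.
    by apply/primitiveP; exists H0.
  by rewrite (detH_even eQ0) d0 ord2.
have [H1 PH1 eQ1] := (primitiveP Q1).1 PQ1.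
have S1 := Pr_sym PH1.
have d1 : \det H1 != 0.
  have [_ Qu] := andP (gramP Q1); rewrite unitmxE eQ1 detZ det_map_mx unitfE mulf_eq0 negb_or in Qu.
  by case/andP: Qu => _; rewrite pQ_eq0.
have [u1 uu1 du1] : exists2 u1, u1 \is a GRing.unit & \det H1 = 2%:R * u1.
  apply: padic_ord_assoc => //; first exact: two_neq0.
  by rewrite -(detH_even eQ1) o1 pQ_nat.
have du1' : \det H1 = pz p ^+ k * (c * u1) by rewrite du1 e2 mulrA.
have uc1 : c * u1 \is a GRing.unit by rewrite unitrM cu.
have p1 := orb_periodic S1 uc1 du1'.
have v1 : 0 < volS 1 (orb H1) := volS_gt0 R (oner_neq0 _) p1 (orb_refl H1).
exists H1; split=> //; first by exists u1.
move=> e S S0; rewrite volS_mass_set // /mass_sum.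
have fin := finite_genera e S0.
rewrite !fsbig_finite //= mulr_suml; apply: eq_big_seq => g; rewrite in_fset_set // inE => gg.
have [eg M] := genera_hessian gg.
have [l lP] := mass_set_ord p n S0; have [w wu dw] := lP _ _ M.
have Sg : Sz (genus_hessian g) by have [/Pr_sym] := M.
have pg := orb_periodic Sg wu dw.
rewrite std (local_densityE R S1 uc1 du1' eQ1) (local_densityE R Sg wu dw eg).
rewrite (volS_two p1) (volS_two pg).
have a0 := lt0r_neq0 volM_units_gt0; have b0 := volS_neq0 R n (two_neq0 p).
have c0 := lt0r_neq0 v1.
have c1 := lt0r_neq0 (volS_gt0 R (oner_neq0 _) pg (orb_refl _)).
move: a0 b0 c0 c1; move: (volM _) (volS 2%:R _) (volS 1 (orb H1)) (volS 1 (orb _)) => a b x y.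
by move=> a0 b0 x0 y0; field; rewrite ?a0 ?b0 ?x0 ?y0.
Qed.

End MassSum.

(** * Rational power series *)

Section RationalSeries.
Variable C : fieldType.
Implicit Types (f g : power_series C) (P Q : {poly C}).

Definition series_mul Q f : power_series C :=
  fun k => \sum_(i < k.+1) Q`_i * f (k - i)%N.

(** Below degree N a series may be truncated to a polynomial, so associativity is inherited from
    polynomial multiplication. *)
Lemma series_mulE Q f N k : (k < N)%N -> series_mul Q f k = (Q * \poly_(i < N) f i)`_k.
Proof.
move=> kN; rewrite coefM; apply: eq_bigr => i _; rewrite coef_poly.
by rewrite (leq_ltn_trans (leq_subr _ _) kN).
Qed.

Lemma series_mulA P Q f : series_mul (P * Q) f = series_mul P (series_mul Q f).
Proof.
apply/funext => k; rewrite (series_mulE _ _ (ltnSn k)) -mulrA coefM.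
apply: eq_bigr => i _; rewrite -series_mulE // ltnS leq_subr //.
Qed.

Lemma series_mulD Q f g : series_mul Q (fun k => f k + g k) =
  fun k => series_mul Q f k + series_mul Q g k.
Proof.
apply/funext => k; rewrite /series_mul -big_split; apply: eq_bigr => i _.
by rewrite mulrDr.
Qed.

Lemma series_mul_poly P Q : series_mul P (fun k => Q`_k) = fun k => (P * Q)`_k.
Proof. by apply/funext => k; rewrite coefM. Qed.

Lemma series_mulC_poly a f : series_mul a%:P f = fun k => a * f k.
Proof.
apply/funext => k; rewrite /series_mul big_ord_recl coefC eqxx subn0 big1 ?addr0 //.
by move=> i _; rewrite coefC /= mul0r.
Qed.

Lemma rationalP f : is_rational f <->
  exists P Q, Q != 0 /\ series_mul Q f = fun k => P`_k.
Proof.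
split=> -[P [Q [Q0 h]]]; exists P, Q; split=> //; first exact/funext.
by move=> k; rewrite -/(series_mul Q f k) h.
Qed.

Lemma rational_coef P : is_rational (fun k => P`_k).
Proof.
by apply/rationalP; exists P, 1; rewrite oner_neq0 series_mul_poly mul1r.
Qed.

Lemma rational_fin f N : (forall k, (N <= k)%N -> f k = 0) -> is_rational f.
Proof.
move=> fN; have -> : f = (fun k => (\poly_(i < N) f i)`_k); last exact: rational_coef.
by apply/funext => k; rewrite coef_poly; case: ltnP => // /fN.
Qed.

Lemma rational0 : is_rational (fun=> 0 : C).
Proof. exact: (@rational_fin _ 0). Qed.

Lemma rational_mul Q f : is_rational f -> is_rational (series_mul Q f).
Proof.
move=> /rationalP[P [Q' [Q0 e]]]; apply/rationalP; exists (Q * P), Q'.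
by rewrite Q0 -series_mulA mulrC series_mulA e series_mul_poly.
Qed.

Lemma rational_solve Q f : Q != 0 -> is_rational (series_mul Q f) -> is_rational f.
Proof.
move=> Q0 /rationalP[P [Q' [Q'0 e]]]; apply/rationalP; exists P, (Q' * Q).
by rewrite mulf_neq0 // series_mulA.
Qed.

Lemma rational_add f g : is_rational f -> is_rational g -> is_rational (fun k => f k + g k).
Proof.
move=> /rationalP[P [Q [Q0 e]]] /rationalP[P' [Q' [Q'0 e']]].
apply/rationalP; exists (Q' * P + Q * P'), (Q' * Q); split; first exact: mulf_neq0.
rewrite series_mulD series_mulA e [in X in _ = X](mulrC Q P') (mulrC Q' Q) series_mulA e'.
by rewrite !series_mul_poly; apply/funext => k; rewrite coefD [P' * Q]mulrC.
Qed.

Lemma rational_scale a f : is_rational f -> is_rational (fun k => a * f k).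
Proof. by move=> /(rational_mul a%:P); rewrite series_mulC_poly. Qed.

Lemma rational_sub f g : is_rational f -> is_rational g -> is_rational (fun k => f k - g k).
Proof.
move=> rf rg; have := rational_add rf (rational_scale (-1) rg).
by under eq_fun do rewrite mulN1r.
Qed.

Lemma rational_sum (I : finType) (F : I -> power_series C) :
  (forall i, is_rational (F i)) -> is_rational (fun k => \sum_i F i k).
Proof.
move=> rF; suff h (s : seq I) : is_rational (fun k => \sum_(i <- s) F i k).
  exact: h.
elim: s => [|i s IHs]; first by under eq_fun do rewrite big_nil; exact: rational0.
by under eq_fun do rewrite big_cons; exact: rational_add.
Qed.

Definition series_shift m f : power_series C := fun k => if (k < m)%N then 0 else f (k - m)%N.

Lemma series_mul_Xn m f : series_mul 'X^m f = series_shift m f.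
Proof.
apply/funext => k; rewrite /series_mul /series_shift; case: ltnP => km.
  rewrite big1 // => i _; rewrite coefXn.
  by rewrite (ltn_eqF (leq_ltn_trans (ltn_ord i : (i <= k)%N) km)) mul0r.
have km' : (m < k.+1)%N by rewrite ltnS.
rewrite (bigD1 (Ordinal km')) //= coefXn eqxx mul1r big1 ?addr0 // => i.
by rewrite -val_eqE /= coefXn => /negbTE ->; rewrite mul0r.
Qed.

Lemma rational_shift m f : is_rational f -> is_rational (series_shift m f).
Proof. by move=> /(rational_mul 'X^m); rewrite series_mul_Xn. Qed.

(** The hypothesis is about (1 - a X^m) f, and for m > 0 the first factor is nonzero because its
    constant term is 1. *)
Lemma rational_recurrence m a f : (0 < m)%N ->
  is_rational (fun k => f k - a * series_shift m f k) -> is_rational f.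
Proof.
move=> m0; have -> : (fun k => f k - a * series_shift m f k) = series_mul (1 - a *: 'X^m) f.
  apply/funext => k; rewrite -series_mul_Xn /series_mul mulr_sumr.
  rewrite (_ : f k = \sum_(i < k.+1) (1 : {poly C})`_i * f (k - i)%N); last first.
    rewrite big_ord_recl coefC eqxx mul1r subn0 big1 ?addr0 // => i _.
    by rewrite coefC mul0r.
  rewrite -sumrB; apply: eq_bigr => i _.
  by rewrite coefB coefZ mulrBl mulrA.
apply: rational_solve; apply/eqP => /(congr1 (fun q : {poly C} => q`_0)).
rewrite coefB coefZ coefXn coefC coef0 (ltn_eqF m0) mulr0 subr0 => /eqP.
by rewrite oner_eq0.
Qed.

(** Substitution of b X for X; this is how an Euler factor is twisted by a character value. *)
Lemma rational_rescale b f : b != 0 -> is_rational f -> is_rational (fun k => b ^+ k * f k).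
Proof.
move=> b0 /rationalP[P [Q [Q0 e]]]; pose r (P : {poly C}) := \poly_(i < size P) (b ^+ i * P`_i).
have rE P' k : (r P')`_k = b ^+ k * P'`_k by rewrite coef_poly; case: ltnP => // h; rewrite nth_default // mulr0.
apply/rationalP; exists (r P), (r Q); split.
  apply/eqP => r0; case/negP: Q0; apply/eqP/polyP => k.
  have := rE Q k; rewrite r0 !coef0 => /esym/eqP; rewrite mulf_eq0 expf_eq0 (negbTE b0) andbF.
  by move=> /eqP.
apply/funext => k; rewrite rE -(congr1 (fun h => h k) e) /series_mul mulr_sumr.
apply: eq_bigr => i _; rewrite rE mulrACA -exprD subnKC //; exact: ltn_ord i.
Qed.

End RationalSeries.

Lemma rational_map (C C' : fieldType) (h : {rmorphism C -> C'}) (f : power_series C) :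
  is_rational f -> is_rational (fun k => h (f k)).
Proof.
move=> [P [Q [Q0 e]]]; exists (map_poly h P), (map_poly h Q).
split=> [|k]; first by rewrite map_poly_eq0.
rewrite coef_map /= -e rmorph_sum; apply: eq_bigr => i _.
by rewrite coef_map rmorphM.
Qed.

(** * Rationality of the volumes *)

Lemma congr_undo (F : comUnitRingType) n (U : 'M[F]_n) : U \in unitmx ->
  exists2 V, V \in unitmx & forall M, V^T *m (U^T *m M *m U) *m V = M.
Proof.
move=> Uu; exists (invmx U); first by rewrite unitmx_inv.
by move=> M; rewrite !mulmxA -trmx_mul mulmxV // trmx1 mul1mx mulmxK.
Qed.

Section Schur.
Variables (F : comUnitRingType) (r s : nat).
Implicit Types (G : 'M[F]_(r + s)).

Definition schur G : 'M[F]_s :=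
  drsubmx G - (ursubmx G)^T *m invmx (ulsubmx G) *m ursubmx G.

Definition schur_trans G : 'M[F]_(r + s) :=
  block_mx 1%:M (invmx (ulsubmx G) *m ursubmx G) 0 1%:M.

Lemma schur_trans_unit G : schur_trans G \in unitmx.
Proof. by rewrite unitmxE det_ublock !det1 mulr1 unitr1. Qed.

Lemma sym_submx G : G^T = G ->
  [/\ (ulsubmx G)^T = ulsubmx G, dlsubmx G = (ursubmx G)^T & (drsubmx G)^T = drsubmx G].
Proof. by move=> SG; rewrite trmx_ulsub trmx_ursub trmx_drsub SG. Qed.

Lemma schurE G : G^T = G -> ulsubmx G \in unitmx ->
  G = (schur_trans G)^T *m block_mx (ulsubmx G) 0 0 (schur G) *m schur_trans G.
Proof.
move=> SG Au; have [eA eC eD] := sym_submx SG.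
rewrite /schur_trans tr_block_mx !trmx1 trmx0 trmx_mul trmx_inv eA.
rewrite !mulmx_block !mul1mx !mulmx1 !mul0mx !mulmx0 !addr0 !add0r.
rewrite -[LHS]submxK eC /schur; congr block_mx.
- by rewrite mulKVmx.
- by rewrite mulmxKV.
- by rewrite mulmxKV // mulmxA addrC subrK.
Qed.

Lemma schur_det G : G^T = G -> ulsubmx G \in unitmx ->
  \det G = \det (ulsubmx G) * \det (schur G).
Proof.
move=> SG Au; rewrite {1}(schurE SG Au) !det_mulmx det_tr.
have -> : \det (schur_trans G) = 1 by rewrite det_ublock !det1 mulr1.
by rewrite mul1r mulr1 det_ublock.
Qed.

Lemma schur_sym G : G^T = G -> (schur G)^T = schur G.
Proof.
move=> SG; have [eA eC eD] := sym_submx SG.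
by rewrite /schur tr_mxB !trmx_mul trmxK trmx_inv eA eD mulmxA.
Qed.

(** Makes the volume pushed forward along G |-> [schur G] translation invariant. *)
Lemma schur_add G (h : 'M[F]_s) : schur (block_mx 0 0 0 h + G) = h + schur G.
Proof.
rewrite /schur -[G]submxK add_block_mx !add0r !block_mxKul !block_mxKur !block_mxKdr.
by rewrite addrA.
Qed.

End Schur.

Section CosetVolumes.
Variables (R : realType) (p : prime_nat).
Local Notation Zp := (padic_int p).
Local Notation Qp := (padic p).
Local Notation Sz := (@Symz p _).
Local Notation vol := (@volS R p _ 1).

Definition congr_inv n (P : set 'M[Qp]_n) : Prop :=
  forall U M, U \in unitmx -> P M -> P (U^T *m M *m U).

Definition ord_det n k : set 'M[Zp]_n :=
  [set G | exists2 u : Zp, u \is a GRing.unit & \det G = pz p ^+ k * u].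

Definition coset_set n (P : set 'M[Qp]_n) (C : 'M[Zp]_n) k : set 'M[Zp]_n :=
  [set G | [/\ Sz G, cong 1 G C, ord_det k G & P (toQ G)]].

Lemma toQ_unit n (U : 'M[Zp]_n) : U \in unitmx -> toQ U \in unitmx.
Proof.
rewrite unitmxE => Uu; apply: trmx_nondeg; apply: contraTneq Uu => ->.
by rewrite unitr0.
Qed.

Lemma congr_inv_toQ n (P : set 'M[Qp]_n) (H H' : 'M[Zp]_n) : congr_inv P ->
  zequiv H H' -> P (toQ H) -> P (toQ H').
Proof.
move=> Pi [U Uu ->]; rewrite !toQM toQT; apply: Pi; exact: toQ_unit.
Qed.

Lemma ord_det_zequiv n k (H H' : 'M[Zp]_n) : zequiv H H' -> ord_det k H -> ord_det k H'.
Proof.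
move=> /zequiv_det[v vu e] [u uu dH]; exists (u * v ^+ 2); last by rewrite e dH -mulrA.
by rewrite unitrM uu unitrX.
Qed.

Lemma hensel_ord_det n k (H H' : 'M[Zp]_n) : Sz H -> Sz H' -> ord_det k H ->
  cong (k + 3) H' H -> zequiv H H'.
Proof. by move=> SH SH' [u uu dH]; apply: hensel_orbit SH SH' uu dH. Qed.

Lemma coset_set_periodic n (P : set 'M[Qp]_n) C k : congr_inv P ->
  periodic (k + 3) Sz (coset_set P C k).
Proof.
move=> Pi; split=> [G []//|X Y SY XY [SX XC oX PX]].
have e : zequiv X Y by apply: hensel_ord_det SX SY oX _; exact: cong_sym.
split=> //; last exact: congr_inv_toQ Pi e PX.
  have XY1 : cong 1 X Y by apply: cong_le XY; rewrite addn3.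
  exact: cong_trans (cong_sym XY1) XC.
exact: ord_det_zequiv e oX.
Qed.

Lemma coset_set_congr n (P : set 'M[Qp]_n) C k U : congr_inv P -> U \in unitmx ->
  vol (coset_set P C k) = vol (coset_set P (U^T *m C *m U) k).
Proof.
move=> Pi Uu.
rewrite -(volS_cpull R (oner_neq0 _) Uu (coset_set_periodic (U^T *m C *m U) k Pi)).
congr vol; have [V Vu VU] := congr_undo Uu.
apply/seteqP; split=> G.
  move=> [SG GC oG PG]; have e : zequiv G (U^T *m G *m U) by exists U.
  split=> //; split.
  - exact: zequiv_sym_mx e SG.
  - by apply: congM (cong_refl _ _); apply: congM GC; exact: cong_refl.
  - exact: ord_det_zequiv e oG.
  - exact: congr_inv_toQ Pi e PG.
move=> [SG [_ GC oG PG]]; have e : zequiv (U^T *m G *m U) G.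
  by exists V; rewrite ?VU.
split=> //.
- have c : cong 1 (V^T *m (U^T *m G *m U) *m V) (V^T *m (U^T *m C *m U) *m V).
    by apply: congM (cong_refl _ _); apply: congM GC; exact: cong_refl.
  by rewrite !VU in c.
- exact: ord_det_zequiv e oG.
- exact: congr_inv_toQ Pi e PG.
Qed.

Lemma unit_ord_det n (A : 'M[Zp]_n) : A \in unitmx -> ord_det 0 A.
Proof. by rewrite unitmxE => Au; exists (\det A); rewrite ?mul1r. Qed.

Section Pivot.
Variables (r s : nat) (P : set 'M[Qp]_(r + s)) (C : 'M[Zp]_(r + s)).
Hypothesis Pi : congr_inv P.
Hypothesis SC : Sz C.
Hypothesis Cu : ulsubmx C \in unitmx.

(** The condition that P imposes on the Schur complement when the pivot block is A. Being congruence
    invariant again, it keeps the induction on the rank within one family of statements. *)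
Definition slice (A : 'M[Zp]_r) : set 'M[Qp]_s := [set M | P (block_mx (toQ A) 0 0 M)].

Lemma slice_inv A : congr_inv (slice A).
Proof.
move=> U M Uu PM; rewrite /slice /=.
have := @Pi (block_mx 1%:M 0 0 U) _ _ PM.
rewrite tr_block_mx !trmx0 trmx1 !mulmx_block !mul1mx !mulmx1 !mul0mx !mulmx0 !addr0 !add0r.
by rewrite mul0mx; apply; rewrite unitmxE det_ublock det1 mul1r -unitmxE.
Qed.

Lemma invmx_cong k (A B : 'M[Zp]_r) : A \in unitmx -> B \in unitmx -> cong k A B ->
  cong k (invmx A) (invmx B).
Proof.
move=> Au Bu AB; have e : invmx A = invmx A *m (B *m invmx B) by rewrite mulmxV // mulmx1.
rewrite e mulmxA -[X in cong _ _ X]mul1mx -(mulVmx Au).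
apply: congM (cong_refl _ _); apply: congM (cong_refl _ _) _; exact: cong_sym.
Qed.

Lemma schur_cong k (G G' : 'M[Zp]_(r + s)) : ulsubmx G \in unitmx -> ulsubmx G' \in unitmx ->
  cong k G G' -> cong k (schur G) (schur G').
Proof.
move=> Gu Gu' GG'.
have sub : [/\ cong k (ulsubmx G) (ulsubmx G'), cong k (ursubmx G) (ursubmx G')
    & cong k (drsubmx G) (drsubmx G')] by split=> i j; rewrite !mxE; exact: GG'.
case: sub => cA cB cD; apply: congD cD _; apply/congN/congM/cB; apply: congM (congT cB) _.
exact: invmx_cong.
Qed.

(** A unimodular block has determinant of order 0, so by Hensel's lemma its class modulo p^3 fixes
    it up to equivalence. Once this class is that of A, all conditions on G except those on its
    upper blocks depend on the Schur complement alone. *)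
Lemma slice_set (A : 'M[Zp]_r) k : Sz A -> cong 1 A (ulsubmx C) ->
  coset_set P C k `&` [set G | cong 3 (ulsubmx G) A] =
  [set G | [/\ Sz G, cong 3 (ulsubmx G) A, cong 1 (ursubmx G) (ursubmx C)
             & coset_set (slice A) (schur C) k (schur G)]].
Proof.
move=> SA cA0; have Au : A \in unitmx by rewrite (unitmx_cong (ltn0Sn 0) cA0).
have facts G : Sz G -> cong 3 (ulsubmx G) A -> cong 1 (ursubmx G) (ursubmx C) ->
  [/\ ulsubmx G \in unitmx, cong 1 G C <-> cong 1 (schur G) (schur C),
      ord_det k G <-> ord_det k (schur G) & P (toQ G) <-> slice A (toQ (schur G))].
  move=> SG GA GB; have Gu : ulsubmx G \in unitmx by rewrite (unitmx_cong _ GA).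
  have GA1 : cong 1 (ulsubmx G) (ulsubmx C).
    by apply: cong_trans cA0; exact: cong_le GA.
  have [eA eC eD] := sym_submx SG; have [eAC eCC eDC] := sym_submx SC.
  have dG := schur_det SG Gu; rewrite unitmxE in Gu.
  split; first by rewrite unitmxE.
  - split=> [GC|S1]; first by apply: schur_cong; rewrite ?unitmxE.
    have cD : cong 1 (drsubmx G) (drsubmx C).
      have e (X : 'M[Zp]_(r + s)) : drsubmx X = schur X +
          (ursubmx X)^T *m invmx (ulsubmx X) *m ursubmx X by rewrite subrK.
      rewrite (e G) (e C); apply: congD => //; do 2!apply: congM => //; first exact: congT.
      by apply: invmx_cong; rewrite ?unitmxE.
    rewrite -[G]submxK -[C]submxK eC eCC => i j; rewrite !mxE.
    case: splitP => i' _; rewrite !mxE; case: splitP => j' _; rewrite !mxE.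
    + by have := GA1 i' j'; rewrite !mxE.
    + by have := GB i' j'; rewrite !mxE.
    + by have := GB j' i'; rewrite !mxE.
    + by have := cD i' j'; rewrite !mxE.
  - rewrite /ord_det /= dG; split=> -[u uu e].
      exists ((\det (ulsubmx G))^-1 * u); first by rewrite unitrM unitrV Gu.
      by rewrite mulrCA -e mulKr.
    by exists (\det (ulsubmx G) * u); rewrite ?unitrM ?Gu // e mulrCA.
  - have [V Vu eV] := congr_undo (toQ_unit (schur_trans_unit G)).
    have [U Uu eU] : zequiv (ulsubmx G) A.
      apply: (hensel_ord_det (k := 0)) => //; first by apply: unit_ord_det; rewrite unitmxE.
    pose T := block_mx (toQ U) 0 0 (1%:M : 'M[Qp]_s).
    have Tu : T \in unitmx by rewrite unitmxE det_ublock det1 mulr1 -unitmxE toQ_unit.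
    have eT : T^T *m block_mx (toQ (ulsubmx G)) 0 0 (toQ (schur G)) *m T =
        block_mx (toQ A) 0 0 (toQ (schur G)).
      rewrite /T tr_block_mx !trmx0 trmx1 !mulmx_block !mul1mx !mulmx1 !mul0mx !mulmx0.
      by rewrite !addr0 ?mul0mx !add0r eU !toQM toQT.
    have eB : block_mx (toQ (ulsubmx G)) 0 0 (toQ (schur G)) =
        toQ (block_mx (ulsubmx G) 0 0 (schur G)) by rewrite map_block_mx !toQ0.
    have eG : toQ G = (toQ (schur_trans G))^T *m
        block_mx (toQ (ulsubmx G)) 0 0 (toQ (schur G)) *m toQ (schur_trans G).
      rewrite eB -toQT -!toQM -schurE // unitmxE //.
    have [V' V'u eV'] := congr_undo Tu.
    split=> [PG|PS].
      rewrite /slice /= -eT; apply: Pi Tu _.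
      by rewrite -(eV (block_mx _ _ _ _)) -eG; apply: Pi.
    rewrite eG; apply: Pi; first exact/toQ_unit/schur_trans_unit.
    by rewrite -(eV' (block_mx _ _ _ _)) eT; apply: Pi.
apply/seteqP; split=> G.
  move=> [[SG GC oG PG] GA].
  have GB : cong 1 (ursubmx G) (ursubmx C) by move=> i j; rewrite !mxE; exact: GC.
  have [Gu f1 f2 f3] := facts G SG GA GB.
  by split; [exact: SG|exact: GA|exact: GB|split; [exact: schur_sym|exact/f1|exact/f2|exact/f3]].
move=> [SG GA GB [SS S1 S2 S3]]; have [Gu f1 f2 f3] := facts G SG GA GB.
by split; [split; [exact: SG|exact/f1|exact/f2|exact/f3]|exact: GA].
Qed.

End Pivot.
End CosetVolumes.

Section VolumeRecursion.
Variables (R : realType) (p : prime_nat).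
Local Notation Zp := (padic_int p).
Local Notation Qp := (padic p).
Local Notation Sz := (@Symz p _).
Local Notation vol := (@volS R p _ 1).

Lemma vol0 n : vol (set0 : set 'M[Zp]_n) = 0.
Proof. exact: (pcontent0 (volS_pcontent R (k := 0) (oner_neq0 _))). Qed.

(** The volume of the G whose Schur complement lies in W is a translation invariant content of W,
    hence proportional to the volume of W. The factor c is the same for all k, as rationality in k
    demands. *)
Lemma slice_vol r s (P : set 'M[Qp]_(r + s)) (C : 'M[Zp]_(r + s)) (A : 'M[Zp]_r) :
  congr_inv P -> Sz C -> ulsubmx C \in unitmx -> Sz A -> cong 1 A (ulsubmx C) ->
  exists c, forall k, vol (coset_set P C k `&` [set G | cong 3 (ulsubmx G) A]) =
    c * vol (coset_set (slice P A) (schur C) k).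
Proof.
move=> Pi SC Cu SA cA.
pose T (W : set 'M[Zp]_s) := [set G : 'M[Zp]_(r + s) |
  [/\ Sz G, cong 3 (ulsubmx G) A, cong 1 (ursubmx G) (ursubmx C) & W (schur G)]].
have Au : A \in unitmx by rewrite (unitmx_cong (ltn0Sn 0) cA).
have Gu (G : 'M[Zp]_(r + s)) : cong 3 (ulsubmx G) A -> ulsubmx G \in unitmx.
  by move=> GA; rewrite (unitmx_cong _ GA).
have Tper j W : (3 <= j)%N -> periodic j Sz W -> periodic j Sz (T W).
  move=> j3 pW; split=> [G []//|X Y SY XY [SX XA XB WX]].
  have YA : cong 3 (ulsubmx Y) A.
    apply: cong_trans XA => a b; rewrite !mxE.
    by apply/esym/(residue_cong_le j3); exact: XY.
  split; [exact: SY|exact: YA| |].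
    apply: cong_trans XB => a b; rewrite !mxE.
    by apply/esym/(residue_cong_le (_ : 1 <= j)%N); [exact: leq_trans j3|exact: XY].
  exact: pW.2 _ _ (schur_sym SY) (schur_cong (Gu _ XA) (Gu _ YA) XY) WX.
exists (vol (T Sz)) => k; rewrite (slice_set Pi SC Cu k SA cA) -/(T _).
have pS := coset_set_periodic (schur C) k (@slice_inv _ _ _ _ Pi A).
rewrite -[LHS]mulr1 -(volS_total1 R p s).
apply: (@volS_unique R p s 1 (k + 3) _ (fun W => vol (T W))) => //; first exact: oner_neq0.
- move=> B B' pB pB' BB'.
  rewrite (_ : T (B `|` B') = T B `|` T B'); last first.
    apply/seteqP; split=> G; first by move=> [SG GA GB [WG|WG]]; [left|right].
    by move=> [] [SG GA GB WG]; split=> //; [left|right].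
  apply: (volS_pcontent R (oner_neq0 _)).
  - by apply: Tper pB; rewrite addn3.
  - by apply: Tper pB'; rewrite addn3.
  apply/seteqP; split=> // G [[_ _ _ WG] [_ _ _ WG']].
  by have : (B `&` B') (schur G) by []; rewrite BB'.
- move=> h B Sh pB; pose H : 'M[Zp]_(r + s) := block_mx 0 0 0 h.
  have SH : Sz H by rewrite /Symz /= tr_block_mx !trmx0 Sh.
  have ulH (G : 'M[Zp]_(r + s)) : ulsubmx (H + G) = ulsubmx G.
    by rewrite -[G]submxK add_block_mx !block_mxKul add0r.
  have urH (G : 'M[Zp]_(r + s)) : ursubmx (H + G) = ursubmx G.
    by rewrite -[G]submxK add_block_mx !block_mxKur add0r.
  have pTB : periodic (k + 3) Sz (T B) by apply: Tper pB; rewrite addn3.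
  rewrite -(volS_translate R (oner_neq0 _) SH pTB).
  have [_ SD SN] := subgroup_Symz p (r + s).
  congr vol; apply/seteqP; split=> G.
    move=> [SG GA GB [X BX eX]]; exists (- H + G); last by rewrite addrA subrr add0r.
    have eG : G = H + (- H + G) by rewrite addrA subrr add0r.
    split.
    - by apply: SD => //; exact: SN.
    - by rewrite eG ulH in GA.
    - by rewrite eG urH in GB.
    - rewrite eG schur_add in eX; rewrite (_ : schur _ = X) //.
      exact: (addrI h (esym eX)).
  move=> [X [SX XA XB BX] <-]; split.
  - exact: SD.
  - by rewrite ulH.
  - by rewrite urH.
  - by rewrite schur_add; exists (schur X).
Qed.

Lemma pivot_rational r s (P : set 'M[Qp]_(r + s)) (C : 'M[Zp]_(r + s)) :
  congr_inv P -> Sz C -> ulsubmx C \in unitmx ->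
  (forall A : 'M[Zp]_r, is_rational (fun k => vol (coset_set (slice P A) (schur C) k))) ->
  is_rational (fun k => vol (coset_set P C k)).
Proof.
move=> Pi SC Cu ratS.
have part k : vol (coset_set P C k) = \sum_(t : 'M['I_(p ^ 3)]_r)
    vol (coset_set P C k `&` [set G | residue_mx 3 (ulsubmx G) = t]).
  apply: (pcontent_partition (volS_pcontent R (oner_neq0 _)) (coset_set_periodic C k Pi)).
  move=> X Y _ _ XY; apply/residue_mxP => i j; rewrite !mxE.
  by apply: (residue_cong_le (_ : 3 <= k + 3)%N (XY _ _)); rewrite addn3.
under eq_fun do rewrite part.
apply: rational_sum => t.
have [[A [SA cA At]]|nA] := pselect (exists A : 'M[Zp]_r,
    [/\ Sz A, cong 1 A (ulsubmx C) & residue_mx 3 A = t]).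
  have [c cP] := slice_vol Pi SC Cu SA cA.
  have e : (fun k => vol (coset_set P C k `&` [set G | residue_mx 3 (ulsubmx G) = t])) =
      (fun k => c * vol (coset_set (slice P A) (schur C) k)).
    apply/funext => k; rewrite -cP; congr (vol (_ `&` _)); apply/seteqP.
    by split=> G /=; rewrite -At => /residue_mxP.
  by rewrite e; apply: rational_scale.
have e : (fun k => vol (coset_set P C k `&` [set G | residue_mx 3 (ulsubmx G) = t])) = (fun=> 0).
  apply/funext => k; rewrite [X in vol X](_ : _ = set0) ?vol0 //.
  apply/seteqP; split=> // G [[SG GC _ _] Gt]; apply: nA; exists (ulsubmx G); split=> //.
    by have [] := sym_submx SG.
  by move=> i j; rewrite !mxE; exact: GC.
by rewrite e; exact: rational0.
Qed.

Definition all_set n (P : set 'M[Qp]_n) k : set 'M[Zp]_n :=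
  [set G | [/\ Sz G, ord_det k G & P (toQ G)]].

Lemma all_set_periodic n (P : set 'M[Qp]_n) k : congr_inv P ->
  periodic (k + 3) Sz (all_set P k).
Proof.
move=> Pi; split=> [G []//|X Y SY XY [SX oX PX]].
have e : zequiv X Y by apply: hensel_ord_det SX SY oX _; exact: cong_sym.
by split=> //; [exact: ord_det_zequiv e oX|exact: congr_inv_toQ Pi e PX].
Qed.

Lemma restrict_partition n (P : set 'M[Qp]_n) (E : set 'M[Zp]_n) k : congr_inv P ->
  periodic 1 Sz E ->
  vol (all_set P k `&` E) = \sum_(t : 'M['I_(p ^ 1)]_n)
    vol (all_set P k `&` E `&` [set G | residue_mx 1 G = t]).
Proof.
move=> Pi pE.
apply: (pcontent_partition (volS_pcontent R (oner_neq0 _)) (k := k + 3)).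
  apply: periodicI; first exact: all_set_periodic.
  by apply: periodic_le pE; rewrite addn3.
by move=> X Y _ _ XY; apply/residue_mxP; apply: cong_le XY; rewrite addn3.
Qed.

Lemma restrict_class n (P : set 'M[Qp]_n) (E : set 'M[Zp]_n) (t : 'M['I_(p ^ 1)]_n) :
  periodic 1 Sz E ->
  (forall k, all_set P k `&` E `&` [set G | residue_mx 1 G = t] = set0) \/
  exists C, [/\ E C, residue_mx 1 C = t & forall k,
    all_set P k `&` E `&` [set G | residue_mx 1 G = t] = coset_set P C k].
Proof.
move=> pE; have [[C [EC Ct]]|nC] := pselect (exists C, E C /\ residue_mx 1 C = t).
  right; exists C; split=> // k; apply/seteqP; split=> G.
    by move=> [[[SG oG PG] EG] /= Gt]; split=> //; apply/residue_mxP; rewrite Ct.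
  move=> [SG GC oG PG]; split; last by rewrite /= -Ct; apply/residue_mxP.
  by split=> //; apply: pE.2 (cong_sym GC) EC.
left=> k; apply/seteqP; split=> // G [[_ EG] Gt]; apply: nC; by exists G.
Qed.

Lemma scale_vol n (s : Zp) : s != 0 -> exists c, forall k (W : set 'M[Zp]_n),
  periodic k Sz W -> vol [set s *: X | X in W] = c * vol W.
Proof.
move=> s0; pose T (W : set 'M[Zp]_n) := [set s *: X | X in W].
have pinj : injective (fun X : 'M[Zp]_n => s *: X).
  move=> X Y /matrixP e; apply/matrixP => i j; have := e i j.
  by rewrite [LHS]mxE [RHS]mxE => /(mulfI s0).
have [S0 SD SN] := subgroup_Symz p n.
have SpE (X : 'M[Zp]_n) : Symz (s *: X) <-> Symz X.
  rewrite /Symz /= tr_mxZ; split=> [/pinj //|-> //].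
have [m [u uu es]] := zp_ordP s0.
have Tper k W : periodic k Sz W -> periodic (m + k) Sz (T W).
  move=> [WS Wp]; split=> [_ [X WX <-]|X' Y SY XY [X WX eX]]; first by apply/SpE/WS.
  rewrite -eX in XY; have /congP[Z eZ] := cong_sym XY.
  have eY : Y = s *: (X + pz p ^+ k *: (u^-1 *: Z)).
    rewrite eZ scalerDr !scalerA; congr (_ + _ *: _).
    by rewrite es exprD -!mulrA; congr (_ * _); rewrite mulrCA divrr // mulr1.
  exists (X + pz p ^+ k *: (u^-1 *: Z)) => //; apply: Wp WX.
    by apply/SpE; rewrite -eY.
  by apply: cong_sym; apply/congP; exists (u^-1 *: Z).
exists (vol (T Sz)) => k W pW.
rewrite -[LHS]mulr1 -(volS_total1 R p n).
apply: (@volS_unique R p n 1 k _ (fun W => vol (T W))) => //; first exact: oner_neq0.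
- move=> B B' pB pB' BB'.
  rewrite (_ : T (B `|` B') = T B `|` T B'); last exact: image_setU.
  apply: (volS_pcontent R (oner_neq0 _) (Tper _ _ pB) (Tper _ _ pB')).
  apply/seteqP; split=> // _ [[X BX <-] [Y BY /pinj eY]].
  have BBX : (B `&` B') X by split; rewrite // -eY.
  by rewrite BB' in BBX.
- move=> h B Sh pB; have SH : Sz (s *: h) by apply/SpE.
  rewrite -(volS_translate R (oner_neq0 _) SH (Tper _ _ pB)).
  congr vol; apply/seteqP; split=> G.
    move=> [_ [X BX <-] <-]; exists (s *: X); first by exists X.
    by rewrite scalerDr.
  move=> [_ [X BX <-] <-]; exists (h + X); first by exists X.
  by rewrite scalerDr.
Qed.

Definition scale_set n (P : set 'M[Qp]_n) : set 'M[Qp]_n := [set M | P ((p : nat)%:R *: M)].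

Lemma scale_set_inv n (P : set 'M[Qp]_n) : congr_inv P -> congr_inv (scale_set P).
Proof. by move=> Pi U M Uu PM; rewrite /scale_set /= scalemxAl scalemxAr; apply: Pi. Qed.

Lemma scale_setK n (P : set 'M[Qp]_n) : congr_inv P -> scale_set (scale_set P) = P.
Proof.
move=> Pi.
have e M : (p : nat)%:R *: ((p : nat)%:R *: M) =
    ((p : nat)%:R%:M : 'M[Qp]_n)^T *m M *m ((p : nat)%:R%:M).
  by rewrite tr_scalar_mx mul_scalar_mx mul_mx_scalar.
have Uu : ((p : nat)%:R%:M : 'M[Qp]_n) \in unitmx.
  by rewrite unitmxE det_scalar unitrX // unitfE pq_neq0.
have [V Vu eV] := congr_undo Uu.
have scE M : scale_set (scale_set P) M = P ((p : nat)%:R *: ((p : nat)%:R *: M)) by [].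
apply/seteqP; split=> M; rewrite scE e => PM; last exact: Pi Uu PM.
by have := Pi _ _ Vu PM; rewrite eV.
Qed.

Lemma scale_all_set n (P : set 'M[Qp]_n) (E : set 'M[Zp]_n) k : E `<=` Sz ->
  all_set P k `&` [set pz p *: X | X in E] =
  if (k < n)%N then set0 else [set pz p *: X | X in all_set (scale_set P) (k - n) `&` E].
Proof.
move=> ES.
have oE l X : ord_det (n + l) (pz p *: X) <-> ord_det l (X : 'M[Zp]_n).
  split=> -[u uu e]; exists u => //.
    by apply: (mulfI (prX_neq0 p n)); rewrite mulrA -exprD -e detZ.
  by rewrite detZ e mulrA exprD.
have PE X : P (toQ (pz p *: X)) <-> scale_set P (toQ (X : 'M[Zp]_n)).
  by rewrite /scale_set /= toQZ pQ_nat.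
case: ltnP => kn.
  apply/seteqP; split=> // G [[SG [u uu e] PG] [X EX eX]].
  have X0 : \det X != 0.
    apply/eqP => X0; move: e; rewrite -eX detZ X0 mulr0 => /esym/eqP.
    rewrite mulf_eq0 (negbTE (prX_neq0 p k)) /= => /eqP u0.
    by rewrite u0 unitr0 in uu.
  have [l [v vu eV]] := zp_ordP X0.
  have := @ord_uniq p k (n + l) u v uu vu; rewrite -e -eX detZ eV mulrA exprD.
  by move=> /(_ erefl) ekn; move: kn; rewrite ekn ltnNge leq_addr.
apply/seteqP; split=> G.
  move=> [[SG oG PG] [X EX eX]]; exists X => //; split=> //; split.
  - exact: ES.
  - by apply/oE; rewrite subnKC // eX.
  - by apply/PE; rewrite eX.
move=> [X [[SX oX PX] EX] <-]; split; last by exists X.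
split.
- by rewrite /Symz /= tr_mxZ SX.
- by rewrite -(subnKC kn); apply/oE.
- exact/PE.
Qed.

End VolumeRecursion.

Lemma det_mx2 (F : comNzRingType) (A : 'M[F]_2) :
  \det A = A ord0 ord0 * A ord_max ord_max - A ord0 ord_max * A ord_max ord0.
Proof.
rewrite (expand_det_row _ ord0) big_ord_recl big_ord1 /cofactor !det_mx11 !mxE.
have -> : lift ord0 (ord0 : 'I_1) = ord_max by apply: val_inj.
have -> : lift (ord_max : 'I_2) (ord0 : 'I_1) = ord0 by apply: val_inj.
by rewrite /= expr0 expr1 mul1r mulN1r mulrN.
Qed.

Lemma perm_mx_congr (F : comNzRingType) n (C : 'M[F]_n) (s : 'S_n) i j :
  (((perm_mx s)^T)^T *m C *m (perm_mx s)^T) i j = C (s i) (s j).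
Proof. by rewrite trmxK tr_perm_mx -row_permE -col_permE !mxE. Qed.

Lemma diag_pivot (F : comUnitRingType) m (C : 'M[F]_m.+1) i : C i i \is a GRing.unit ->
  exists2 U, U \in unitmx & ulsubmx (U^T *m C *m U : 'M[F]_(1 + m)) \in unitmx.
Proof.
move=> Cu; pose s := tperm (ord0 : 'I_m.+1) i.
exists (perm_mx s)^T; first by rewrite unitmx_tr unitmx_perm.
rewrite unitmxE det_mx11 2!mxE perm_mx_congr.
have -> : lshift m (ord0 : 'I_1) = ord0 :> 'I_m.+1 by apply: val_inj.
by rewrite /s tpermL.
Qed.

Section Rationality.
Variables (R : realType) (p : prime_nat).
Local Notation Zp := (padic_int p).
Local Notation Qp := (padic p).
Local Notation Sz := (@Symz p _).
Local Notation vol := (@volS R p _ 1).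

(** When no diagonal entry is a unit, as for even forms at p = 2, the minor of rows i and j is minus
    a unit square modulo p. *)
Lemma offdiag_pivot m (C : 'M[Zp]_m.+2) i j : C^T = C ->
  (forall l, C l l \isn't a GRing.unit) -> C i j \is a GRing.unit ->
  exists2 U, U \in unitmx & ulsubmx (U^T *m C *m U : 'M[Zp]_(2 + m)) \in unitmx.
Proof.
move=> SC Cd Cu; have ij : j != i by apply: contraTneq Cu => ->; apply: Cd.
pose o0 : 'I_m.+2 := ord0; pose o1 : 'I_m.+2 := lift ord0 ord0.
(* The preimage of j under the transposition that brings i to the front, so that s sends 0 to i and
   1 to j. *)
pose j' := tperm o0 i j.
have j'0 : j' != o0 by rewrite /j' -[X in _ != X](tpermR o0 i) (inj_eq perm_inj).
pose s := (tperm o1 j' * tperm o0 i)%g.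
have s0 : s o0 = i by rewrite permM (tpermD (isT : o1 != o0) j'0) tpermL.
have s1 : s o1 = j by rewrite permM tpermL /j' tpermK.
exists (perm_mx s)^T; first by rewrite unitmx_tr unitmx_perm.
rewrite unitmxE det_mx2.
have e0 : lshift m (ord0 : 'I_2) = o0 by apply: val_inj.
have e1 : lshift m (ord_max : 'I_2) = o1 by apply: val_inj.
have E a b : ulsubmx ((perm_mx s)^T^T *m C *m (perm_mx s)^T : 'M[Zp]_(2 + m)) a b =
    C (s (lshift m a)) (s (lshift m b)) by rewrite 2!mxE perm_mx_congr.
rewrite !E e0 e1 s0 s1.
have -> : C j i = C i j by rewrite -[in LHS]SC mxE.
have /residue_unitP/contrapT/residue_eq0P[z ->] := Cd i.
rewrite expr1 -mulrA addrC unit_add_pr -mulNr.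
by rewrite unitrM unitrN Cu.
Qed.

Lemma nonzero_class n (C : 'M[Zp]_n) : ~ cong 1 C 0 -> exists i j, C i j \is a GRing.unit.
Proof.
move=> nC; apply: contrapT => h; apply: nC => i j; rewrite mxE residue0.
have := @residue_unitP p (C i j); case: (boolP (_ \is a _)) => [Cu|_ /elimF].
  by case: h; exists i, j.
by move=> /(_ erefl)/contrapT.
Qed.

Lemma zero_class_rational n (P : set 'M[Qp]_n.+1) : congr_inv P ->
  (forall (P' : set 'M[Qp]_n.+1) C, congr_inv P' -> Sz C -> ~ cong 1 C 0 ->
     is_rational (fun k => vol (coset_set P' C k))) ->
  is_rational (fun k => vol (coset_set P 0 k)).
Proof.
move=> Pi nz; have [S0 _ _] := subgroup_Symz p n.+1.
pose f (P : set 'M[Qp]_n.+1) k := vol (coset_set P 0 k).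
have [c cP] := @scale_vol R p n.+1 _ (pr_neq0 p).
(* The series g collects the classes that are nonzero modulo p, which are rational by hypothesis. *)
have all_rat P' : congr_inv P' -> exists2 g, is_rational g &
    forall k, vol (all_set P' k) = f P' k + g k.
  move=> P'i; pose t0 : 'M['I_(p ^ 1)]_n.+1 := residue_mx 1 0.
  pose h t k := if t == t0 then 0 else vol (all_set P' k `&` Sz `&` [set G | residue_mx 1 G = t]).
  exists (fun k => \sum_t h t k).
    apply: rational_sum => t; rewrite /h; have [_|tt0] := eqVneq t t0; first exact: rational0.
    have [e|[C [SC Ct e]]] := restrict_class P' t (periodic_full 1 Sz).
      by under eq_fun do rewrite e vol0; exact: rational0.
    under eq_fun do rewrite e; apply: nz => // C0.
    by move: tt0; rewrite -Ct; move/residue_mxP: C0 => ->; rewrite eqxx.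
  move=> k; rewrite (_ : all_set P' k = all_set P' k `&` Sz); last first.
    by rewrite setIidl // => G [].
  rewrite (restrict_partition R k P'i (periodic_full 1 Sz)) (bigD1 t0) //=.
  congr (_ + _).
    congr vol; apply/seteqP; split=> G.
      by move=> [[[SG oG PG] _] /residue_mxP Gt].
    by move=> [SG Gt oG PG]; split; [|apply/residue_mxP].
  by rewrite [RHS](bigD1 t0) //= /h eqxx add0r; apply: eq_bigr => t /negbTE ->.
have rec P' : congr_inv P' -> exists2 g, is_rational g &
    forall k, f P' k = c * series_shift n.+1 (f (scale_set P')) k + g k.
  move=> P'i; have [g gr gE] := all_rat _ (scale_set_inv P'i).
  exists (fun k => c * series_shift n.+1 g k).
    by apply: rational_scale; apply: rational_shift.
  move=> k; rewrite /f.
  have -> : coset_set P' 0 k = all_set P' k `&` [set pz p *: X | X in Sz].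
    apply/seteqP; split=> G.
      move=> [SG G0 oG PG]; split=> //; have /congP[Z eZ] := G0.
      rewrite add0r expr1 in eZ; exists Z => //.
      have [_ _ KZ _ _] := lattice_Symz p n.+1.
      by apply/(KZ 1%N); rewrite expr1 -eZ.
    move=> [[SG oG PG] [X SX eX]]; split=> //.
    by apply/congP; exists X; rewrite add0r expr1.
  rewrite scale_all_set // /series_shift; case: ltnP => kn; first by rewrite vol0 !mulr0 addr0.
  rewrite (_ : all_set _ _ `&` _ = all_set (scale_set P') (k - n.+1)); last first.
    by rewrite setIidl // => G [].
  by rewrite (cP _ _ (all_set_periodic _ (scale_set_inv P'i))) gE mulrDr.
have [g gr gE] := rec _ Pi; have [g' gr' gE'] := rec _ (scale_set_inv Pi).
rewrite scale_setK // in gE'.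
apply: (@rational_recurrence _ (n.+1 + n.+1) (c ^+ 2)) => //.
have e : (fun k => f P k - c ^+ 2 * series_shift (n.+1 + n.+1) (f P) k) =
    (fun k => c * series_shift n.+1 g' k + g k).
  apply/funext => k; rewrite gE.
  have -> : f (scale_set P) = (fun k => c * series_shift n.+1 (f P) k + g' k).
    by apply/funext => l; rewrite gE'.
  rewrite /series_shift; case: ltnP => kn.
    by rewrite ltn_addr // !mulr0 subr0.
  have -> : (k < n.+1 + n.+1)%N = (k - n.+1 < n.+1)%N by rewrite ltn_subLR.
  rewrite subnDA; case: ltnP => _; first by rewrite !mulr0 subr0 add0r.
  by rewrite mulrDr mulrA -expr2 [X in X - _]addrC addrA; ring.
rewrite -/(f P) e; apply: rational_add => //.
by apply: rational_scale; apply: rational_shift.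
Qed.

Theorem coset_rational n (P : set 'M[Qp]_n) C : congr_inv P -> Sz C ->
  is_rational (fun k => vol (coset_set P C k)).
Proof.
have [N] := ubnP n; elim: N n P C => // N IHN n P C; rewrite ltnS => nN Pi SC.
have pivot r s (e : n = (r + s)%N) : (0 < r)%N -> forall (P' : set 'M[Qp]_(r + s)) C',
    congr_inv P' -> Sz C' -> ulsubmx C' \in unitmx ->
    is_rational (fun k => vol (coset_set P' C' k)).
  move=> r0 P' C' P'i SC' C'u; apply: pivot_rational => // A.
  apply: IHN; last exact: schur_sym.
    by apply: leq_trans nN; rewrite e -[X in (X < _)%N]add0n ltn_add2r.
  exact: slice_inv.
case: n P C nN Pi SC pivot => [|n] P C nN Pi SC pivot.
  (* In rank 0 the determinant is 1, so only k = 0 contributes. *)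
  apply: (@rational_fin _ _ 1) => k k0; rewrite (_ : coset_set P C k = set0) ?vol0 //.
  apply/seteqP; split=> // G [_ _ [u uu e] _].
  have := @ord_uniq p 0 k 1 u (unitr1 _) uu; rewrite -e det_mx00 mul1r => /(_ erefl) k00.
  by rewrite -k00 in k0.
have nz (P' : set 'M[Qp]_n.+1) C' : congr_inv P' -> Sz C' -> ~ cong 1 C' 0 ->
     is_rational (fun k => vol (coset_set P' C' k)).
  move=> P'i SC' /nonzero_class[i [j Cij]].
  have [[l Cl]|nd] := pselect (exists l, C' l l \is a GRing.unit).
    have [U Uu CU] := diag_pivot Cl.
    under eq_fun do rewrite (coset_set_congr R C' _ P'i Uu).
    apply: (pivot 1%N n) => //.
    by rewrite /Symz /= !trmx_mul trmxK SC' mulmxA.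
  have {}nd l : C' l l \isn't a GRing.unit by apply/negP => Cl; apply: nd; exists l.
  (* A unit entry off the diagonal forces rank at least 2. *)
  case: n P C nN Pi SC pivot P' C' P'i SC' i j Cij nd => [|n] P C nN Pi SC pivot P' C' P'i SC' i j Cij nd.
    by move: Cij; rewrite !ord1 => Cij; have := nd 0; rewrite Cij.
  have [U Uu CU] := offdiag_pivot SC' nd Cij.
  under eq_fun do rewrite (coset_set_congr R C' _ P'i Uu).
  apply: (pivot 2%N n) => //.
  by rewrite /Symz /= !trmx_mul trmxK SC' mulmxA.
have [C0|nC0] := pselect (cong 1 C 0); last exact: nz.
have e : (fun k => vol (coset_set P C k)) = (fun k => vol (coset_set P 0 k)).
  apply/funext => k; congr vol; apply/seteqP; split=> G [SG GC oG PG]; split=> //.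
    exact: cong_trans GC C0.
  exact: cong_trans GC (cong_sym C0).
by rewrite e; apply: zero_class_rational.
Qed.

End Rationality.

Section MassRational.
Variables (R : realType) (p : prime_nat) (n : nat).
Local Notation Zp := (padic_int p).
Local Notation Qp := (padic p).
Local Notation Sz := (@Symz p _).
Local Notation vol := (@volS R p _ 1).
Local Notation half := ((padic_of_int (2%:R : Zp))^-1).
Local Notation Ev := (@Ev p n).
Local Notation Pr := (@Pr p n).

Lemma two_unit : (p : nat) != 2%N -> 2%:R \is a @GRing.unit Zp.
Proof.
move=> p2; apply/residue_unitP; rewrite residue_nat expn1 => /eqP; rewrite -/(dvdn _ _).
by rewrite dvdn_prime2 ?Defs.primeP // (negbTE p2).
Qed.

Lemma two_dvd_p : exists c : Zp, pz p = 2%:R * c.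
Proof.
have [p2|p2] := eqVneq (p : nat) 2%N; first by exists 1; rewrite mulr1 p2.
by exists (2%:R^-1 * pz p); rewrite mulrA divrr ?mul1r // two_unit.
Qed.

Lemma Ev_sub H H' : Ev H -> Ev H' -> Ev (H - H').
Proof.
by move=> [L ->] [L' ->]; exists (L - L'); rewrite tr_mxB opprD addrACA.
Qed.

Lemma Ev_scale a H : Ev H -> Ev (a *: H).
Proof. by move=> [L ->]; exists (a *: L); rewrite tr_mxZ scalerDr. Qed.

Lemma Ev_pr X : Sz X -> Ev (pz p *: X).
Proof.
have [c ->] := two_dvd_p => SX; exists (c *: X).
by rewrite tr_mxZ SX -scalerA -mulr2n scaler_nat.
Qed.

(** Since 2 divides p in Z_p for every p, p times a symmetric matrix is even, so evenness of a
    symmetric matrix depends only on its class modulo p. *)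
Lemma Ev_periodic : periodic 1 Sz Ev.
Proof.
split; first exact: Ev_sym.
move=> X Y SY XY EX; have /congP[Z eX] := XY.
have SX := Ev_sym EX.
have SZ : Sz Z.
  have [_ _ KZ _ _] := lattice_Symz p n; apply/(KZ 1%N).
  have -> : pz p ^+ 1 *: Z = X - Y by rewrite eX addrC addKr.
  by rewrite /Symz /= tr_mxB SX SY.
have -> : Y = X - pz p *: Z by rewrite eX expr1 addrK.
exact/Ev_sub/Ev_pr.
Qed.

(** Combined with [ord_det k], it makes the determinant p^k times a unit square, yet it does not
    mention k and is invariant under congruence over Q_p. Both properties are required of P. *)
Definition unit_power_class (e : int) : set 'M[Qp]_n :=
  [set M | hasse_mx (half *: M) = e /\
           exists2 w, w != 0 & \det M = w ^+ 2 \/ \det M = (p : nat)%:R * w ^+ 2].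

Lemma unit_power_class_inv e : congr_inv (unit_power_class e).
Proof.
move=> U M Uu [hM [w w0 dM]]; split.
  by rewrite scalemxAl scalemxAr hasse_mx_congr.
exists (\det U * w).
  by rewrite mulf_neq0 // -unitfE -unitmxE.
have gen (F : comNzRingType) (a b c : F) : a * (b * c ^+ 2) * a = b * (a * c) ^+ 2 by ring.
rewrite !det_mulmx det_tr; case: dM => ->; [left|right]; last exact: gen.
by have := gen _ (\det U) 1 w; rewrite !mul1r.
Qed.

Lemma pQ_nonzero (w : Qp) : w != 0 ->
  exists j l, exists2 y : Zp, y \is a GRing.unit & w * (p : nat)%:R ^+ l = padic_of_int (pz p ^+ j * y).
Proof.
move=> w0; have [x [l ew]] := padic_fracP w.
have x0 : x != 0.
  by apply: contraNneq w0 => x0; rewrite ew x0 pQ0 mul0r.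
have [j [y yu ex]] := zp_ordP x0; exists j, l, y => //.
rewrite -ex ew; exact: divfK (pqX_neq0 p l) _.
Qed.

(** Denominators are cleared and the powers of p compared; what remains is v = y^2 for the unit part
    y of w. *)
Lemma unit_squareP k (v : Zp) (w : Qp) : v \is a GRing.unit -> w != 0 ->
  padic_of_int (pz p ^+ k * v) = w ^+ 2 \/
  padic_of_int (pz p ^+ k * v) = (p : nat)%:R * w ^+ 2 ->
  exists2 u, u \is a GRing.unit & v = u ^+ 2.
Proof.
move=> vu w0 h; have [j [l [y yu ey]]] := pQ_nonzero w0; exists y => //.
have yu2 : y ^+ 2 \is a GRing.unit by rewrite unitrX.
suff [m em] : exists m, pz p ^+ (k + (l + l)) * v = pz p ^+ m * y ^+ 2.
  have := ord_uniq vu yu2 em => km; apply: (mulfI (prX_neq0 p m)).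
  by rewrite -em km.
have eL : padic_of_int (pz p ^+ (k + (l + l)) * v) =
    padic_of_int (pz p ^+ k * v) * (p : nat)%:R ^+ l ^+ 2.
  rewrite -pQ_pr -pQX -pQM; congr padic_of_int.
  by rewrite 2!exprD expr2 mulrAC.
have eR : (pz p ^+ j * y) ^+ 2 = pz p ^+ (j + j) * y ^+ 2.
  by rewrite exprMn exprD -expr2.
case: h => h; [exists (j + j)%N|exists (j + j).+1]; apply: pQ_inj; rewrite eL h.
  by rewrite -eR pQX -ey exprMn.
have -> : pz p ^+ (j + j).+1 * y ^+ 2 = pz p * (pz p ^+ j * y) ^+ 2.
  by rewrite eR mulrA -exprS.
rewrite [RHS]pQM pQX -ey pQ_nat exprMn; exact: esym (mulrA _ _ _).
Qed.

Lemma mass_set_all e k : mass_set e (p ^ k) = all_set (unit_power_class e) k `&` Pr.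
Proof.
apply/seteqP; split=> H.
  move=> [PH [u uu dH] hH]; rewrite natrX in dH; split=> //; split.
  - exact: Pr_sym.
  - by exists (u ^+ 2) => //; rewrite unitrX.
  split=> //; have u0 : padic_of_int u != 0.
    by rewrite pQ_eq0; apply: contraTneq uu => ->; rewrite unitr0.
  exists ((p : nat)%:R ^+ k./2 * padic_of_int u); first exact: mulf_neq0 (pqX_neq0 p _) u0.
  have -> : \det (toQ H) = (p : nat)%:R ^+ k * padic_of_int u ^+ 2.
    have e1 : padic_of_int (pz p ^+ k * u ^+ 2) = (p : nat)%:R ^+ k * padic_of_int u ^+ 2.
      by rewrite pQM pQ_pr pQX.
    by rewrite det_map_mx dH.
  rewrite exprMn -exprM muln2 -{1 3}(odd_double_half k) exprD.
  case: (odd k); [right; rewrite expr1; exact: esym (mulrA _ _ _)|left].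
  by rewrite expr0 mul1r.
move=> [[SH [v vu dH] [hH [w w0 dw]]] PH]; split=> //.
rewrite det_map_mx dH in dw; have [u uu ev] := unit_squareP vu w0 dw.
by exists u => //; rewrite dH ev natrX.
Qed.

Lemma all_Ev_rational (P : set 'M[Qp]_n) : congr_inv P ->
  is_rational (fun k => vol (all_set P k `&` Ev)).
Proof.
move=> Pi; under eq_fun do rewrite (restrict_partition R _ Pi Ev_periodic).
apply: rational_sum => t; have [e|[C [EC Ct e]]] := restrict_class P t Ev_periodic.
  by under eq_fun do rewrite e vol0; exact: rational0.
by under eq_fun do rewrite e; apply: coset_rational => //; exact: Ev_sym.
Qed.

Lemma all_pEv_rational (P : set 'M[Qp]_n) : congr_inv P ->
  is_rational (fun k => vol (all_set P k `&` [set pz p *: X | X in Ev])).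
Proof.
move=> Pi; have [c cP] := @scale_vol R p n _ (pr_neq0 p).
have -> : (fun k => vol (all_set P k `&` [set pz p *: X | X in Ev])) =
    (fun k => c * series_shift n (fun k => vol (all_set (scale_set P) k `&` Ev)) k).
  apply/funext => k; rewrite scale_all_set; last exact: Ev_sym.
  rewrite /series_shift; case: ltnP => _; first by rewrite vol0 mulr0.
  apply: (cP (k - n + 3)%N); apply: periodicI.
    exact: all_set_periodic _ (scale_set_inv Pi).
  by apply: periodic_le Ev_periodic; rewrite addn3.
apply/rational_scale/rational_shift/all_Ev_rational; exact: scale_set_inv.
Qed.

(** Primitive Hessians are the even ones that are not p times an even one, so the series is a
    difference of two rational series. *)
Lemma mass_set_rational e : is_rational (fun k => vol (@mass_set p n e (p ^ k))).
Proof.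
have Pi := @unit_power_class_inv e; set P := unit_power_class e in Pi.
have -> : (fun k => vol (@mass_set p n e (p ^ k))) = (fun k => vol (all_set P k `&` Ev) -
    vol (all_set P k `&` [set pz p *: X | X in Ev])); last first.
  by apply: rational_sub; [exact: all_Ev_rational|exact: all_pEv_rational].
apply/funext => k; have [m pM] : exists m, periodic m Sz (@mass_set p n e (p ^ k)).
  by apply: mass_set_periodic; exact: pX_gt0.
have pE : periodic (m + (k + 3)) Sz (all_set P k `&` Ev).
  apply: periodicI; first by apply: periodic_le (all_set_periodic _ Pi); rewrite leq_addl.
  by apply: periodic_le Ev_periodic; rewrite addn3 addnS.
have {}pM : periodic (m + (k + 3)) Sz (@mass_set p n e (p ^ k)).
  by apply: periodic_le pM; rewrite leq_addr.
have -> : all_set P k `&` [set pz p *: X | X in Ev] = (all_set P k `&` Ev) `\` @mass_set p n e (p ^ k).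
  rewrite mass_set_all -/P; apply/seteqP; split=> H.
    move=> [PH [X EX eX]]; split; first by split=> //; rewrite -eX; apply: Ev_scale.
    by move=> [_ [_]]; case; exists X.
  move=> [[PH EH] nP]; split=> //; apply: contrapT => nE; apply: nP; split=> //.
  by split=> // -[X EX eX]; apply: nE; exists X.
set M := @mass_set p n e (p ^ k) in pM *; set A := all_set P k `&` Ev in pE *.
have MA : M `<=` A by move=> H; rewrite /M mass_set_all => -[? []].
have pX : periodic (m + (k + 3)) Sz (A `\` M).
  split=> [H [[_ /Ev_sym]] //|X Y SY XY [AX nX]].
  split; first exact: pE.2 XY AX.
  by move=> MY; apply: nX; apply: pM.2 (cong_sym XY) MY; case: AX => _ /Ev_sym.
have dis : M `&` (A `\` M) = set0 by apply/seteqP; split=> // H [MH []].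
have := volS_pcontent R (n := n) (k := m + (k + 3)) (oner_neq0 Zp) pM pX dis.
rewrite (_ : M `|` (A `\` M) = A); first by move=> ->; rewrite addrK.
apply/seteqP; split=> H; first by case=> [/MA|[]].
by move=> AH; have [MH|nM] := pselect (M H); [left|right].
Qed.

End MassRational.

(** * Witt cancellation and diagonal forms *)

Section Congruence.
Variable F : comUnitRingType.

Definition congruent n (A B : 'M[F]_n) : Prop :=
  exists2 V, V \in unitmx & V^T *m A *m V = B.

Lemma congruent_trans n (B A C : 'M[F]_n) : congruent A B -> congruent B C -> congruent A C.
Proof.
move=> [V Vu <-] [W Wu <-]; exists (V *m W); first by rewrite unitmx_mul Vu.
by rewrite trmx_mul !mulmxA.
Qed.

Lemma congruent_sym n (A B : 'M[F]_n) : congruent A B -> congruent B A.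
Proof.
by move=> [V Vu <-]; have [W Wu e] := congr_undo Vu; exists W => //; apply: e.
Qed.

Lemma congruentI n (A B V : 'M[F]_n) : B \in unitmx -> V^T *m A *m V = B -> congruent A B.
Proof.
move=> Bu e; exists V => //; move: Bu; rewrite -e !unitmxE !det_mulmx !unitrM.
by case/andP.
Qed.

Lemma congruent_block m n (A A' : 'M[F]_m) (B B' : 'M[F]_n) : congruent A A' ->
  congruent B B' -> congruent (block_mx A 0 0 B) (block_mx A' 0 0 B').
Proof.
move=> [V Vu <-] [W Wu <-]; exists (block_mx V 0 0 W).
  by rewrite unitmxE det_ublock unitrM -!unitmxE Vu.
rewrite tr_block_mx !trmx0 !mulmx_block.
by rewrite !(mulmx0, mul0mx, addr0, add0r).
Qed.

Definition diag_congruent n (a b : 'rV[F]_n) := congruent (diag_mx a) (diag_mx b).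

Lemma diag_mx_cons n a (t : 'rV[F]_n) :
  diag_mx (row_mx a%:M t : 'rV_(1 + n)) = block_mx a%:M 0 0 (diag_mx t).
Proof.
rewrite diag_mx_row; congr block_mx; apply/matrixP => i j.
by rewrite !mxE !ord1 eqxx.
Qed.

Lemma diag_congruent_cons n a (t t' : 'rV[F]_n) : diag_congruent t t' ->
  diag_congruent (row_mx a%:M t : 'rV_(1 + n)) (row_mx a%:M t').
Proof.
rewrite /diag_congruent !diag_mx_cons; apply: congruent_block.
by exists 1%:M; rewrite ?unitmx1 // trmx1 mul1mx mulmx1.
Qed.

(** The vectors (x, y) and (- b y, a x) are orthogonal and take the values c and a b c. *)
Lemma diag_congruent2 (a b c x y : F) : a \is a GRing.unit -> b \is a GRing.unit -> c \is a GRing.unit ->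
  c = a * x ^+ 2 + b * y ^+ 2 ->
  diag_congruent (row_mx a%:M b%:M : 'rV_(1 + 1)) (row_mx c%:M (a * b * c)%:M).
Proof.
move=> a0 b0 c0 e; rewrite /diag_congruent !diag_mx_cons.
have d1 (u : F) : diag_mx u%:M = u%:M :> 'M[F]_1.
  by apply/matrixP => i j; rewrite !mxE !ord1 eqxx.
rewrite !d1; apply: (@congruentI _ _ _ (block_mx x%:M (- (b * y))%:M y%:M (a * x)%:M)).
  by rewrite unitmxE det_ublock !det_scalar1 !unitrM a0 b0 c0.
rewrite (@tr_block_mx _ 1 1 1 1) !(@mulmx_block _ 1 1 1 1 1 1) !tr_scalar_mx.
rewrite !(mulmx0, mul0mx, addr0, add0r) -!scalar_mxM -!raddfD.
by congr block_mx; rewrite -?(raddf0 (@scalar_mx F 1)); congr (_%:M); rewrite ?e; ring.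
Qed.

Lemma diag_congruent_binary n (a b c x y : F) (t : 'rV[F]_n) :
  a \is a GRing.unit -> b \is a GRing.unit -> c \is a GRing.unit -> c = a * x ^+ 2 + b * y ^+ 2 ->
  diag_congruent (row_mx a%:M (row_mx b%:M t) : 'rV_(1 + (1 + n)))
                 (row_mx c%:M (row_mx (a * b * c)%:M t)).
Proof.
move=> a0 b0 c0 e.
have rA (u v : F) : row_mx u%:M (row_mx v%:M t) = row_mx (row_mx u%:M v%:M) t :> 'rV_(2 + n).
  by rewrite row_mxA castmx_id.
rewrite /diag_congruent !rA (@diag_mx_row _ n 2) (@diag_mx_row _ n 2).
have h1 : congruent (diag_mx t) (diag_mx t).
  by exists 1%:M; rewrite ?unitmx1 // trmx1 mul1mx mulmx1.
exact: congruent_block (diag_congruent2 a0 b0 c0 e) h1.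
Qed.

End Congruence.

Section WittCancellation.
Variable F : fieldType.
Hypothesis two_neq0 : 2%:R != 0 :> F.

(** For nonzero a, the reflection along P e_1 + e_1 sends P e_1 = (p, q) to - e_1. Composed with P,
    it has S - q r / (1 + p) as its lower right block. *)
Lemma witt_formula m (a p : F) (r : 'rV[F]_m) (q : 'cV[F]_m) (S A B : 'M[F]_m) :
  let P := block_mx p%:M r q S in A^T = A -> 1 + p != 0 ->
  P^T *m block_mx a%:M 0 0 A *m P = block_mx a%:M 0 0 B ->
  (S - (1 + p)^-1 *: (q *m r))^T *m A *m (S - (1 + p)^-1 *: (q *m r)) = B.
Proof.
move=> P SA p1; rewrite tr_block_mx tr_scalar_mx !mulmx_block.
rewrite !(mulmx0, mul0mx, addr0, add0r) => /eq_block_mx[e1 e2 e3 e4].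
rewrite -!scalar_mxM in e1; rewrite -scalar_mxM mul_scalar_mx in e2.
have eqq : q^T *m A *m q = (a * (1 - p ^+ 2))%:M.
  have -> : a * (1 - p ^+ 2) = a - p * a * p by ring.
  by rewrite raddfB /= -e1 addrC addKr.
have eqS : q^T *m A *m S = - (p * a) *: r.
  by rewrite scaleNr; apply/eqP; rewrite -addr_eq0 addrC e2.
have eSq : S^T *m A *m q = - (p * a) *: r^T.
  by rewrite -tr_mxZ -eqS !trmx_mul trmxK SA mulmxA.
set k := (1 + p)^-1.
rewrite tr_mxB tr_mxZ trmx_mul !(mulmxBl, mulmxBr) -!(scalemxAl, scalemxAr).
have -> : r^T *m q^T *m A *m S = r^T *m (q^T *m A *m S) by rewrite !mulmxA.
have -> : S^T *m A *m (q *m r) = (S^T *m A *m q) *m r by rewrite !mulmxA.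
have -> : r^T *m q^T *m A *m (q *m r) = r^T *m (q^T *m A *m q) *m r by rewrite !mulmxA.
rewrite eqS eSq eqq -e4 -scalemxAr -scalemxAl !mul_mx_scalar -!scalemxAl !scalerA.
rewrite -scalerBl -addrA -opprD -scalerDl addrC -scaleNr; congr (_ *: _ + _).
by rewrite /k; field.
Qed.

Lemma witt_cancellation m (a : F) (A B : 'M[F]_m) : A^T = A -> B \in unitmx ->
  congruent (block_mx a%:M 0 0 A) (block_mx a%:M 0 0 B : 'M[F]_(1 + m)) -> congruent A B.
Proof.
move=> SA Bu [P Pu eP].
suff [p [r [q [S [p1 e]]]]] : exists p (r : 'rV[F]_m) (q : 'cV[F]_m) (S : 'M[F]_m), 1 + p != 0 /\
    (block_mx p%:M r q S)^T *m block_mx a%:M 0 0 A *m block_mx p%:M r q S = block_mx a%:M 0 0 B.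
  exact: congruentI Bu (witt_formula SA p1 e).
pose p := ulsubmx P ord0 ord0.
have eM : P = block_mx p%:M (ursubmx P) (dlsubmx P) (drsubmx P).
  by rewrite -[LHS]submxK [X in block_mx X _ _ _]mx11_scalar.
have [p1|p1] := boolP (1 + p != 0).
  by exists p, (ursubmx P), (dlsubmx P), (drsubmx P); rewrite -eM.
(* If 1 + p = 0, changing the sign of the first column replaces p by - p = 1, and 1 + 1 is
   nonzero. *)
exists (- p), (ursubmx P), (- dlsubmx P), (drsubmx P); split.
  by move: p1; rewrite negbK addrC addr_eq0 => /eqP ->; rewrite opprK.
pose N : 'M[F]_(1 + m) := block_mx (-1)%:M 0 0 1%:M.
have -> : block_mx (- p)%:M (ursubmx P) (- dlsubmx P) (drsubmx P) = P *m N.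
  rewrite [in RHS]eM mulmx_block !mulmx0 !mulmx1 !addr0 !add0r.
  by rewrite -scalar_mxM mulrN1 mul_mx_scalar scaleN1r.
have -> D : (P *m N)^T *m D *m (P *m N) = N^T *m (P^T *m D *m P) *m N.
  by rewrite trmx_mul !mulmxA.
rewrite eP.
rewrite tr_block_mx !trmx0 !tr_scalar_mx !mulmx_block !(mulmx0, mul0mx, addr0, add0r).
by rewrite !mulmx1 !mul1mx -!scalar_mxM mulN1r mulrN1 opprK.
Qed.

End WittCancellation.

Section DiagonalForms.
Variables (F : fieldType) (h : F -> F -> int).
Hypothesis two_neq0 : 2%:R != 0 :> F.
Hypothesis hC : forall a b, h a b = h b a.
Hypothesis hMr : forall a b c : F, a != 0 -> b != 0 -> c != 0 -> h a (b * c) = h a b * h a c.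
Hypothesis h_sgn : forall a b, h a b * h a b = 1.
Hypothesis h_sol : forall a b x y z : F, z != 0 -> z ^+ 2 = a * x ^+ 2 + b * y ^+ 2 -> h a b = 1.

Let hMl (a b c : F) : a != 0 -> b != 0 -> c != 0 -> h (a * b) c = h a c * h b c.
Proof. by move=> a0 b0 c0; rewrite hC hMr // ![h c _]hC. Qed.

Let h1r (a : F) : a != 0 -> h a 1 = 1.
Proof. by move=> a0; rewrite -(h_sgn a 1) -hMr ?oner_neq0 // mulr1. Qed.

Let hXr (a b c : F) : a != 0 -> b != 0 -> c != 0 -> h a (b * c ^+ 2) = h a b.
Proof. by move=> a0 b0 c0; rewrite expr2 !hMr ?mulf_neq0 // h_sgn mulr1. Qed.

(** Multiplied by c, the equation reads c^2 = (a c) x^2 + (b c) y^2, so the symbol of a c and b c is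
    1; expanding it bilinearly gives the claim. *)
Lemma symbol_binary (a b c x y : F) : a != 0 -> b != 0 -> c != 0 ->
  c = a * x ^+ 2 + b * y ^+ 2 -> h a b = h c (a * b * c).
Proof.
move=> a0 b0 c0 e.
have : h (a * c) (b * c) = 1.
  by apply: (@h_sol _ _ x y c) => //; rewrite expr2 {1}e; ring.
rewrite hMl ?mulf_neq0 // !hMr ?mulf_neq0 // => e1.
have : h a b * (h a b * h a c * (h c b * h c c)) = h a b * 1 by rewrite e1.
by rewrite mulr1 !mulrA h_sgn mul1r (hC a c) => <-.
Qed.

Definition diag_symbol n (a : 'rV[F]_n) : int :=
  \prod_(i < n) \prod_(j < n | (i < j)%N) h (a ord0 i) (a ord0 j).

Definition rV_prod n (a : 'rV[F]_n) : F := \prod_j a ord0 j.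

Definition rV_nz n (a : 'rV[F]_n) : Prop := forall j, a ord0 j != 0.

Lemma rV_prod_neq0 n (a : 'rV[F]_n) : rV_nz a -> rV_prod a != 0.
Proof. by move=> a0; apply/prodf_neq0 => j _. Qed.

Lemma rV_prod_cons n a (t : 'rV[F]_n) : rV_prod (row_mx a%:M t : 'rV_(1 + n)) = a * rV_prod t.
Proof.
rewrite /rV_prod big_split_ord /= big_ord1 row_mxEl mxE eqxx mulr1n; congr (_ * _).
by apply: eq_bigr => j _; rewrite row_mxEr.
Qed.

Lemma rV_nz_cons n a (t : 'rV[F]_n) : rV_nz (row_mx a%:M t : 'rV_(1 + n)) <-> a != 0 /\ rV_nz t.
Proof.
split=> [nz|[a0 t0] j].
  split=> [|j]; last by have := nz (rshift 1 j); rewrite row_mxEr.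
  by have := nz (lshift n ord0); rewrite row_mxEl mxE eqxx mulr1n.
case: (split_ordP j) => k ->; last by rewrite row_mxEr.
by rewrite row_mxEl mxE !ord1 eqxx mulr1n.
Qed.

Lemma symbol_rV_prod n a (t : 'rV[F]_n) : a != 0 -> rV_nz t ->
  \prod_j h a (t ord0 j) = h a (rV_prod t).
Proof.
move=> a0 t0; suff [] : rV_prod t != 0 /\ \prod_j h a (t ord0 j) = h a (rV_prod t) by [].
rewrite /rV_prod; elim/big_rec2: _ => [|j y x _ [x0 ->]]; first by rewrite oner_neq0 h1r.
by rewrite mulf_neq0 ?hMr.
Qed.

Lemma diag_symbol_cons n a (t : 'rV[F]_n) : a != 0 -> rV_nz t ->
  diag_symbol (row_mx a%:M t : 'rV_(1 + n)) = h a (rV_prod t) * diag_symbol t.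
Proof.
move=> a0 t0; rewrite /diag_symbol big_split_ord /= big_ord1; congr (_ * _).
  rewrite big_mkcond big_split_ord /= big_ord1 mul1r -symbol_rV_prod //.
  by apply: eq_bigr => j _; rewrite row_mxEl row_mxEr mxE eqxx mulr1n.
apply: eq_bigr => i _; rewrite big_mkcond big_split_ord /= big_ord1 mul1r [RHS]big_mkcond.
by apply: eq_bigr => j _; rewrite !row_mxEr.
Qed.

Lemma diag_congruent_sq n a x (t : 'rV[F]_n) : x != 0 ->
  diag_congruent (row_mx a%:M t : 'rV_(1 + n)) (row_mx (a * x ^+ 2)%:M t).
Proof.
move=> x0; rewrite /diag_congruent !diag_mx_cons; apply: congruent_block; last first.
  by exists 1%:M; rewrite ?unitmx1 // trmx1 mul1mx mulmx1.
exists x%:M; first by rewrite unitmxE det_scalar1 unitfE.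
by rewrite tr_scalar_mx -!scalar_mxM; congr (_%:M); ring.
Qed.

Lemma rV_consP n (a : 'rV[F]_(1 + n)) : exists a0 a', a = row_mx a0%:M a'.
Proof.
by exists (lsubmx a ord0 ord0), (rsubmx a); rewrite -mx11_scalar hsubmxK.
Qed.

Lemma diag_congruent_prod n (a b : 'rV[F]_n) : diag_congruent a b ->
  exists2 c, c != 0 & rV_prod b = rV_prod a * c ^+ 2.
Proof.
move=> [V Vu e]; exists (\det V); first by rewrite -unitfE -unitmxE.
have := congr1 determinant e; rewrite !det_mulmx det_tr !det_diag -!/(rV_prod _) => <-.
by rewrite mulrAC -expr2 mulrC.
Qed.

Lemma symbol_congruent_prod n c (a b : 'rV[F]_n) : c != 0 -> rV_nz a ->
  diag_congruent a b -> h c (rV_prod a) = h c (rV_prod b).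
Proof.
by move=> c0 a0 /diag_congruent_prod[d d0 ->]; rewrite hXr // rV_prod_neq0.
Qed.

Definition equivalent_diag n (a b : 'rV[F]_n) : Prop :=
  diag_congruent a b /\ diag_symbol a = diag_symbol b.

Lemma equivalent_diag_trans n (b a c : 'rV[F]_n) :
  equivalent_diag a b -> equivalent_diag b c -> equivalent_diag a c.
Proof. by move=> [ab e] [bc e']; split; [apply: congruent_trans ab bc|rewrite e]. Qed.

Lemma equivalent_diag_sq n a x (t : 'rV[F]_n) : a != 0 -> x != 0 -> rV_nz t ->
  equivalent_diag (row_mx a%:M t : 'rV_(1 + n)) (row_mx (a * x ^+ 2)%:M t).
Proof.
move=> a0 x0 t0; split; first exact: diag_congruent_sq.
have t0' := rV_prod_neq0 t0; have x20 : x ^+ 2 != 0 by rewrite expf_neq0.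
rewrite !diag_symbol_cons ?mulf_neq0 //.
by rewrite ![h _ (rV_prod _)]hC hXr.
Qed.

Lemma equivalent_diag_cons n a (t t' : 'rV[F]_n) : a != 0 -> rV_nz t -> rV_nz t' ->
  equivalent_diag t t' ->
  equivalent_diag (row_mx a%:M t : 'rV_(1 + n)) (row_mx a%:M t').
Proof.
move=> a0 t0 t0' [tt' e]; split; first exact: diag_congruent_cons.
by rewrite !diag_symbol_cons // e (symbol_congruent_prod a0 t0 tt').
Qed.

Lemma equivalent_diag_binary n (a b c x y : F) (t : 'rV[F]_n) :
  a != 0 -> b != 0 -> c != 0 -> rV_nz t -> c = a * x ^+ 2 + b * y ^+ 2 ->
  equivalent_diag (row_mx a%:M (row_mx b%:M t) : 'rV_(1 + (1 + n)))
                  (row_mx c%:M (row_mx (a * b * c)%:M t)).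
Proof.
move=> a0 b0 c0 t0 e; split; first by apply: diag_congruent_binary e; rewrite unitfE.
have t0' := rV_prod_neq0 t0; have abc0 : a * b * c != 0 by rewrite !mulf_neq0.
rewrite !diag_symbol_cons ?rV_prod_cons //; try by apply/rV_nz_cons.
rewrite !(hMr _ _ t0') // (symbol_binary a0 b0 c0 e) !hMl ?mulf_neq0 //.
have := h_sgn c (rV_prod t); move: (h c _) (h a _) (h b _) (h c _) => u v w z e1.
rewrite -!mulrA; congr (_ * _); rewrite -[LHS]mul1r -e1; ring.
Qed.

Let diag_value_cons n (a x : F) (t : 'rV[F]_n) (y : 'cV[F]_n) :
  (col_mx x%:M y)^T *m diag_mx (row_mx a%:M t : 'rV_(1 + n)) *m col_mx x%:M y =
  (a * x ^+ 2)%:M + y^T *m diag_mx t *m y.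
Proof.
rewrite diag_mx_cons tr_col_mx mul_row_block mul_row_col !(mulmx0, addr0, add0r).
by rewrite tr_scalar_mx -!scalar_mxM; congr (_%:M + _); ring.
Qed.

Let diag_represent0 m (a : F) (t : 'rV[F]_m) (x b : F) : a != 0 -> rV_nz t -> b != 0 ->
    (a * x ^+ 2)%:M = b%:M :> 'M[F]_1 -> exists2 t' : 'rV[F]_m, rV_nz t' &
    equivalent_diag (row_mx a%:M t : 'rV_(1 + m)) (row_mx b%:M t').
Proof.
move=> a0 t0 b0 /(congr1 (fun M : 'M[F]_1 => M ord0 ord0)).
rewrite !mxE eqxx !mulr1n => eb.
have x0 : x != 0 by apply: contraNneq b0 => x0; rewrite -eb x0 expr0n mulr0.
by exists t => //; rewrite -eb; apply: equivalent_diag_sq.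
Qed.

(** Witt's chain equivalence: a value b of a diagonal form is brought to the front by binary moves,
    each of which preserves the product of symbols. The value b1 taken by the tail is moved to
    second place first. *)
Lemma diag_represent n (a : F) (t : 'rV[F]_n) (x : F) (y : 'cV[F]_n) b : a != 0 -> rV_nz t ->
  b != 0 -> (a * x ^+ 2)%:M + y^T *m diag_mx t *m y = b%:M ->
  exists2 t' : 'rV[F]_n, rV_nz t' &
    equivalent_diag (row_mx a%:M t : 'rV_(1 + n)) (row_mx b%:M t').
Proof.
elim: n a t x y b => [|n IHn] a t x y b a0 t0 b0.
  by rewrite [y]flatmx0 mulmx0 addr0; apply: diag_represent0.
have [a1 [t1 et]] := @rV_consP n t.
have [a10 t10] : a1 != 0 /\ rV_nz t1 by apply/rV_nz_cons; rewrite -et.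
have ey := vsubmxK (y : 'cV_(1 + n)); rewrite [usubmx _]mx11_scalar in ey.
move: (usubmx _ _ _) (dsubmx _) ey => y0 y' ey.
set q := _^T *m _ *m _ => eb.
have eq : q = (a1 * y0 ^+ 2)%:M + y'^T *m diag_mx t1 *m y'.
  by rewrite /q et -ey; apply: diag_value_cons.
rewrite [q]mx11_scalar in eb eq; move: (q _ _) eb eq => b1 {q} eb eq.
(* When the tail contributes 0, b differs from the first entry by a square and no binary move is
   made. *)
have [b10|b10] := eqVneq b1 0.
  by rewrite b10 raddf0 addr0 in eb; exact: diag_represent0 a0 t0 b0 eb.
have [t2 t20 e2] := IHn _ _ _ _ _ a10 t10 b10 (esym eq).
have eb' : b = a * x ^+ 2 + b1 * 1 ^+ 2.
  move: eb; rewrite -raddfD => /(congr1 (fun M : 'M[F]_1 => M ord0 ord0)).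
  by rewrite !mxE eqxx !mulr1n expr1n mulr1.
exists (row_mx (a * b1 * b)%:M t2 : 'rV_(1 + n)).
  by apply/rV_nz_cons; rewrite !mulf_neq0.
apply: equivalent_diag_trans (equivalent_diag_binary a0 b10 b0 t20 eb').
apply: equivalent_diag_cons => //; first by apply/rV_nz_cons.
by rewrite et.
Qed.

(** The form of a represents the first entry of b, so a chain of moves puts that entry in front;
    Witt cancellation removes it and the rank drops. *)
Theorem diag_symbol_congruent n (a b : 'rV[F]_n) : rV_nz a -> rV_nz b ->
  diag_congruent a b -> diag_symbol a = diag_symbol b.
Proof.
elim: n a b => [|n IHn] a b a0 b0 ab; first by rewrite /diag_symbol !big_ord0.
have [a1 [t ea]] := @rV_consP n a; have [b1 [s eb]] := @rV_consP n b.
have [a10 t0] : a1 != 0 /\ rV_nz t by apply/rV_nz_cons; rewrite -ea.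
have [b10 s0] : b1 != 0 /\ rV_nz s by apply/rV_nz_cons; rewrite -eb.
rewrite ea eb in ab *; case: (ab) => P Pu.
rewrite !diag_mx_cons -[P](@submxK _ 1 n 1 n) (@tr_block_mx _ 1 n 1 n) !(@mulmx_block _ 1 n 1 n 1 n).
rewrite !(mulmx0, addr0, add0r) => /(@eq_block_mx _ 1 n 1 n)[e1 _ _ _].
rewrite [ulsubmx _]mx11_scalar tr_scalar_mx -!scalar_mxM in e1.
move: (ulsubmx _ _ _) (dlsubmx _) e1 => x y e1.
have {}e1 : (a1 * x ^+ 2)%:M + y^T *m diag_mx t *m y = b1%:M.
  by rewrite -e1; congr (_%:M + _); ring.
have [t' t'0 [att' hatt']] := diag_represent a10 t0 b10 e1.
have t's : diag_congruent t' s.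
  apply: (@witt_cancellation F two_neq0 n b1).
  - by rewrite tr_diag_mx.
  - by rewrite unitmxE det_diag unitfE; apply: rV_prod_neq0.
  rewrite -!diag_mx_cons; apply: congruent_trans ab.
  exact: congruent_sym.
rewrite hatt' !diag_symbol_cons // (IHn _ _ t'0 s0 t's).
by rewrite (symbol_congruent_prod b10 t'0 t's).
Qed.

Let hX (a b : F) k : a != 0 -> b != 0 -> h a (b ^+ k) = h a b ^+ k.
Proof.
move=> a0 b0; elim: k => [|k IHk]; first by rewrite !expr0 h1r.
by rewrite !exprS hMr ?expf_neq0 // IHk.
Qed.

Lemma rV_prod_scale n u (a : 'rV[F]_n) : rV_prod (u *: a) = u ^+ n * rV_prod a.
Proof.
rewrite /rV_prod -[X in _ ^+ X]card_ord -prodr_const -big_split.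
by apply: eq_bigr => j _; rewrite mxE.
Qed.

Lemma rV_nz_scale n u (a : 'rV[F]_n) : u != 0 -> rV_nz a -> rV_nz (u *: a).
Proof. by move=> u0 a0 j; rewrite mxE mulf_neq0. Qed.

(** The extra symbol on the left turns the exponent n - 1 of the usual formula into n, which avoids
    truncated subtraction at n = 0. For odd n it cancels. *)
Lemma diag_symbol_scale_prod n u (a : 'rV[F]_n) : u != 0 -> rV_nz a ->
  diag_symbol (u *: a) * h u (rV_prod a) =
  h u u ^+ 'C(n, 2) * h u (rV_prod a) ^+ n * diag_symbol a.
Proof.
move=> u0; elim: n a => [|n IHn] a a0.
  by rewrite /diag_symbol !big_ord0 bin0n !expr0 !mul1r /rV_prod big_ord0 h1r.
have [a1 [t ea]] := @rV_consP n a.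
have [a10 t0] : a1 != 0 /\ rV_nz t by apply/rV_nz_cons; rewrite -ea.
have ut0 := rV_nz_scale u0 t0; have P0 := rV_prod_neq0 t0.
have IH := IHn t t0.
have -> : u *: a = row_mx (u * a1)%:M (u *: t) :> 'rV_(1 + n).
  by rewrite ea -scale_scalar_mx; apply: scale_row_mx.
rewrite ea !diag_symbol_cons ?mulf_neq0 // rV_prod_cons rV_prod_scale.
rewrite hMl ?mulf_neq0 ?expf_neq0 // !hMr ?expf_neq0 // !hX // (hC a1 u) binS bin1.
move: IH; move: (h u u) (h u a1) (h u (rV_prod t)) (h a1 _) (diag_symbol _) (diag_symbol t).
move=> x y z w X D IH.
transitivity (X * z * (x ^+ n * z * y ^+ n * w * y)); first by ring.
by rewrite IH exprD exprS exprMn; ring.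
Qed.

Lemma diag_symbol_scale n u (a : 'rV[F]_n) : odd n -> u != 0 -> rV_nz a ->
  diag_symbol (u *: a) = h u u ^+ 'C(n, 2) * diag_symbol a.
Proof.
move=> no u0 a0; have := diag_symbol_scale_prod u0 a0.
have e := h_sgn u (rV_prod a).
have -> : h u (rV_prod a) ^+ n = h u (rV_prod a).
  move: (h u _) e => x e.
  by rewrite -(odd_double_half n) no exprD expr1 -muln2 mulnC exprM expr2 e expr1n mulr1.
move=> eX; rewrite -[LHS]mulr1 -e mulrA eX.
by rewrite -!mulrA; congr (_ * _); rewrite mulrCA e mulr1.
Qed.

End DiagonalForms.

(** * Hilbert symbols and Hasse invariants *)

Section NormValues.
Variable F : fieldType.
Hypothesis two_neq0 : 2%:R != 0 :> F.
Implicit Types a b c t : F.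

Definition norm_value a b : Prop := exists x y, b = x ^+ 2 - a * y ^+ 2.

Lemma norm_value_isotropic a b : a != 0 -> b != 0 ->
  (exists x y z : F, (x, y, z) != (0, 0, 0) /\ z ^+ 2 = a * x ^+ 2 + b * y ^+ 2) <->
  norm_value a b.
Proof.
move=> a0 b0; split=> [[x [y [z [nz e]]]]|[x [y e]]]; last first.
  exists y, 1, x; split; last by rewrite e; ring.
  by rewrite !xpair_eqE oner_eq0 andbF.
have [y0|y0] := eqVneq y 0; last first.
  exists (z / y), (x / y); have {1}-> : b = (z ^+ 2 - a * x ^+ 2) / y ^+ 2 by rewrite e; field.
  by field.
move: nz e; rewrite y0 expr0n mulr0 addr0 !xpair_eqE eqxx => nz e.
have x0 : x != 0.
  apply: contraNneq nz => x0; rewrite x0 expr0n mulr0 in e.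
  by rewrite x0 eqxx /= -sqrf_eq0 e.
have z0 : z != 0 by rewrite -sqrf_eq0 e mulf_neq0 // expf_neq0.
(* Here a = (z / x)^2 is a square, and every b is the difference of the squares of (1 + b) / 2 and
   (1 - b) / 2. *)
exists ((1 + b) / 2%:R), ((1 - b) * x / (2%:R * z)).
have -> : a = z ^+ 2 / x ^+ 2 by rewrite e; field.
by field; rewrite z0 x0 two_neq0.
Qed.

Lemma norm_value_sq a b c : norm_value a b -> norm_value a (b * c ^+ 2).
Proof. by move=> [x [y ->]]; exists (x * c), (y * c); ring. Qed.

Lemma norm_value_sqE a b c : c != 0 -> norm_value a (b * c ^+ 2) <-> norm_value a b.
Proof.
move=> c0; split; last exact: norm_value_sq.
by move/(norm_value_sq c^-1); congr norm_value; field.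
Qed.

Lemma norm_value_sql a b c : c != 0 -> norm_value (a * c ^+ 2) b <-> norm_value a b.
Proof.
move=> c0; split=> -[x [y ->]]; first by exists x, (c * y); ring.
by exists x, (y / c); field.
Qed.

Lemma norm_valueM a b c : norm_value a b -> norm_value a c -> norm_value a (b * c).
Proof.
move=> [x [y ->]] [z [w ->]]; exists (x * z + a * y * w), (x * w + y * z); ring.
Qed.

Lemma norm_value_div a b c : b != 0 -> norm_value a b -> norm_value a (b * c) -> norm_value a c.
Proof.
move=> b0 Nb Nbc; have := norm_value_sq b^-1 (norm_valueM Nb Nbc).
by congr norm_value; field.
Qed.

(* The group of nonzero values of the norm form has index at most 2. *)
Definition norm_index2 a : Prop :=
  exists2 t, t != 0 & forall b, b != 0 -> norm_value a b \/ norm_value a (b * t).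

Lemma norm_index2_mul a b c : norm_index2 a -> b != 0 -> c != 0 ->
  ~ norm_value a b -> ~ norm_value a c -> norm_value a (b * c).
Proof.
move=> [t t0 ht] b0 c0 nb nc; case: (ht b b0) => // bt; case: (ht c c0) => // ct.
by apply/(norm_value_sqE a (b * c) t0); have := norm_valueM bt ct; rewrite mulrACA -expr2.
Qed.

Definition norm_symbol a b : int := if `[< norm_value a b >] then 1 else -1.

(** Norms form a group, so the only case that involves the index is that of two non-norms, whose
    product has to be a norm. *)
Lemma norm_symbolM a b c : norm_index2 a -> b != 0 -> c != 0 ->
  norm_symbol a (b * c) = norm_symbol a b * norm_symbol a c.
Proof.
move=> i2 b0 c0; rewrite /norm_symbol.
have [Nb|nb] := pselect (norm_value a b); have [Nc|nc] := pselect (norm_value a c).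
- by rewrite !asboolT //; apply: norm_valueM.
- rewrite [in RHS](asboolT Nb) !asboolF // => N; apply: nc; exact: norm_value_div Nb N.
- rewrite [in RHS](asboolT Nc) !asboolF // => N; apply: nb.
  by apply: norm_value_div Nc _ => //; rewrite mulrC.
- rewrite (asboolF nb) (asboolF nc) asboolT //; exact: norm_index2_mul.
Qed.

End NormValues.

(** * Squareclasses and norm groups in Q_p *)

Section PadicSquares.
Variable p : prime_nat.
Local Notation Zp := (padic_int p).
Local Notation Qp := (padic p).

Lemma padic_two_neq0 : 2%:R != 0 :> Qp.
Proof. by rewrite -pQ_nat pQ_eq0 two_neq0. Qed.

Lemma unit_pQ_neq0 (u : Zp) : u \is a GRing.unit -> padic_of_int u != 0.
Proof. by rewrite pQ_eq0; apply: contraTneq => ->; rewrite unitr0. Qed.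

Lemma zp_fixpoint (f : Zp -> Zp) :
  (forall k (x y : Zp), x k = y k -> f x k.+1 = f y k.+1) -> exists x, x = f x.
Proof.
move=> fP; pose g (X : 'M[Zp]_1) : 'M[Zp]_1 := (f (X ord0 ord0))%:M.
have [k X Y XY i j|X eX _] := @cong_fixpoint p _ _ g.
  by rewrite !ord1 !mxE eqxx; apply: fP; apply: XY.
by exists (X ord0 ord0); rewrite {1}eX mxE eqxx mulr1n.
Qed.

Lemma residue_opp (x y : Zp) k : x k = y k -> (- x) k = (- y) k.
Proof. by move=> /residue_eqP[z ->]; apply/residue_eqP; exists (- z); rewrite opprD mulrN. Qed.

Lemma residue_pr_succ (x y : Zp) k : x k = y k -> (pz p * x) k.+1 = (pz p * y) k.+1.
Proof.
move=> /residue_eqP[z ->]; apply/residue_eqP; exists z.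
by rewrite mulrDr mulrA -exprS.
Qed.

(** The root is 1 + 2 p w, where w + p w^2 = t is solved by iterating w |-> t - p w^2. *)
Lemma one_add_4p_sq (t : Zp) :
  exists2 v, v \is a GRing.unit & 1 + 4%:R * pz p * t = v ^+ 2.
Proof.
have [k x y xy|w ew] := @zp_fixpoint (fun w => t - pz p * w ^+ 2).
  rewrite !residueD; congr ((_ + _) %% _)%N; apply: residue_opp; apply: residue_pr_succ.
  by rewrite !expr2 !residueM xy.
exists (1 + 2%:R * pz p * w).
  by rewrite -mulrA mulrCA unit_add_pr unitr1.
by rewrite {1}(_ : t = w + pz p * w ^+ 2); [ring|rewrite {1}ew subrK].
Qed.

Lemma unit_sq_cong (u v : Zp) t : v \is a GRing.unit -> u = v + 4%:R * pz p * t ->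
  exists2 w, w \is a GRing.unit & u = v * w ^+ 2.
Proof.
move=> vu e; have [w wu ew] := one_add_4p_sq (v^-1 * t); exists w => //.
by rewrite -ew mulrDr mulr1 mulrCA mulVKr.
Qed.

Lemma padic_class (b : Qp) : b != 0 -> exists (e : bool) (u : Zp) (c : Qp),
  [/\ u \is a GRing.unit, c != 0 & b = (p : nat)%:R ^+ e * padic_of_int u * c ^+ 2].
Proof.
move=> b0; have [j [l [u uu eb]]] := pQ_nonzero b0.
exists (odd (j + l)), u, ((p : nat)%:R ^+ (j + l)./2 / (p : nat)%:R ^+ l); split=> //.
  by apply: mulf_neq0; rewrite ?invr_eq0 pqX_neq0.
apply: (mulIf (pqX_neq0 p l)); rewrite eb pQM pQ_pr.
have gen (F : fieldType) (q v : F) m i h (d : bool) : q != 0 -> (m + i = d + h.*2)%N ->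
    q ^+ m * v = q ^+ d * v * (q ^+ h / q ^+ i) ^+ 2 * q ^+ i.
  move=> q0 /(congr1 (GRing.exp q)); rewrite !exprD -muln2 exprM => e.
  have qi : q ^+ i != 0 by rewrite expf_neq0.
  apply: (mulIf qi); rewrite mulrAC e; field; exact: qi.
by apply: gen; rewrite ?pq_neq0 // odd_double_half.
Qed.

End PadicSquares.

Section OddPrime.
Variable p : prime_nat.
Hypothesis p2 : (p : nat) != 2%N.
Local Notation Zp := (padic_int p).
Local Notation Qp := (padic p).
Local Notation Fp := 'F_(p : nat).

Definition red (x : Zp) : Fp := (x 1%N)%:R.

Lemma red_nat m : red m%:R = m%:R.
Proof. by rewrite /red residue_nat expn1 Fp_nat_mod ?Defs.primeP. Qed.

Lemma redD x y : red (x + y) = red x + red y.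
Proof. by rewrite /red residueD expn1 Fp_nat_mod ?Defs.primeP // natrD. Qed.

Lemma redM x y : red (x * y) = red x * red y.
Proof. by rewrite /red residueM expn1 Fp_nat_mod ?Defs.primeP // natrM. Qed.

Lemma redN x : red (- x) = - red x.
Proof. by apply/eqP; rewrite -addr_eq0 -redD addNr -[0]/(0%:R) red_nat. Qed.

Lemma Fp_nat_eq0 m : (m%:R == 0 :> Fp) = (p %| m)%N.
Proof. by rewrite -(dvdn_pcharf (pchar_Fp (Defs.primeP p))). Qed.

Lemma red_unit x : (x \is a GRing.unit) = (red x != 0).
Proof.
rewrite /red Fp_nat_eq0 /dvdn -{1}[x 1%N]residue_id expn1 modn_mod.
have := residue_id x 1; rewrite expn1 => ->.
by apply/idP/idP => [/residue_unitP/eqP|/eqP/residue_unitP].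
Qed.

Lemma red_lift (a : Fp) : red (a : nat)%:R = a.
Proof. by rewrite red_nat natr_Zp. Qed.

Lemma red_inj x y : red x = red y -> x 1%N = y 1%N.
Proof.
move=> e; have h (z : Zp) : z 1%N = (red z : nat).
  rewrite /red val_Fp_nat ?Defs.primeP // modn_small //.
  by have := residue_lt z 1; rewrite expn1.
by rewrite !h e.
Qed.

(** The range from 0 to (p - 1) / 2 meets every pair of opposite residues once, which gives (p + 1)
    / 2 distinct squares. *)
Let half_sq (k : 'I_(p./2.+1)) : Fp := (k : nat)%:R ^+ 2.

Let half_sq_inj : injective half_sq.
Proof.
have p_odd : odd p by case: (even_prime (Defs.primeP p)) => // e; case/eqP: p2.
have ep : (p : nat) = p./2.*2.+1 by rewrite -[LHS]odd_double_half p_odd.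
move=> k l /eqP; rewrite eqf_sqr => /orP[]; last first.
  rewrite -addr_eq0 -natrD Fp_nat_eq0 => /dvdn_leq h; apply: val_inj => /=.
  have := ltn_ord k; have := ltn_ord l; rewrite !ltnS => lp kp.
  have : ~~ (0 < k + l)%N.
    by apply/negP => /h; move: ep lp kp; lia.
  by rewrite lt0n negbK addn_eq0 => /andP[/eqP -> /eqP ->].
have lt (i : 'I_(p./2.+1)) : (i < p)%N.
  by move: ep (ltn_ord i); lia.
move=> /eqP /(congr1 (@nat_of_ord _)); rewrite !val_Fp_nat ?Defs.primeP // !modn_small // => e.
exact: val_inj.
Qed.

Let half_sq_im (f : Fp -> Fp) : {set Fp} :=
  finset.imset (f \o half_sq) (mem 'I_(p./2.+1)).

Lemma half_sq_card (f : Fp -> Fp) : injective f -> #|half_sq_im f| = p./2.+1.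
Proof. by move=> fi; rewrite card_imset ?card_ord //; apply: inj_comp fi half_sq_inj. Qed.

(** Pigeonhole principle: two sets of (p + 1) / 2 residues have p + 1 elements together, so they
    meet. If they meet in one point only, they cover the whole field. *)
Lemma half_sq_cover (f g : Fp -> Fp) : injective f -> injective g ->
  exists k l, f (half_sq k) = g (half_sq l) /\ forall b,
    (forall k l, f (half_sq k) = g (half_sq l) -> k = ord0) ->
    exists k, b = f (half_sq k) \/ b = g (half_sq k).
Proof.
move=> fi gi; have p_odd : odd p by case: (even_prime (Defs.primeP p)) => // e; case/eqP: p2.
have ep : (p : nat) = p./2.*2.+1 by rewrite -[LHS]odd_double_half p_odd.
set A := (half_sq_im f).
set B := (half_sq_im g).
have cAB : (#|A :|: B| + #|A :&: B|)%N = p.+1.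
  by rewrite cardsUI !half_sq_card // {3}ep addSn addnS addnn.
have : (A :&: B != finset.set0)%SET.
  apply/negP => /eqP AB; move: cAB; rewrite AB cards0 addn0 => e.
  by have := max_card (mem (A :|: B)%SET); rewrite e card_Fp ?Defs.primeP // ltnn.
case/set0Pn => x; rewrite inE => /andP[/imsetP[k _ ->] /imsetP[l _ e]].
exists k, l; split=> // b meet.
have AB1 : (#|A :&: B| <= 1)%N.
  rewrite (leq_trans (subset_leq_card (_ : _ \subset [set f (half_sq ord0)]%SET))) ?cards1 //.
  apply/fintype.subsetP => y /setIP[/imsetP[i _ ->] /imsetP[j _ eij]].
  by rewrite /= (meet _ _ eij) finset.inE.
have ABT : (A :|: B)%SET = [set: Fp]%SET.
  apply/eqP; rewrite eqEcard finset.subsetT cardsT card_Fp ?Defs.primeP //=.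
  by move: cAB AB1; move: #|_|%N #|_|%N => i j; lia.
have : b \in (A :|: B)%SET by rewrite ABT finset.inE.
by case/setUP => /imsetP[i _ ->]; exists i; [left|right].
Qed.

Lemma Fp_binary (u v : Fp) : u != 0 -> v != 0 -> exists x y : Fp, u * x ^+ 2 + v * y ^+ 2 = 1.
Proof.
move=> u0 v0; have [||k [l [e _]]] := @half_sq_cover (fun a => u * a) (fun a => 1 - v * a).
- exact: mulfI.
- by move=> a b /addrI/oppr_inj/(mulfI v0).
by exists (k : nat)%:R, (l : nat)%:R; rewrite -/(half_sq k) e subrK.
Qed.

(** The squares and a times the squares meet only in 0, hence they cover the field, and the
    nonsquare b is a times a square. *)
Lemma Fp_nonsquareM (a b : Fp) : a != 0 -> b != 0 -> (forall x, a <> x ^+ 2) ->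
  (forall x, b <> x ^+ 2) -> exists x, a * b = x ^+ 2.
Proof.
move=> a0 b0 na nb; have [|_ [_ [_ /(_ b)]]] := @half_sq_cover id (fun c => a * c) _ (mulfI a0).
  by [].
case=> [k l e|k [e|e]]; last by exists (a * (k : nat)%:R); rewrite e /half_sq; ring.
- have [l0|l0] := eqVneq ((l : nat)%:R : Fp) 0.
    by apply: half_sq_inj; rewrite e /half_sq l0 /= !expr0n mulr0.
  by case: (na ((k : nat)%:R / (l : nat)%:R)); rewrite exprMn exprVn -/(half_sq k) e /half_sq mulfK // expf_neq0.
- by case: (nb (k : nat)%:R).
Qed.
Lemma unit_square_red (u w : Zp) : u \is a GRing.unit -> red u = red w ^+ 2 ->
  exists2 v, v \is a GRing.unit & u = v ^+ 2.
Proof.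
move=> uu e; have wu : w \is a GRing.unit.
  by apply: contraTT uu; rewrite !red_unit e expf_eq0 => /=.
have /red_inj/residue_eqP[z ez] : red u = red (w ^+ 2) by rewrite e expr2 redM.
have u4 : 4%:R \is a @GRing.unit Zp by rewrite (natrM _ 2 2) unitrM two_unit.
have [||x xu ->] := @unit_sq_cong p u (w ^+ 2) (4%:R^-1 * z); first by rewrite unitrX.
  by rewrite ez expr1 mulrAC mulVKr // mulrC.
by exists (w * x); rewrite ?unitrM ?wu // exprMn.
Qed.

(** A solution modulo p is lifted by adjusting a coordinate that is nonzero modulo p, where Hensel's
    lemma for square roots applies. *)
Lemma unit_binary (u v : Zp) : u \is a GRing.unit -> v \is a GRing.unit ->
  exists x y : Zp, u * x ^+ 2 + v * y ^+ 2 = 1.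
Proof.
have lift (a b : Zp) (x y : Fp) : a \is a GRing.unit -> red a * x ^+ 2 + red b * y ^+ 2 = 1 ->
    x != 0 -> exists x y : Zp, a * x ^+ 2 + b * y ^+ 2 = 1.
  move=> au e x0; pose y1 : Zp := (y : nat)%:R.
  have ec : red (a^-1 * (1 - b * y1 ^+ 2)) = red (x : nat)%:R ^+ 2.
    apply: (@mulfI _ (red a)); first by rewrite -red_unit.
    rewrite -redM mulVKr // redD redN redM expr2 redM !red_lift -expr2 -[1]/(1%:R) red_nat.
    by apply/eqP; rewrite subr_eq e.
  have [|w wu ew] := unit_square_red _ ec; first by rewrite red_unit ec red_lift expf_neq0.
  by exists w, y1; rewrite -ew mulVKr // subrK.
rewrite !red_unit => u0 v0; have [x [y e]] := Fp_binary u0 v0.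
have [x0|x0] := eqVneq x 0; last by apply: lift e x0; rewrite red_unit.
have y0 : y != 0.
  by apply: contra_eq_neq e => ->; rewrite x0 !expr0n !mulr0 addr0 eq_sym oner_eq0.
have vu : v \is a GRing.unit by rewrite red_unit.
have {}e : red v * y ^+ 2 + red u * x ^+ 2 = 1 by rewrite addrC.
have [x' [y' e']] := lift _ _ _ _ vu e y0.
by exists y', x'; rewrite addrC.
Qed.

Lemma unit_square_index2 : exists2 t : Zp, t \is a GRing.unit & forall u : Zp,
  u \is a GRing.unit -> exists2 w, w \is a GRing.unit & u = w ^+ 2 \/ u * t = w ^+ 2.
Proof.
have [[t [tu nt]]|all_sq] :=
    pselect (exists t : Zp, t \is a GRing.unit /\ forall x, red t <> x ^+ 2); last first.
  exists 1; rewrite ?unitr1 // => u uu.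
  have [x ex] : exists x, red u = x ^+ 2.
    by apply: contrapT => /forallNP nx; apply: all_sq; exists u.
  have [|w wu ew] := @unit_square_red u (x : nat)%:R uu; first by rewrite red_lift.
  by exists w => //; left.
exists t => // u uu; have [[x ex]|/forallNP nu] := pselect (exists x, red u = x ^+ 2).
  have [|w wu ew] := @unit_square_red u (x : nat)%:R uu; first by rewrite red_lift.
  by exists w => //; left.
have [||x ex] := Fp_nonsquareM _ _ nu nt; rewrite -?red_unit //.
have [||w wu ew] := @unit_square_red (u * t) (x : nat)%:R; rewrite ?unitrM ?uu // ?redM ?red_lift //.
by exists w => //; right.
Qed.

Lemma norm_unit (u v : Zp) : u \is a GRing.unit -> v \is a GRing.unit ->
  norm_value (padic_of_int u) (padic_of_int v).
Proof.
move=> uu vu; have [||x [y e]] := @unit_binary v^-1 (- (v^-1 * u)).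
- by rewrite unitrV.
- by rewrite unitrN unitrM unitrV vu.
exists (padic_of_int x), (padic_of_int y); rewrite -!pQX -pQM -pQB; congr padic_of_int.
rewrite -[LHS]mulr1 -e mulrDr mulVKr // mulNr mulrN; congr (_ - _).
by rewrite -[v^-1 * u * _]mulrA mulVKr.
Qed.

(** If a is a unit up to squares, all units are norms and p represents the other coset. Otherwise -
    a is a norm of odd order, which reduces everything to units modulo squares, a group of order at
    most 2. *)
Lemma padic_index2_odd (a : Qp) : a != 0 -> norm_index2 a.
Proof.
move=> a0; have [d [u [c [uu c0 ea]]]] := padic_class a0.
suff [t t0 ht] : norm_index2 ((p : nat)%:R ^+ d * padic_of_int u).
  by exists t => // b b0; rewrite ea !(norm_value_sql _ _ c0); exact: ht.
case: d {ea}; last first.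
  exists (p : nat)%:R; first exact: pq_neq0.
  move=> b b0; have [d [v [z [vu z0 ->]]]] := padic_class b0.
  rewrite expr0 mul1r; case: d; [right|left].
    have -> : (p : nat)%:R ^+ true * padic_of_int v * z ^+ 2 * (p : nat)%:R =
        padic_of_int v * ((p : nat)%:R * z) ^+ 2 by rewrite expr1 exprMn; ring.
    by apply/norm_value_sq/norm_unit.
  by rewrite expr0 mul1r; apply/norm_value_sq/norm_unit.
have [t tu ht] := unit_square_index2.
rewrite expr1; set a' := _ * _.
have Nsq (w : Zp) : norm_value a' (padic_of_int (w ^+ 2)).
  by exists (padic_of_int w), 0; rewrite pQX expr0n mulr0 subr0.
have Nu (v : Zp) : v \is a GRing.unit ->
    norm_value a' (padic_of_int v) \/ norm_value a' (padic_of_int v * padic_of_int t).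
  move=> vu; rewrite -pQM; have [w _ [->|->]] := ht v vu; [left|right]; exact: Nsq.
have Na : norm_value a' (- a') by exists 0, 1; rewrite expr0n expr1n sub0r mulr1.
exists (padic_of_int t); first exact: unit_pQ_neq0.
move=> b b0; have [d [v [z [vu z0 ->]]]] := padic_class b0.
rewrite [_ * padic_of_int t]mulrAC !(norm_value_sqE _ _ z0).
case: d; last by rewrite expr0 mul1r; exact: Nu.
rewrite expr1.
have -> : (p : nat)%:R * padic_of_int v = - a' * padic_of_int (- (u^-1 * v)).
  by rewrite /a' mulNr -mulrA -pQM mulrN pQN mulrN opprK mulVKr.
rewrite -mulrA.
have [|N|N] := Nu (- (u^-1 * v)); first by rewrite unitrN unitrM unitrV uu.
  by left; apply: norm_valueM.
by right; apply: norm_valueM.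
Qed.

End OddPrime.

Section TwoAdic.
Variable p : prime_nat.
Hypothesis p2 : (p : nat) = 2%N.
Local Notation Zp := (padic_int p).
Local Notation Qp := (padic p).

(** The numbers 4^j (8 q + 1) with j < 4, which are 2-adic squares and suffice for the table
    below. *)
Let square_class m := [|| (m %% 8 == 1)%N, (m %% 32 == 4)%N, (m %% 128 == 16)%N |
  (m %% 512 == 64)%N].

Let square_classP m : square_class m -> exists2 w : Qp, w != 0 & m%:R = w ^+ 2.
Proof.
suff h j q : exists2 w : Qp, w != 0 & (q * (4 ^ j * 8) + 4 ^ j)%:R = w ^+ 2.
  by case/or4P => /eqP e; [rewrite (divn_eq m 8) e; exact: (h 0%N)|rewrite (divn_eq m 32) e; exact: (h 1%N)|
    rewrite (divn_eq m 128) e; exact: (h 2%N)|rewrite (divn_eq m 512) e; exact: (h 3%N)].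
have [v vu ev] := @one_add_4p_sq p q%:R.
exists (2%:R ^+ j * padic_of_int v).
  by rewrite mulf_neq0 ?unit_pQ_neq0 // expf_neq0 // padic_two_neq0.
rewrite exprMn -pQX -ev.
have -> : 1 + 4%:R * pz p * q%:R = (1 + 4 * 2 * q)%:R :> Zp by rewrite p2 natrD !natrM.
rewrite pQ_nat -!natrX -natrM; congr (_%:R).
have -> : ((2 ^ j) ^ 2 = 4 ^ j)%N by rewrite -expnM mulnC expnM.
lia.
Qed.

Let reps := [:: 1; 3; 5; 7; 2; 6; 10; 14]%N.

Lemma two_adic_class (b : Qp) : b != 0 ->
  exists2 r, r \in reps & exists2 c : Qp, c != 0 & b = r%:R * c ^+ 2.
Proof.
move=> b0; have [d [u [c [uu c0 ->]]]] := padic_class b0.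
pose r := u 3%N.
have ru : (r%:R : Zp) \is a GRing.unit.
  by rewrite (@unit_cong p _ u) // residue_nat residue_mod.
have [z ez] : exists z, u = r%:R + pz p ^+ 3 * z.
  by apply/residue_eqP; rewrite residue_nat residue_id.
have [|w wu ew] := @unit_sq_cong p u r%:R z ru.
  by rewrite ez p2; ring.
exists (2 ^ d * r)%N; last first.
  exists (padic_of_int w * c); first by rewrite mulf_neq0 ?unit_pQ_neq0.
  by rewrite ew pQM pQX pQ_nat p2 natrM natrX exprMn !mulrA.
have r8 : (r < 8)%N by have := residue_lt u 3; rewrite p2.
have : odd r.
  move/residue_unitP: ru; rewrite residue_nat p2 modn2; by case: (odd r).
by move: r r8 {ru ez ew}; case: d => r; do 8?[case: r => [|r] //].
Qed.

(** Here a represents the squareclass of minus the coefficient, so that the norm form x^2 + a y^2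
    has natural coefficients. If b times a value of this form is a nonzero square, then b is itself
    a value over Q_2. *)
Lemma two_adic_table : all (fun a => has (fun t => all (fun b =>
   has (fun x => has (fun y => square_class (b * (x ^ 2 + a * y ^ 2)) ||
     square_class (b * t * (x ^ 2 + a * y ^ 2))) (iota 0 4)) (iota 0 4)) reps) reps) reps.
Proof. by vm_compute. Qed.

Lemma padic_index2_two (a : Qp) : a != 0 -> norm_index2 a.
Proof.
move=> a0; have [r rr [c c0 ea]] : exists2 r, r \in reps & exists2 c : Qp, c != 0 & - a = r%:R * c ^+ 2.
  by apply: two_adic_class; rewrite oppr_eq0.
have /hasP[t tr /allP ht] := allP two_adic_table _ rr.
have nat_norm b x y : square_class (b * (x ^ 2 + r * y ^ 2)) -> norm_value a b%:R.
  move=> /square_classP[s s0]; set M := (_ + _)%N; rewrite natrM => e.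
  have M0 : M%:R != 0 :> Qp.
    by apply: contra_neq s0 => M0; apply/eqP; rewrite -sqrf_eq0 -e M0 mulr0.
  exists (s * x%:R / M%:R), (s * y%:R / c / M%:R).
  have -> : a = - (r%:R * c ^+ 2) by rewrite -ea opprK.
  have gen (F : fieldType) (B m q z X Y C : F) : m != 0 -> C != 0 -> B * m = q ^+ 2 ->
     m = X ^+ 2 + z * Y ^+ 2 -> B = (q * X / m) ^+ 2 - - (z * C ^+ 2) * (q * Y / C / m) ^+ 2.
    move=> m0 C0 e1 em; have -> : (q * X / m) ^+ 2 - - (z * C ^+ 2) * (q * Y / C / m) ^+ 2 =
        q ^+ 2 * (X ^+ 2 + z * Y ^+ 2) / m ^+ 2 by field; rewrite m0.
    by rewrite -em -e1; field.
  apply: gen => //.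
  by rewrite /M natrD natrM !natrX.
have t0 : t != 0%N by move: tr; case: (t).
exists t%:R; first by rewrite -pQ_nat pQ_eq0; apply: natZ_neq0; rewrite lt0n.
move=> b b0; have [q qr [d d0 ->]] := two_adic_class b0.
rewrite mulrAC !(norm_value_sqE _ _ d0) -natrM.
have /hasP[x _ /hasP[y _ /orP[h|h]]] := ht q qr; [left|right]; exact: nat_norm h.
Qed.
End TwoAdic.

(** * Splitting of symmetric matrices over local rings with 2 invertible *)

Section LocalRing.
Variable F : comUnitRingType.
Hypothesis two_u : 2%:R \is a @GRing.unit F.
Hypothesis local : forall a b : F, a + b \is a GRing.unit -> a \is a GRing.unit \/ b \is a GRing.unit.

(** If no diagonal entry is a unit, the value at e_i + e_j is 2 C i j plus two non-units, hence a
    unit in a local ring with 2 invertible. *)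
Lemma sym_pivot m (C : 'M[F]_m.+1) i j : C^T = C -> C i j \is a GRing.unit ->
  exists2 U, U \in unitmx & ulsubmx (U^T *m C *m U : 'M[F]_(1 + m)) \in unitmx.
Proof.
move=> SC Cij; have [[l Cl]|nd] := pselect (exists l, C l l \is a GRing.unit).
  exact: diag_pivot Cl.
have {}nd l : C l l \isn't a GRing.unit by apply/negP => Cl; apply: nd; exists l.
have ij : i != j by apply: contraTneq Cij => ->; apply: nd.
pose T s : 'M[F]_m.+1 := 1%:M + s *: delta_mx j i.
have Tu : T 1 \in unitmx.
  have [] // := @mulmx1_unit F m.+1 (T 1) (T (- 1)).
  rewrite /T mulmxDl mul1mx scale1r mulmxDr mulmx1 -scalemxAr mul_delta_mx_0 // scaler0 addr0.
  by rewrite scaleN1r addrNK.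
suff /diag_pivot[U Uu h] : ((T 1)^T *m C *m T 1) i i \is a GRing.unit.
  exists (T 1 *m U); first by rewrite unitmx_mul Tu.
  by rewrite trmx_mul !mulmxA; rewrite !mulmxA in h.
have dl (A : 'M[F]_m.+1) k : (delta_mx i j *m A) i k = A j k.
  rewrite mxE (bigD1 j) //= mxE !eqxx mul1r big1 ?addr0 // => l lj.
  by rewrite mxE (negbTE lj) andbF mul0r.
have dr (A : 'M[F]_m.+1) k : (A *m delta_mx j i) k i = A k j.
  rewrite mxE (bigD1 j) //= mxE !eqxx mulr1 big1 ?addr0 // => l lj.
  by rewrite mxE (negbTE lj) mulr0.
have -> : ((T 1)^T *m C *m T 1) i i = (C i i + C j j) + 2%:R * C i j.
  rewrite /T scale1r tr_mxD trmx1 trmx_delta mulmxDl mulmxDr !mul1mx mulmx1.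
  have aE (A B : 'M[F]_m.+1) k l : (A + B) k l = A k l + B k l by rewrite mxE.
  have eC : C j i = C i j by rewrite -[in LHS]SC mxE.
  by rewrite !aE dr !aE !dl eC mulr_natl mulr2n; ring.
have : (C i i + C j j + 2%:R * C i j) + - (C i i + C j j) \is a GRing.unit.
  by rewrite addrC addKr unitrM two_u.
case/local => //; rewrite unitrN => /local[] h; by rewrite (negbTE (nd _)) in h.
Qed.

Lemma sym_split m (C : 'M[F]_m.+1) i j : C^T = C -> C i j \is a GRing.unit ->
  exists a, exists2 D : 'M[F]_m, D^T = D & a \is a GRing.unit /\
    congruent (C : 'M[F]_(1 + m)) (block_mx a%:M 0 0 D).
Proof.
move=> SC /(sym_pivot SC)[U Uu]; set G := (_ *m U) => Gu.
have SG : G^T = G by rewrite /G !trmx_mul trmxK SC mulmxA.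
exists (ulsubmx (G : 'M[F]_(1 + m)) ord0 ord0), (schur (G : 'M[F]_(1 + m))).
  exact: (@schur_sym F 1 m).
split; first by move: Gu; rewrite unitmxE det_mx11.
apply: congruent_trans (_ : congruent (G : 'M[F]_(1 + m)) _); first by exists U.
apply: congruent_sym; exists (schur_trans (G : 'M[F]_(1 + m))); first exact: schur_trans_unit.
by rewrite -mx11_scalar -schurE.
Qed.

End LocalRing.

Lemma sym_diagonal (F : fieldType) n (M : 'M[F]_n) : 2%:R != 0 :> F -> M^T = M ->
  exists a, congruent M (diag_mx a).
Proof.
move=> two0; elim: n M => [|n IHn] M SM.
  by exists 0, 1%:M; rewrite ?unitmx1 // [diag_mx _]flatmx0 [LHS]flatmx0.
have [[i [j Mij]]|M0] := pselect (exists i j, M i j \is a GRing.unit); last first.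
  exists 0, 1%:M; rewrite ?unitmx1 // trmx1 mul1mx mulmx1.
  apply/matrixP => i j; rewrite !mxE mul0rn; apply/eqP; rewrite -[_ == _]negbK -unitfE.
  by apply/negP => Mij; apply: M0; exists i, j.
have [|a b ab|c [D SD [cu hD]]] := sym_split _ _ SM Mij; first by rewrite unitfE.
  by move: ab; rewrite !unitfE; have [->|] := eqVneq a 0; [rewrite add0r; right|left].
have [a aD] := IHn D SD; exists (row_mx c%:M a : 'rV_(1 + n)).
rewrite diag_mx_cons; apply: congruent_trans hD _; apply: congruent_block aD.
by exists 1%:M; rewrite ?unitmx1 // trmx1 mul1mx mulmx1.
Qed.

Section PadicHasse.
Variable p : prime_nat.
Local Notation Zp := (padic_int p).
Local Notation Qp := (padic p).
Local Notation half := ((padic_of_int (2%:R : Zp))^-1).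

Lemma padic_index2 (a : Qp) : a != 0 -> norm_index2 a.
Proof.
by have [p2|p2] := eqVneq (p : nat) 2%N; [apply: padic_index2_two|apply: padic_index2_odd].
Qed.

Lemma hilbertE (a b : Qp) : a != 0 -> b != 0 -> hilbert a b = norm_symbol a b.
Proof.
move=> a0 b0; rewrite /hilbert /norm_symbol.
have h := norm_value_isotropic (padic_two_neq0 p) a0 b0.
by rewrite (asbool_equiv_eq h).
Qed.

Lemma hilbertC (a b : Qp) : hilbert a b = hilbert b a.
Proof.
suff h (c d : Qp) : (exists x y z, (x, y, z) != (0, 0, 0) /\ z ^+ 2 = c * x ^+ 2 + d * y ^+ 2) ->
    exists x y z, (x, y, z) != (0, 0, 0) /\ z ^+ 2 = d * x ^+ 2 + c * y ^+ 2.
  by rewrite /hilbert; congr (if _ then _ else _); apply/asbool_equiv_eq; split; apply: h.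
move=> [x [y [z [nz e]]]]; exists y, x, z; split; last by rewrite e addrC.
by move: nz; rewrite !xpair_eqE; case: (x == 0); case: (y == 0).
Qed.

Lemma hilbertMr (a b c : Qp) : a != 0 -> b != 0 -> c != 0 ->
  hilbert a (b * c) = hilbert a b * hilbert a c.
Proof.
move=> a0 b0 c0; rewrite !hilbertE ?mulf_neq0 //; apply: norm_symbolM => //.
exact: padic_index2.
Qed.

Lemma hilbert_sgn (a b : Qp) : hilbert a b * hilbert a b = 1.
Proof. by rewrite /hilbert; case: ifP. Qed.

Lemma hilbert_sol (a b x y z : Qp) : z != 0 -> z ^+ 2 = a * x ^+ 2 + b * y ^+ 2 -> hilbert a b = 1.
Proof.
move=> z0 e; rewrite /hilbert asboolT //; exists x, y, z; split=> //.
by rewrite !xpair_eqE (negbTE z0) andbF.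
Qed.

(** Frees the Hasse invariant from the diagonalisation chosen by [xget]: any other one is congruent
    to it, and congruent diagonal forms have equal symbol products. *)
Lemma hasse_mx_diag n (M : 'M[Qp]_n) a : rV_nz a -> congruent M (diag_mx a) ->
  hasse_mx M = diag_symbol (@hilbert p) a.
Proof.
move=> a0 Ma; rewrite /hasse_mx; case: xgetP => [b _ Mb|/(_ a)]; last by case.
have ba : diag_congruent b a by apply: congruent_trans (congruent_sym _) Ma.
have b0 : rV_nz b.
  have [c c0 eP] := diag_congruent_prod ba; have := rV_prod_neq0 a0; rewrite eP => Pb j.
  by apply: contraNneq Pb => bj; rewrite /rV_prod (bigD1 j) //= bj !mul0r.
apply: diag_symbol_congruent ba => //; [exact: padic_two_neq0|exact: hilbertC|exact: hilbertMr|
  exact: hilbert_sgn|exact: hilbert_sol].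
Qed.

Lemma hasse_mx_sgn n (M : 'M[Qp]_n) : hasse_mx M = 1 \/ hasse_mx M = -1.
Proof.
rewrite /hasse_mx /hasse_diag; elim/big_ind: _ => [|x y [->|->] [->|->]|i _]; auto.
elim/big_ind: _ => [|x y [->|->] [->|->]|j _]; auto.
by rewrite /hilbert; case: ifP; auto.
Qed.

Lemma hasse_mx_scale n (M : 'M[Qp]_n) u : odd n -> u != 0 -> M^T = M -> \det M != 0 ->
  hasse_mx (u *: M) = hilbert u u ^+ 'C(n, 2) * hasse_mx M.
Proof.
move=> no u0 SM dM; have [a Ma] := sym_diagonal (padic_two_neq0 p) SM.
have a0 : rV_nz a.
  case: (Ma) => V Vu /(congr1 determinant); rewrite !det_mulmx det_tr det_diag => e j.
  have : \det V * \det M * \det V != 0.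
    by rewrite !mulf_neq0 // -unitfE -unitmxE.
  by rewrite e; apply: contraNneq => aj; rewrite (bigD1 j) //= aj mul0r.
rewrite (hasse_mx_diag a0 Ma) (@hasse_mx_diag _ _ (u *: a)); first 1 last.
- exact: rV_nz_scale.
- have [V Vu e] := Ma; exists V => //; rewrite -scalemxAr -scalemxAl e.
  by apply/matrixP => i j; rewrite !mxE mulrnAr.
apply: diag_symbol_scale => //; [exact: hilbertC|exact: hilbertMr|exact: hilbert_sgn].
Qed.

End PadicHasse.

(** * Forms of minimal determinant *)

Section Unimodular.
Variable p : prime_nat.
Local Notation Zp := (padic_int p).
Local Notation Qp := (padic p).
Local Notation half := ((padic_of_int (2%:R : Zp))^-1).

Lemma zp_local (a b : Zp) : a + b \is a GRing.unit -> a \is a GRing.unit \/ b \is a GRing.unit.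
Proof.
have [au|/nonunit_dvd[x ->]] := boolP (a \is a GRing.unit); first by left.
have [bu|/nonunit_dvd[y ->]] := boolP (b \is a GRing.unit); first by right.
by rewrite -mulrDr (negbTE (pr_nonunit _)).
Qed.

Lemma unimodular_entry n (M : 'M[Zp]_n.+1) : M \in unitmx -> exists i j, M i j \is a GRing.unit.
Proof.
move=> Mu; apply: nonzero_class => M0; move: Mu; rewrite (unitmx_cong (ltn0Sn 0) M0).
by rewrite unitmxE det0 unitr0.
Qed.

Lemma unit_rV_cons n (c : Zp) (d : 'rV[Zp]_n) : c \is a GRing.unit ->
  (forall j, d ord0 j \is a GRing.unit) ->
  forall j, (row_mx c%:M d : 'rV_(1 + n)) ord0 j \is a GRing.unit.
Proof.
move=> cu du j; case: (split_ordP j) => l ->; last by rewrite row_mxEr.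
by rewrite row_mxEl mxE !ord1 eqxx mulr1n.
Qed.

Section Odd.
Hypothesis p2 : (p : nat) != 2%N.

Lemma unimodular_diagonal n (M : 'M[Zp]_n) : M^T = M -> M \in unitmx ->
  exists2 a : 'rV[Zp]_n, (forall j, a ord0 j \is a GRing.unit) & congruent M (diag_mx a).
Proof.
elim: n M => [|n IHn] M SM Mu.
  by exists 0; [case|exists 1%:M; rewrite ?unitmx1 // [diag_mx _]flatmx0 [LHS]flatmx0].
have [i [j Mij]] := unimodular_entry Mu.
have [c [D SD [cu hD]]] := sym_split (two_unit p2) (@zp_local) SM Mij.
have Du : D \in unitmx.
  have [V Vu /(congr1 determinant)] := hD; rewrite !det_mulmx det_tr det_ublock det_scalar1 => e.
  have : c * \det D \is a GRing.unit by rewrite -e !unitrM -!unitmxE Vu Mu.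
  by rewrite unitrM unitmxE => /andP[].
have [a au aD] := IHn D SD Du; exists (row_mx c%:M a : 'rV_(1 + n)).
  exact: unit_rV_cons.
rewrite diag_mx_cons; apply: congruent_trans hD _; apply: congruent_block aD.
by exists 1%:M; rewrite ?unitmx1 // trmx1 mul1mx mulmx1.
Qed.

Lemma unit_diag_normalize n (a b : Zp) (t : 'rV[Zp]_n) : a \is a GRing.unit ->
  b \is a GRing.unit ->
  diag_congruent (row_mx a%:M (row_mx b%:M t) : 'rV_(1 + (1 + n)))
                 (row_mx 1%:M (row_mx (a * b)%:M t)).
Proof.
move=> au bu; have [x [y e]] := unit_binary p2 au bu.
have := @diag_congruent_binary _ n a b 1 x y t au bu (unitr1 _) (esym e).
by rewrite mulr1.
Qed.

(** Replacing entries a, b by 1, a b collects the whole product in the last entry, so the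
    determinant up to squares is a complete invariant. *)
Lemma unit_diag_congruent n (a b : 'rV[Zp]_n) w :
  (forall j, a ord0 j \is a GRing.unit) -> (forall j, b ord0 j \is a GRing.unit) ->
  \prod_j b ord0 j = \prod_j a ord0 j * w ^+ 2 -> diag_congruent a b.
Proof.
have consP m (c : 'rV[Zp]_(1 + m)) : (forall j, c ord0 j \is a GRing.unit) ->
    exists c0 d, [/\ c = row_mx c0%:M d, c0 \is a GRing.unit,
      forall j, d ord0 j \is a GRing.unit & \prod_j c ord0 j = c0 * \prod_j d ord0 j].
  move=> cu; exists (lsubmx c ord0 ord0), (rsubmx c); split.
  - by rewrite -mx11_scalar hsubmxK.
  - by rewrite mxE.
  - by move=> j; rewrite mxE.
  rewrite big_split_ord /= big_ord1; congr (_ * _); first by rewrite mxE.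
  by apply: eq_bigr => j _; rewrite mxE.
have consprod m c0 (d : 'rV[Zp]_m) : \prod_j (row_mx c0%:M d : 'rV_(1 + m)) ord0 j =
    c0 * \prod_j d ord0 j.
  rewrite big_split_ord /= big_ord1 row_mxEl mxE eqxx mulr1n; congr (_ * _).
  by apply: eq_bigr => j _; rewrite row_mxEr.
elim: n a b w => [|[|n] IHn] a b w au bu e.
- by exists 1%:M; rewrite ?unitmx1 // [RHS]flatmx0 [LHS]flatmx0.
- move: e; rewrite !big_ord1 => e; exists w%:M; last first.
    apply/matrixP => i j; rewrite !ord1 tr_scalar_mx mul_scalar_mx mul_mx_scalar !mxE eqxx !mulr1n e; ring.
  move: (bu ord0); rewrite e unitrM unitrX_pos // unitmxE det_scalar1.
  by case/andP.
have [a0 [a' [ea a0u a'u ae]]] := consP _ _ au; have [a1 [s [es a1u su se]]] := consP _ _ a'u.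
have [b0 [b' [eb b0u b'u be]]] := consP _ _ bu; have [b1 [t [et b1u tu te]]] := consP _ _ b'u.
rewrite ea es eb et; apply: congruent_trans (unit_diag_normalize s a0u a1u) _.
apply: congruent_trans (congruent_sym (unit_diag_normalize t b0u b1u)).
apply: diag_congruent_cons; apply: IHn.
- by apply: unit_rV_cons => //; rewrite unitrM a0u.
- by apply: unit_rV_cons => //; rewrite unitrM b0u.
- have {}e : b0 * (b1 * \prod_j t ord0 j) = a0 * (a1 * \prod_j s ord0 j) * w ^+ 2.
    rewrite -te -be e; congr (_ * _); rewrite -se; exact: ae.
  apply: etrans (consprod _ _ _) _; rewrite -mulrA e; congr (_ * _).
  by apply: etrans (esym (consprod _ _ _)); rewrite mulrA.
Qed.

Lemma unimodular_congruent n (M M' : 'M[Zp]_n) w : M^T = M -> M'^T = M' -> M \in unitmx ->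
  M' \in unitmx -> \det M' = \det M * w ^+ 2 -> zequiv M M'.
Proof.
move=> SM SM' Mu Mu' e.
have [a au Ma] := unimodular_diagonal SM Mu; have [b bu Mb] := unimodular_diagonal SM' Mu'.
suff ab : diag_congruent a b.
  by have [V Vu <-] := congruent_trans Ma (congruent_trans ab (congruent_sym Mb)); exists V.
have detE (A : 'M[Zp]_n) (c : 'rV[Zp]_n) : congruent A (diag_mx c) ->
    exists2 v, v \is a GRing.unit & \prod_j c ord0 j = \det A * v ^+ 2.
  move=> [V Vu /(congr1 determinant)]; rewrite !det_mulmx det_tr det_diag => <-.
  by exists (\det V); rewrite -?unitmxE // mulrAC -expr2 mulrC.
have [v vu ea] := detE _ _ Ma; have [v' vu' eb] := detE _ _ Mb.
apply: (@unit_diag_congruent _ _ _ (w * v' * v^-1)) => //.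
have gen (F : comNzRingType) (d x y z z' : F) : z * z' = 1 ->
    d * x ^+ 2 * y ^+ 2 = d * z ^+ 2 * (x * y * z') ^+ 2.
  move=> zz; transitivity (d * x ^+ 2 * y ^+ 2 * (z * z') ^+ 2); last by ring.
  by rewrite zz expr1n mulr1.
by rewrite ea eb e; apply: gen; rewrite divrr.
Qed.

Lemma hasse_unimodular n (M : 'M[Zp]_n) : M^T = M -> M \in unitmx ->
  hasse_mx (half *: toQ M) = 1.
Proof.
move=> SM Mu; have [a au [V Vu e]] := unimodular_diagonal SM Mu.
have h2 := two_unit p2.
pose b : 'rV[Zp]_n := 2%:R^-1 *: a.
have bu j : b ord0 j \is a GRing.unit by rewrite mxE unitrM unitrV h2 au.
rewrite (@hasse_mx_diag _ _ _ (toQ b)); last 2 first.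
- by move=> j; rewrite mxE unit_pQ_neq0.
- exists (toQ V); first exact: toQ_unit.
  rewrite -pQ_unitV // -toQZ -toQT -!toQM -scalemxAr -scalemxAl e.
  by apply/matrixP => i j; rewrite !mxE mulrnAr raddfMn.
rewrite /diag_symbol big1 // => i _; rewrite big1 // => j _.
have [x [y exy]] := unit_binary p2 (bu i) (bu j).
apply: (@hilbert_sol _ _ _ (padic_of_int x) (padic_of_int y) 1); first exact: oner_neq0.
have h (c d : Zp) : c * x ^+ 2 + d * y ^+ 2 = 1 ->
    padic_of_int c * padic_of_int x ^+ 2 + padic_of_int d * padic_of_int y ^+ 2 = 1.
  by move=> e1; rewrite -!pQX -!pQM -pQD e1 pQ1.
by rewrite expr1n ![toQ _ _ _]mxE h.
Qed.

End Odd.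
End Unimodular.

Section EvenForms.
Variable p : prime_nat.
Local Notation Zp := (padic_int p).

Definition mx2 (F : comNzRingType) (a b c d : F) : 'M[F]_(1 + 1) :=
  block_mx a%:M b%:M c%:M d%:M.

Lemma mx2P (F : comNzRingType) (A : 'M[F]_(1 + 1)) : exists a b c d, A = mx2 a b c d.
Proof.
exists (ulsubmx A ord0 ord0), (ursubmx A ord0 ord0), (dlsubmx A ord0 ord0), (drsubmx A ord0 ord0).
by rewrite /mx2 -!mx11_scalar submxK.
Qed.

Lemma mx2_inj (F : comNzRingType) (a b c d a' b' c' d' : F) :
  mx2 a b c d = mx2 a' b' c' d' -> [/\ a = a', b = b', c = c' & d = d'].
Proof.
have si (x y : F) : x%:M = y%:M :> 'M[F]_1 -> x = y.
  by move=> /(congr1 (fun M : 'M[F]_1 => M ord0 ord0)); rewrite !mxE eqxx !mulr1n.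
by move=> /(@eq_block_mx _ 1 1 1 1)[/si-> /si-> /si-> /si->].
Qed.

Lemma tr_mx2 (F : comNzRingType) (a b c d : F) : (mx2 a b c d)^T = mx2 a c b d.
Proof. by rewrite /mx2 (@tr_block_mx _ 1 1 1 1) !tr_scalar_mx. Qed.

Lemma mx2M (F : comNzRingType) (a b c d a' b' c' d' : F) :
  mx2 a b c d *m mx2 a' b' c' d' =
  mx2 (a * a' + b * c') (a * b' + b * d') (c * a' + d * c') (c * b' + d * d').
Proof. by rewrite /mx2 (@mulmx_block _ 1 1 1 1 1 1) -!scalar_mxM -!raddfD. Qed.

Lemma mx2D (F : comNzRingType) (a b c d a' b' c' d' : F) :
  mx2 a b c d + mx2 a' b' c' d' = mx2 (a + a') (b + b') (c + c') (d + d').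
Proof. by rewrite /mx2 (@add_block_mx _ 1 1 1 1) -!raddfD. Qed.

Lemma det_mx2E (F : comNzRingType) (a b c d : F) : \det (mx2 a b c d) = a * d - b * c.
Proof.
rewrite det_mx2.
have e0 : (ord0 : 'I_2) = lshift 1 (ord0 : 'I_1) by apply: val_inj.
have e1 : (ord_max : 'I_2) = rshift 1 (ord0 : 'I_1) by apply: val_inj.
rewrite e0 e1 /mx2 (block_mxEul (a%:M : 'M[F]_1)) (block_mxEur (a%:M : 'M[F]_1)).
rewrite (block_mxEdl (a%:M : 'M[F]_1)) (block_mxEdr (a%:M : 'M[F]_1)).
by rewrite !mxE !eqxx !mulr1n.
Qed.

Lemma Ev_ulsubmx m n (H : 'M[Zp]_(m + n)) : Ev H -> Ev (ulsubmx H).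
Proof. by move=> [L ->]; exists (ulsubmx L); apply/matrixP => i j; rewrite !mxE. Qed.

Lemma Ev_drsubmx m n (H : 'M[Zp]_(m + n)) : Ev H -> Ev (drsubmx H).
Proof. by move=> [L ->]; exists (drsubmx L); apply/matrixP => i j; rewrite !mxE. Qed.

Lemma Ev_diag n (H : 'M[Zp]_n) i : Ev H -> exists a, H i i = 2%:R * a.
Proof. by move=> [L ->]; exists (L i i); rewrite !mxE mulr_natl mulr2n. Qed.

(** If H were p D with D even, then 2 p would divide its determinant: in rank 1 because the entry of
    D is even, in higher rank because p^2 divides the determinant and 2 divides p. *)
Lemma Pr_of_Ev n (H : 'M[Zp]_n) u : odd n -> Ev H -> u \is a GRing.unit ->
  \det H = 2%:R * u -> Pr H.
Proof.
move=> no EH uu dH; split=> // -[D ED eH].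
have [c ec] := two_dvd_p p.
suff [x ex] : exists x, 2%:R * (pz p * x) = 2%:R * u :> Zp.
  have := mulfI (two_neq0 p) ex => eu; by rewrite -eu (negbTE (pr_nonunit x)) in uu.
case: n no H EH D ED eH dH => [//|[|n]] no H EH D [L eD] eH dH.
  exists (L ord0 ord0); rewrite -dH det_mx11 eH eD !mxE; ring.
exists (c * pz p ^+ n * \det D); rewrite -dH eH detZ 2!exprS.
transitivity (2%:R * c * (pz p * pz p ^+ n * \det D)); first by ring.
by rewrite -ec; ring.
Qed.

Lemma schur_split m n (H : 'M[Zp]_(m + n)) : Ev H -> ulsubmx H \in unitmx ->
  exists2 D : 'M[Zp]_n, Ev D & zequiv H (block_mx (ulsubmx H) 0 0 D).
Proof.
move=> EH Hu; have SH := Ev_sym EH.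
have e : zequiv H (block_mx (ulsubmx H) 0 0 (schur H)).
  apply: zequiv_sym; exists (schur_trans H); first exact: schur_trans_unit.
  by rewrite -schurE.
exists (schur H) => //; have [U Uu eU] := e.
rewrite -(block_mxKdr (ulsubmx H) 0 0 (schur H)) eU.
by apply: Ev_drsubmx; apply: Ev_congr.
Qed.

Lemma zequiv_block m n (A A' : 'M[Zp]_m) (B B' : 'M[Zp]_n) : zequiv A A' -> zequiv B B' ->
  zequiv (block_mx A 0 0 B) (block_mx A' 0 0 B').
Proof.
move=> [U Uu eA] [V Vu eB].
have [W Wu eW] : congruent (block_mx A 0 0 B) (block_mx A' 0 0 B').
  by apply: congruent_block; [exists U|exists V].
by exists W.
Qed.

Section Dyadic.
Hypothesis p2 : (p : nat) = 2%N.

Let pz2 : pz p = 2%:R. Proof. by rewrite p2. Qed.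

(** The residue field has two elements, so z = 0 or z = 1 corrects the parity of a. *)
Lemma dyadic_parity (a d : Zp) : d \is a GRing.unit -> exists z t, a + z ^+ 2 * d = 2%:R * t.
Proof.
move=> du; have [au|/nonunit_dvd[t ->]] := boolP (a \is a GRing.unit); last first.
  by exists 0, t; rewrite pz2; ring.
exists 1; have [|t et] := @nonunit_dvd p (a + d); last by exists t; rewrite -pz2 -et; ring.
apply/residue_unitP; apply; rewrite residueD.
have h (x : Zp) : x \is a GRing.unit -> x 1%N = 1%N.
  by move=> /residue_unitP; have := residue_lt x 1; rewrite p2; case: (x 1%N) => [|[|]].
by rewrite !h // p2.
Qed.

(** With y = 2 w the equation becomes t + b w + 2 c w^2 = 0, whose linear coefficient is a unit and
    which is contracting when solved for w. *)
Lemma dyadic_root (b c t : Zp) : b \is a GRing.unit ->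
  exists y, 2%:R * t + b * y + c * y ^+ 2 = 0.
Proof.
move=> bu; have [k x y xy|w ew] := @zp_fixpoint p (fun w => - b^-1 * t - pz p * (b^-1 * c * w ^+ 2)).
  rewrite !residueD; congr ((_ + _) %% _)%N; apply: residue_opp; apply: residue_pr_succ.
  by rewrite !expr2 !residueM xy.
have bw : b * w = - t - 2%:R * c * w ^+ 2.
  have bb : b * b^-1 = 1 by rewrite divrr.
  transitivity (- (b * b^-1) * t - 2%:R * (b * b^-1) * c * w ^+ 2); last by rewrite bb; ring.
  by rewrite {1}ew pz2; ring.
exists (2%:R * w); transitivity (2%:R * t + 2%:R * (b * w) + 4%:R * c * w ^+ 2); first by ring.
by rewrite bw; ring.
Qed.

Definition hyperbolic : 'M[Zp]_(1 + 1) := mx2 0 1 1 0.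

Lemma hyperbolic_plane (b c : Zp) : b \is a GRing.unit ->
  zequiv (mx2 0 b b (2%:R * c)) hyperbolic.
Proof.
move=> bu; exists (mx2 b^-1 (- (b^-1 * c)) 0 1).
  by rewrite unitmxE det_mx2E mulr1 mulr0 subr0 unitrV.
have bb : b * b^-1 = 1 by rewrite divrr.
have bb' : b^-1 * b = 1 by rewrite mulVr.
rewrite tr_mx2 !mx2M; congr mx2; ring: bb bb'.
Qed.

(* The vector e = (1, y, x) is isotropic and pairs with f = (0, 1, 0) to a unit. *)
Lemma split_isotropic m (a b c : Zp) (D : 'M[Zp]_m) (x : 'cV[Zp]_m) (y : Zp) :
  Ev D -> b + 2%:R * c * y \is a GRing.unit ->
  (2%:R * (a + b * y + c * y ^+ 2))%:M + x^T *m D *m x = 0 ->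
  exists2 H1 : 'M[Zp]_m, Ev H1 &
    zequiv (block_mx (mx2 (2%:R * a) b b (2%:R * c)) 0 0 D) (block_mx hyperbolic 0 0 H1).
Proof.
move=> ED bu e; set H := block_mx _ _ _ D.
have EH : Ev H.
  have [L eL] := ED; exists (block_mx (mx2 a b 0 c) 0 0 L).
  rewrite /H tr_block_mx !trmx0 add_block_mx !addr0 -eL; congr block_mx.
  by rewrite tr_mx2 mx2D; congr mx2; ring.
pose P : 'M[Zp]_((1 + 1) + m) := block_mx (mx2 1 0 y 1) 0 (row_mx x 0) 1%:M.
have Pu : P \in unitmx.
  by rewrite unitmxE det_lblock det_mx2E det1 !mulr1 mul0r subr0 unitr1.
have HG : zequiv H (P^T *m H *m P) by exists P.
have ul : ulsubmx (P^T *m H *m P) = mx2 0 (b + 2%:R * c * y) (b + 2%:R * c * y) (2%:R * c).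
  rewrite /P /H tr_block_mx !mulmx_block block_mxKul !(mulmx0, mul0mx, addr0, add0r).
  rewrite tr_row_mx tr_mx2 !mx2M mul_col_mx mul_col_row !(trmx0, mulmx0, mul0mx).
  have -> : x^T *m D *m x = (- (2%:R * (a + b * y + c * y ^+ 2)))%:M.
    by apply/eqP; rewrite -subr_eq0 raddfN opprK addrC e.
  have -> v : block_mx v%:M 0 0 0 = mx2 v 0 0 0 by rewrite /mx2 !raddf0.
  by rewrite mx2D; congr mx2; ring.
have [|H1 EH1 HH1] := @schur_split _ _ (P^T *m H *m P) (Ev_congr _ EH).
  by rewrite ul unitmxE det_mx2E mul0r sub0r unitrN unitrM bu.
exists H1 => //; apply: zequiv_trans HG (zequiv_trans HH1 _).
by rewrite ul; apply: zequiv_block (hyperbolic_plane _ bu) (zequiv_refl _).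
Qed.

(** An even form over Z_2 has only even diagonal entries, so a unimodular binary block splits off.
    Its complement still has determinant 2 times a unit, hence is primitive and takes an odd value,
    which compensates the binary block and yields an isotropic vector. *)
Lemma hyperbolic_split k (H : 'M[Zp]_(2 + (1 + k))) u : ~~ odd k -> Ev H ->
  u \is a GRing.unit -> \det H = 2%:R * u ->
  exists2 H1 : 'M[Zp]_(1 + k), Ev H1 & zequiv H (block_mx hyperbolic 0 0 H1).
Proof.
move=> ok EH uu dH; have SH := Ev_sym EH.
have diag2 n (G : 'M[Zp]_n) l : Ev G -> G l l \isn't a GRing.unit.
  by move=> EG; have [a ->] := Ev_diag l EG; rewrite -pz2 pr_nonunit.
have nH : ~ cong 1 H 0.
  move/congP => [X eX]; move: dH; rewrite eX add0r expr1 detZ 2!exprS pz2.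
  rewrite -!mulrA => /(mulfI (two_neq0 p)) eu; move: uu.
  by rewrite -eu -pz2 (negbTE (pr_nonunit _)).
have [i [j Hij]] := nonzero_class nH.
have [U Uu] := @offdiag_pivot p k.+1 H i j SH (fun l => diag2 _ H l EH) Hij.
move=> Gu0; pose G : 'M[Zp]_((1 + 1) + (1 + k)) := U^T *m H *m U.
have Gu : ulsubmx G \in unitmx by exact: Gu0.
have HG : zequiv H G by exists U.
have EG : Ev G := Ev_congr U EH.
have [D ED GD] := @schur_split (1 + 1) (1 + k) G EG Gu.
have EA : Ev (ulsubmx G) := @Ev_ulsubmx (1 + 1) (1 + k) G EG.
move: Gu GD EA; move: (ulsubmx G) => A Au GD EA.
have [a' [b [b' [c' eA]]]] := mx2P (A : 'M[Zp]_(1 + 1)).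
have SA := Ev_sym EA; rewrite /Symz /= eA tr_mx2 in SA; have [_ eb _ _] := mx2_inj SA.
have [a ea] : exists a, a' = 2%:R * a.
  have [a ea] := @Ev_diag _ A (lshift 1 (ord0 : 'I_1)) EA; exists a.
  by rewrite -ea eA /mx2 (block_mxEul (a'%:M : 'M[Zp]_1)) mxE eqxx.
have [c ec] : exists c, c' = 2%:R * c.
  have [c ec] := @Ev_diag _ A (rshift 1 (ord0 : 'I_1)) EA; exists c.
  by rewrite -ec eA /mx2 (block_mxEdr (a'%:M : 'M[Zp]_1)) mxE eqxx.
rewrite {}ea {}ec eb in eA.
have bu : b \is a GRing.unit.
  move: Au; rewrite eA unitmxE det_mx2E => du.
  have : - (b * b) + pz p * (2%:R * a * c) \is a GRing.unit.
    by move: du; congr (_ \is a _); rewrite pz2; ring.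
  by rewrite unit_add_pr unitrN unitrM => /andP[].
have {HG GD} HA := zequiv_trans HG GD.
have [v vu dA] : exists2 v, v \is a GRing.unit & \det D = 2%:R * v.
  have [w wu] := zequiv_det HA; rewrite det_ublock dH => dAD.
  have Au' : \det A \is a GRing.unit by rewrite -unitmxE.
  exists ((\det A)^-1 * u * w ^+ 2); first by rewrite !unitrM unitrV Au' uu wu.
  by apply: (mulrI Au'); rewrite dAD; have := divrr Au'; move: (_^-1) => d dd; ring: dd.
have [_ nD] := @Pr_of_Ev (1 + k) D v ok ED vu dA.
have [L eL] := ED.
have [x dx] : exists x : 'cV[Zp]_(1 + k), (x^T *m L *m x) ord0 ord0 \is a GRing.unit.
  apply: contrapT => /forallNP nx; apply: nD; rewrite eL; apply: even_dvd => x.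
  exact/negP/nx.
(* First z makes a plus z^2 times the odd value even, then y solves the remaining quadratic
   equation. *)
have [z [t et]] := dyadic_parity a dx.
have [y ey] := dyadic_root c t bu.
have [||H1 EH1 h1] := @split_isotropic _ a b c D (z *: x) y ED; last first.
- by exists H1 => //; apply: zequiv_trans HA _; rewrite eA.
- have -> : (z *: x)^T *m D *m (z *: x) = (2%:R * (z ^+ 2 * (x^T *m L *m x) ord0 ord0))%:M.
    rewrite tr_mxZ -!scalemxAl -scalemxAr scalerA -expr2 eL mulmxDr mulmxDl.
    have -> : x^T *m L^T *m x = (x^T *m L *m x)^T by rewrite !trmx_mul trmxK mulmxA.
    by rewrite [LHS]mx11_scalar mxE add_tr_mxE; congr (_%:M); ring.
  rewrite -raddfD /=; have -> : 0 = 0%:M :> 'M[Zp]_1 by rewrite raddf0.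
  congr (_%:M); transitivity (2%:R * ((a + z ^+ 2 * (x^T *m L *m x) ord0 ord0) + b * y + c * y ^+ 2)); first by ring.
  by rewrite et ey mulr0.
- by rewrite -pz2 -mulrA unit_add_pr.
Qed.

(** Both forms lose a hyperbolic plane at a time until rank 1, where the form is its determinant. *)
Lemma even_zequiv n (H H' : 'M[Zp]_n) u w : odd n -> Ev H -> Ev H' -> u \is a GRing.unit ->
  w \is a GRing.unit -> \det H = 2%:R * u -> \det H' = \det H * w ^+ 2 -> zequiv H H'.
Proof.
elim/ltn_ind: n H H' u w => -[//|[|[//|k]]] IHn H H' u w no EH EH' uu wu dH dH'.
  exists w%:M; first by rewrite unitmxE det_scalar1.
  rewrite tr_scalar_mx mul_scalar_mx mul_mx_scalar scalerA [LHS]mx11_scalar [H]mx11_scalar.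
  rewrite -!det_mx11 dH' scale_scalar_mx; congr (_%:M); ring.
have ok : ~~ odd k by move: no; rewrite /= !negbK.
have uu' : u * w ^+ 2 \is a GRing.unit by rewrite unitrM uu unitrX.
have dH2 : \det H' = 2%:R * (u * w ^+ 2) by rewrite dH' dH mulrA.
have [H1 EH1 h1] := @hyperbolic_split k H u ok EH uu dH.
have [H1' EH1' h1'] := @hyperbolic_split k H' (u * w ^+ 2) ok EH' uu' dH2.
have dhyp (X : 'M[Zp]_(1 + k)) : \det (block_mx hyperbolic 0 0 X) = - \det X.
  by rewrite det_ublock det_mx2E mul0r mulr1 sub0r mulN1r.
have [v vu dv] := zequiv_det h1; have [v' vu' dv'] := zequiv_det h1'.
rewrite !dhyp in dv dv'.
apply: zequiv_trans h1 (zequiv_trans _ (zequiv_sym h1')).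
apply: zequiv_block; first exact: zequiv_refl.
apply: (IHn k.+1 _ H1 H1' (- (u * v ^+ 2)) (w * v' * v^-1)) => //.
- by rewrite unitrN unitrM uu unitrX.
- by rewrite !unitrM wu vu' unitrV.
- by rewrite -[LHS]opprK dv dH; ring.
- rewrite -[LHS]opprK dv' -[\det H1]opprK dv dH'; have := divrr vu.
  move: (_^-1) => z zz; transitivity (- (\det H * w ^+ 2 * v' ^+ 2 * (v * z) ^+ 2)); last by ring.
  by rewrite zz; ring.
Qed.

End Dyadic.
End EvenForms.

(** * Local factors *)

Lemma Ev_block (p : prime_nat) m n (A : 'M[padic_int p]_m) (B : 'M[padic_int p]_n) :
  Ev A -> Ev B -> Ev (block_mx A 0 0 B).
Proof.
move=> [L ->] [L' ->]; exists (block_mx L 0 0 L').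
by rewrite tr_block_mx !trmx0 add_block_mx !addr0.
Qed.

Section LocalFactors.
Variables (R : realType) (p : prime_nat) (n : nat).
Hypothesis n_odd : odd n.
Local Notation Zp := (padic_int p).
Local Notation Qp := (padic p).
Local Notation Sz := (@Symz p n).
Local Notation vol := (@volS R p n 1).
Local Notation half := ((padic_of_int (2%:R : Zp))^-1).
Local Notation mset := (@mass_set p n).

Lemma even_exists : exists2 H : 'M[Zp]_n, Ev H & exists2 u : Zp, u \is a GRing.unit & \det H = 2%:R * u.
Proof.
clear R; elim/ltn_ind: n n_odd => -[//|[|m]] IHn no.
  exists (1%:M + (1%:M)^T); first by exists 1%:M.
  by exists 1; rewrite ?unitr1 // trmx1 det_mx11 !mxE mulr1 eqxx.
have [|H EH [u uu dH]] := IHn m (leqnSn _); first by move: no; rewrite /= negbK.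
exists (block_mx (hyperbolic p) 0 0 H).
  apply: (@Ev_block p (1 + 1) m) => //; exists (mx2 0 1 0 0).
  by rewrite tr_mx2 mx2D !addr0 add0r.
exists (- u); first by rewrite unitrN.
by rewrite (@det_ublock _ 2 m) det_mx2E dH; ring.
Qed.

Lemma std_genus : exists H1 : 'M[Zp]_n, [/\ Pr H1, exists2 u, u \is a GRing.unit & \det H1 = 2%:R * u,
    0 < vol (orb H1) & forall e S, (0 < S)%N ->
      mass_sum R p n e S = vol (mset e S) / vol (orb H1)].
Proof.
have [H EH [u uu dH]] := even_exists.
exact: mass_sumE (Pr_of_Ev n_odd EH uu dH) uu dH.
Qed.

Lemma unit_scaleK (u : Zp) (X : 'M[Zp]_n) : u \is a GRing.unit -> u *: (u^-1 *: X) = X.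
Proof. by move=> uu; rewrite scalerA divrr // scale1r. Qed.

Lemma vol_unit_scale (u : Zp) k W : u \is a GRing.unit -> periodic k Sz W ->
  vol [set u *: X | X in W] = vol W.
Proof.
move=> uu pW; have u0 : u != 0 by apply: contraTneq uu => ->; rewrite unitr0.
have [c cP] := @scale_vol R p n u u0; rewrite (cP _ _ pW).
have := cP 0%N Sz (periodic_full _ _).
rewrite (_ : [set u *: X | X in Sz] = Sz) ?volS_total1 ?mulr1 => [<-|]; first by rewrite mul1r.
apply/seteqP; split=> [_ [X SX <-]|X SX]; first by rewrite /Symz /= tr_mxZ SX.
by exists (u^-1 *: X); rewrite ?unit_scaleK // /Symz /= tr_mxZ SX.
Qed.

Lemma Pr_unit_scale (u : Zp) (H : 'M[Zp]_n) : u \is a GRing.unit -> Pr H -> Pr (u *: H).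
Proof.
move=> uu [EH nH]; split; first exact: Ev_scale.
move=> [D ED eD]; apply: nH; exists (u^-1 *: D); first exact: Ev_scale.
by rewrite scalerA mulrC -scalerA -eD scalerA mulVr // scale1r.
Qed.

Definition unit_sign (u : Zp) : int := hilbert (padic_of_int u) (padic_of_int u) ^+ 'C(n, 2).

Lemma hasse_unit_scale (u : Zp) (H : 'M[Zp]_n) : u \is a GRing.unit -> Sz H -> \det H != 0 ->
  hasse_mx (half *: toQ (u *: H)) = unit_sign u * hasse_mx (half *: toQ H).
Proof.
move=> uu SH dH; rewrite toQZ scalerA mulrC -scalerA hasse_mx_scale ?unit_pQ_neq0 //.
  by rewrite tr_mxZ -toQT SH.
rewrite detZ det_map_mx mulf_neq0 ?expf_neq0 ?invr_eq0 ?pQ_eq0 ?two_neq0 //.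
Qed.

Lemma unit_sign_sq u : unit_sign u * unit_sign u = 1.
Proof. by rewrite -exprMn hilbert_sgn expr1n. Qed.

Lemma unit_signM u v : u \is a GRing.unit -> v \is a GRing.unit ->
  unit_sign (u * v) = unit_sign u * unit_sign v.
Proof.
move=> uu vu; rewrite /unit_sign -exprMn pQM; congr (_ ^+ _).
have [u0 v0] := (unit_pQ_neq0 uu, unit_pQ_neq0 vu).
rewrite hilbertMr ?mulf_neq0 // ![hilbert (_ * _) _]hilbertC !hilbertMr //.
rewrite (hilbertC (padic_of_int v) (padic_of_int u)).
have := hilbert_sgn (padic_of_int u) (padic_of_int v); move: (hilbert _ _) (hilbert _ _) (hilbert _ _).
by move=> x y z e; transitivity (y * (z * z) * x); [ring|rewrite e mulr1].
Qed.

Lemma unit_sign_odd u : (p : nat) != 2%N -> u \is a GRing.unit -> unit_sign u = 1.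
Proof.
move=> p2 uu; have [x [y e]] := unit_binary p2 uu uu.
rewrite /unit_sign (@hilbert_sol _ _ _ (padic_of_int x) (padic_of_int y) 1) ?expr1n ?oner_neq0 //.
by rewrite -!pQX -!pQM -pQD e pQ1.
Qed.

Lemma mass_set_det_neq0 e S H : (0 < S)%N -> mset e S H -> \det H != 0.
Proof.
move=> S0 [_ [u uu ->] _]; apply: mulf_neq0; first exact: natZ_neq0.
by rewrite expf_neq0 //; apply: contraTneq uu => ->; rewrite unitr0.
Qed.

Lemma det_unit_scale (u : Zp) (H : 'M[Zp]_n) : \det (u *: H) = u * (u ^+ n./2) ^+ 2 * \det H.
Proof.
by rewrite detZ -{1}(odd_double_half n) n_odd exprD expr1 -muln2 exprM.
Qed.

(** For odd n, u^n is u times a unit square, so multiplication by u moves the determinant class of S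
    to that of S u, while the Hasse invariant changes by [unit_sign u]. *)
Lemma mass_set_scale (u : Zp) e S S' : u \is a GRing.unit -> (0 < S)%N -> (0 < S')%N ->
  S'%:R = S%:R * u :> Zp ->
  mset e S' = [set u *: H | H in mset (unit_sign u * e) S].
Proof.
move=> uu S0 S'0 eS; apply/seteqP; split=> [H MH|_ [H MH <-]]; last first.
  have dH := mass_set_det_neq0 S0 MH; case: MH => PH [v vu dHv] hH; split.
  - exact: Pr_unit_scale.
  - exists (u ^+ n./2 * v); first by rewrite unitrM unitrX.
    rewrite det_unit_scale dHv eS exprMn; ring.
  - rewrite hasse_unit_scale ?hH ?mulrA ?unit_sign_sq ?mul1r //; exact: Pr_sym.
have dH := mass_set_det_neq0 S'0 MH; case: MH => PH [v vu dHv] hH.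
have Vu : u^-1 \is a GRing.unit by rewrite unitrV.
exists (u^-1 *: H); last exact: unit_scaleK.
have PH' := Pr_unit_scale Vu PH.
have dH' : \det (u^-1 *: H) != 0.
  by rewrite detZ mulf_neq0 // expf_neq0 //; apply: contraTneq Vu => ->; rewrite unitr0.
split=> //.
- exists (u^-1 ^+ n./2 * v); first by rewrite unitrM unitrX.
  rewrite det_unit_scale dHv eS; have := mulVr uu; move: (u^-1) => w wu.
  by transitivity ((w * u) * S%:R * (w ^+ n./2 * v) ^+ 2); [ring|rewrite wu mul1r].
- have := hasse_unit_scale uu (Pr_sym PH') dH'; rewrite unit_scaleK // hH => ->.
  by rewrite mulrA unit_sign_sq mul1r.
Qed.

Lemma mass_sum_scale (u : Zp) e S S' : u \is a GRing.unit -> (0 < S)%N -> (0 < S')%N ->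
  S'%:R = S%:R * u :> Zp -> mass_sum R p n e S' = mass_sum R p n (unit_sign u * e) S.
Proof.
move=> uu S0 S'0 eS; have [H1 [_ _ _ mE]] := std_genus; rewrite !mE //.
rewrite (mass_set_scale e uu S0 S'0 eS).
have [k pM] : exists k, periodic k Sz (mset (unit_sign u * e) S) by apply: mass_set_periodic.
by rewrite (vol_unit_scale uu pM).
Qed.

Lemma unit_sign1 u : unit_sign u = 1 \/ unit_sign u = -1.
Proof.
have /eqP := unit_sign_sq u; rewrite -expr2 sqrf_eq1 => /orP[] /eqP; by [left|right].
Qed.

Lemma A_loc_scale (u : Zp) S S' : u \is a GRing.unit -> (0 < S)%N -> (0 < S')%N ->
  S'%:R = S%:R * u :> Zp -> A_loc R p n S' = A_loc R p n S.
Proof.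
move=> uu S0 S'0 eS; rewrite /A_loc !(mass_sum_scale _ uu S0 S'0 eS).
by have [->|->] := unit_sign1 u; rewrite ?mul1r // !mulN1r opprK addrC.
Qed.

Lemma B_loc_scale (u : Zp) S S' : u \is a GRing.unit -> (0 < S)%N -> (0 < S')%N ->
  S'%:R = S%:R * u :> Zp -> B_loc R p n S' = (unit_sign u)%:~R * B_loc R p n S.
Proof.
move=> uu S0 S'0 eS; rewrite /B_loc !(mass_sum_scale _ uu S0 S'0 eS).
have [->|->] := unit_sign1 u; first by rewrite !mul1r.
by rewrite !mulN1r opprK opprB.
Qed.

Lemma loc_rational : is_rational (fun k => A_loc R p n (p ^ k)) /\
  is_rational (fun k => B_loc R p n (p ^ k)).
Proof.
have [H1 [_ _ _ mE]] := std_genus.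
have rat e : is_rational (fun k => mass_sum R p n e (p ^ k)).
  under eq_fun do rewrite mE ?pX_gt0 // mulrC.
  apply: rational_scale; exact: mass_set_rational.
by split; [apply: rational_add|apply: rational_sub].
Qed.

Lemma single_class S e0 (H : 'M[Zp]_n) : (0 < S)%N -> mset e0 S H ->
  (forall e H', mset e S H' -> zequiv H H') ->
  (forall e, e != e0 -> vol (mset e S) = 0) /\ vol (mset e0 S) = vol (orb H).
Proof.
move=> S0 MH uniq; split=> [e ee0|].
  rewrite (_ : mset e S = set0) ?vol0 //; apply/seteqP; split=> // H' MH'.
  have [_ _ he0] := mass_set_zequiv (uniq _ _ MH') MH; case: MH' => _ _ he.
  by case/eqP: ee0; rewrite -he -he0.
congr vol; apply/seteqP; split=> H'; first exact: uniq.
by move=> HH'; apply: mass_set_zequiv MH.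
Qed.

Lemma loc_good S : (0 < S)%N -> (p : nat) != 2%N -> (S%:R : Zp) \is a GRing.unit ->
  A_loc R p n S = 1 /\ B_loc R p n S = 1.
Proof.
move=> S0 p2 Su; have [H1 [PH1 [u1 u1u dH1] vH1 mE]] := std_genus.
(* The rank is odd, so scaling by det H1 times S turns the determinant class of H1 into that of S; a
   unit scaling leaves the orbit volume unchanged. *)
have h2 := two_unit p2; pose s : Zp := 2%:R * u1 * S%:R.
have su : s \is a GRing.unit by rewrite !unitrM h2 u1u Su.
have du : exists2 w, w \is a GRing.unit & \det (s *: H1) = S%:R * w ^+ 2.
  exists (s ^+ n./2 * (2%:R * u1)); first by rewrite !unitrM unitrX // h2 u1u.
  by rewrite det_unit_scale dH1 /s; ring.
have [w wu dw] := du.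
have umx (H : 'M[Zp]_n) v : v \is a GRing.unit -> \det H = S%:R * v ^+ 2 -> H \in unitmx.
  by move=> vu; rewrite unitmxE => ->; rewrite unitrM Su unitrX.
have PsH1 := Pr_unit_scale su PH1.
have M1 : mset 1 S (s *: H1).
  have hs := hasse_unimodular p2 (Pr_sym PsH1) (umx _ _ wu dw).
  by split; [exact: PsH1|exists w|].
have [e|v1 v2] := @single_class S 1 _ S0 M1 _.
  move=> H' [PH' [v vu dv] _].
  apply: (@unimodular_congruent p p2 n _ _ (v * w^-1)); [exact: Pr_sym|exact: Pr_sym| | |].
  - exact: umx _ _ wu dw.
  - exact: umx _ _ vu dv.
  rewrite dv dw; have := divrr wu; move: (_^-1) => z wz.
  by transitivity (S%:R * v ^+ 2 * (w * z) ^+ 2); [rewrite wz expr1n mulr1|ring].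
have {}v2 : vol (mset 1 S) = vol (orb H1).
  rewrite v2 (_ : orb (s *: H1) = [set s *: X | X in orb H1]).
    have d0 : \det H1 = pz p ^+ 0 * (2%:R * u1) by rewrite expr0 mul1r.
    by apply: vol_unit_scale su (orb_periodic (Pr_sym PH1) _ d0); rewrite unitrM h2.
  apply/seteqP; split=> [X [U Uu ->]|_ [X [U Uu ->] <-]].
    by exists (U^T *m H1 *m U); [exists U|rewrite -scalemxAr -scalemxAl].
  by exists U => //; rewrite -scalemxAr -scalemxAl.
rewrite /A_loc /B_loc !mE // (v1 (-1)) // v2 mul0r addr0 subr0 divff //.
exact: lt0r_neq0.
Qed.

Lemma loc_two : (p : nat) = 2%N -> A_loc R p n p != 0 /\ B_loc R p n p != 0.
Proof.
move=> p2; have [H1 [PH1 [u1 u1u dH1] vH1 mE]] := std_genus.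
have p0 := p_gt0 p; have ep : (p : nat)%:R = 2%:R :> Zp by rewrite p2.
(* In odd rank, scaling by u1 turns the determinant 2 u1 into 2 times a square. All forms with this
   determinant share one Hasse invariant, so A and B agree up to sign here. *)
pose H := u1 *: H1; have PH : Pr H := Pr_unit_scale u1u PH1.
have dH : \det H = p%:R * (u1 ^+ n./2 * u1) ^+ 2.
  by rewrite det_unit_scale dH1 ep; ring.
have wu : u1 ^+ n./2 * u1 \is a GRing.unit by rewrite unitrM unitrX.
set w := _ * u1 in dH wu; pose e0 := hasse_mx (half *: toQ H).
have MH : mset e0 p H by split=> //; exists w.
have [e|v1 v2] := @single_class p e0 _ p0 MH _.
  move=> H' [PH' [v vu dv] _]; have [[EH _] [EH' _]] := (PH, PH').
  apply: (@even_zequiv p p2 n _ _ (w ^+ 2) (v * w^-1) n_odd EH EH').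
  - by rewrite unitrX.
  - by rewrite unitrM vu unitrV.
  - by rewrite dH ep.
  rewrite dv dH; have := divrr wu; move: (_^-1) => z wz.
  by transitivity (p%:R * v ^+ 2 * (w * z) ^+ 2); [rewrite wz expr1n mulr1|ring].
have vM : vol (mset e0 p) / vol (orb H1) != 0.
  have [k pM] : exists k, periodic k Sz (mset e0 p) by apply: mass_set_periodic.
  apply: lt0r_neq0; apply: divr_gt0 vH1; exact: volS_gt0 (oner_neq0 _) pM MH.
rewrite /A_loc /B_loc !mE //.
have [e1|e1] : e0 = 1 \/ e0 = -1 := hasse_mx_sgn _; rewrite e1 in v1 vM.
  by rewrite (v1 (-1)) // mul0r addr0 subr0.
by rewrite (v1 1) // mul0r add0r sub0r oppr_eq0.
Qed.

End LocalFactors.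

(** * Euler products *)

Definition two_prime : prime_nat := PrimeNat (isT : prime 2).

Definition primes_upto N : seq prime_nat := pmap insub (index_iota 0 N.+1).

Lemma primes_upto_uniq N : uniq (primes_upto N).
Proof. by apply: pmap_sub_uniq; apply: iota_uniq. Qed.

Lemma mem_primes_upto N (p : prime_nat) : (p \in primes_upto N) = (p <= N)%N.
Proof. by rewrite mem_pmap_sub mem_index_iota. Qed.

Lemma odd_prime_nat (p : prime_nat) : odd p = (p != two_prime).
Proof.
rewrite -val_eqE /=; have := Defs.primeP p; case: (even_prime (Defs.primeP p)) => [->//|po] pp.
by rewrite po; apply/esym/eqP => e; rewrite e in po.
Qed.

Lemma logn_prime_eq0 (p q : prime_nat) k : p != q -> logn p (q ^ k) = 0%N.
Proof.
by rewrite -val_eqE => /negbTE pq; rewrite lognX logn_prime ?Defs.primeP // pq muln0.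
Qed.

Section EulerProducts.
Variable C : fieldType.
Implicit Types (f : prime_nat -> C) (a : dirichlet_series C) (E : prime_nat -> power_series C).

Lemma prime_product_seq f (r : seq prime_nat) : uniq r -> (forall p, p \notin r -> f p = 1) ->
  \big[*%R/1]_(p \in [set: prime_nat]) f p = \prod_(p <- r) f p.
Proof. by move=> ur h; rewrite (fsbigE r) // => [|p _]; [apply: eq_bigl => p; rewrite in_setT|apply: h]. Qed.

Lemma euler_product_two a E k : is_euler_product a E -> a (2 ^ k)%N = E two_prime k.
Proof.
move=> [E1 aE]; rewrite aE ?expn_gt0 // (@prime_product_seq _ [:: two_prime]) //.
  by rewrite big_seq1 lognX /= logn_prime // muln1.
move=> p; rewrite inE => p2; rewrite (@logn_prime_eq0 p two_prime) // E1 //.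
by rewrite odd_prime_nat.
Qed.

Lemma euler_product_odd a E (p : prime_nat) k : is_euler_product a E -> p != two_prime ->
  a (2 * p ^ k)%N = E two_prime 1%N * E p k.
Proof.
move=> [E1 aE] p2; have pk0 : (0 < p ^ k)%N by rewrite expn_gt0 prime_gt0 ?Defs.primeP.
have lg (q : prime_nat) : logn q (2 * p ^ k) = (logn q (two_prime ^ 1) + logn q (p ^ k))%N.
  by rewrite lognM // expn1.
rewrite aE ?muln_gt0 // (@prime_product_seq _ [:: two_prime; p]); last 2 first.
- by rewrite /= inE eq_sym p2.
- move=> q; rewrite !inE negb_or => /andP[q2 qp].
  by rewrite lg !logn_prime_eq0 // E1 // odd_prime_nat.
rewrite !big_cons big_nil mulr1; congr (E _ _ * E _ _); rewrite lg.
  by rewrite pfactorK // logn_prime_eq0 // eq_sym.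
by rewrite logn_prime_eq0 // pfactorK ?Defs.primeP.
Qed.

Lemma euler_product_unique a E E' : a 2%N != 0 -> is_euler_product a E ->
  is_euler_product a E' -> forall p, E p = E' p.
Proof.
move=> a2 aE aE' p; apply/funext => k.
have [->|p2] := eqVneq p two_prime.
  by rewrite -(euler_product_two k aE) (euler_product_two k aE').
have := euler_product_odd k aE p2; rewrite (euler_product_odd k aE' p2).
rewrite -(euler_product_two 1 aE) -(euler_product_two 1 aE') expn1.
by move/(mulfI a2).
Qed.

Lemma euler_rational a E : E two_prime 1%N != 0 -> is_euler_product a E ->
  (forall p, is_rational (E p)) ->
  (exists E, is_euler_product a E) /\
  (forall E', is_euler_product a E' -> forall p, is_rational (E' p)).
Proof.
move=> E2 aE rE; split=> [|E' aE' p]; first by exists E.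
have a2 : a 2%N != 0 by rewrite -[2%N]expn1 (euler_product_two 1 aE).
by rewrite -(euler_product_unique a2 aE aE').
Qed.

End EulerProducts.

Section GlobalSeries.
Variables (R : realType) (n : nat).
Hypothesis n_odd : odd n.

Lemma partC_unit (p : prime_nat) S : ((S`_p^')%N%:R : padic_int p) \is a GRing.unit.
Proof.
apply/residue_unitP; rewrite residue_nat expn1 => /eqP; rewrite -/(dvdn _ _).
by apply/negP; rewrite -p'natE ?Defs.primeP // part_pnat.
Qed.

Lemma natr_partC (p : prime_nat) S : (0 < S)%N ->
  S%:R = (p ^ logn p S)%N%:R * (S`_p^')%N%:R :> padic_int p.
Proof. by move=> S0; rewrite -natrM -p_part partnC. Qed.

Lemma A_loc_logn (p : prime_nat) S : (0 < S)%N -> A_loc R p n S = A_loc R p n (p ^ logn p S).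
Proof.
by move=> S0; apply: A_loc_scale (partC_unit p S) (pX_gt0 p _) S0 (natr_partC p S0).
Qed.

Lemma B_loc_logn (p : prime_nat) S : (0 < S)%N ->
  B_loc R p n S = (unit_sign n ((S`_p^')%N%:R : padic_int p))%:~R * B_loc R p n (p ^ logn p S).
Proof.
by move=> S0; apply: B_loc_scale (partC_unit p S) (pX_gt0 p _) S0 (natr_partC p S0).
Qed.

Lemma loc_one (p : prime_nat) S : (0 < S)%N -> odd p -> ~~ (p %| S)%N ->
  A_loc R p n S = 1 /\ B_loc R p n S = 1.
Proof.
move=> S0 po pS; apply: loc_good => //.
  by apply: contraTneq po => ->.
by apply/residue_unitP; rewrite residue_nat expn1; apply/eqP.
Qed.

(** The bound S + 1 keeps the prime 2 in the list even for S = 1, where its factor need not be 1. *)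
Lemma glob_product (F : prime_nat -> nat -> R) S : (0 < S)%N ->
  (forall p : prime_nat, odd p -> ~~ (p %| S)%N -> F p S = 1) ->
  \big[*%R/1]_(p \in [set: prime_nat]) F p S = \prod_(p <- primes_upto S.+1) F p S.
Proof.
move=> S0 F1; apply: prime_product_seq => [|p]; first exact: primes_upto_uniq.
rewrite mem_primes_upto -ltnNge => Sp; apply: F1; last first.
  by apply/negP => /dvdn_leq -/(_ S0); rewrite leqNgt (ltn_trans _ Sp).
by rewrite odd_prime_nat; apply: contraTneq Sp => ->; rewrite -leqNgt.
Qed.

Lemma real_rational (f : power_series R) : is_rational f -> is_rational (fun k => (f k)%:C%C).
Proof. exact: (rational_map (real_complex R)). Qed.

Lemma local_euler_product (F E : prime_nat -> nat -> R) :
  (forall (p : prime_nat) S, (0 < S)%N -> odd p -> ~~ (p %| S)%N -> F p S = 1) ->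
  (forall p : prime_nat, odd p -> E p 0%N = 1) ->
  (forall S, (0 < S)%N -> \prod_(p <- primes_upto S.+1) F p S =
     \prod_(p <- primes_upto S.+1) E p (logn p S)) ->
  is_euler_product (fun S => (\big[*%R/1]_(p \in [set: prime_nat]) F p S)%:C%C)
    (fun p k => (E p k)%:C%C).
Proof.
move=> F1 E1 FE; split=> [p po|S S0]; first by rewrite E1.
rewrite glob_product // => [|p po pS]; last exact: F1.
rewrite FE // (rmorph_prod (real_complex R)) (@prime_product_seq _ _ (primes_upto S.+1)) //.
  exact: primes_upto_uniq.
move=> p; rewrite mem_primes_upto -ltnNge => Sp.
rewrite ltn_log0 ?(ltn_trans _ Sp) // E1 // odd_prime_nat.
by apply: contraTneq Sp => ->; rewrite -leqNgt.
Qed.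

Lemma A_euler : exists E, [/\ is_euler_product (D_A R n) E, E two_prime 1%N != 0 &
  forall p, is_rational (E p)].
Proof.
exists (fun (p : prime_nat) k => (A_loc R p n (p ^ k))%:C%C); split=> [||p].
- apply: (@local_euler_product (fun p S => A_loc R p n S) (fun p k => A_loc R p n (p ^ k))).
  + by move=> p S S0 po pS; case: (loc_one S0 po pS).
  + move=> p po; rewrite expn0; apply: (loc_one _ po _).1 => //.
    by rewrite dvdn1 neq_ltn prime_gt1 ?Defs.primeP // orbT.
  + by move=> S S0; apply: eq_bigr => p _; rewrite -A_loc_logn.
- rewrite expn1 (fmorph_eq0 (real_complex R)).
  by case: (@loc_two R two_prime n n_odd erefl).
- by apply: real_rational; case: (loc_rational R p n_odd).
Qed.

(** The quadratic character by which the factor of B at 2 depends on the odd part of S. *)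
Let sign2 m : int := if odd m then unit_sign n (m%:R : padic_int two_prime) else 1.

Let odd_unit m : odd m -> (m%:R : padic_int two_prime) \is a GRing.unit.
Proof.
move=> om; apply/residue_unitP; rewrite residue_nat expn1 modn2 om.
by [].
Qed.

Let sign2M m k : odd m -> odd k -> sign2 (m * k) = sign2 m * sign2 k.
Proof.
by move=> om ok; rewrite /sign2 oddM om ok natrM unit_signM // odd_unit.
Qed.

Let sign2X m k : odd m -> sign2 (m ^ k) = sign2 m ^+ k.
Proof.
move=> om; elim: k => [|k IHk]; last by rewrite expnS sign2M ?IHk ?exprS // oddX om orbT.
by have := sign2M (isT : odd 1) (isT : odd 1); rewrite mul1n /sign2 /= -expr2; have [->|->] := @unit_sign1 two_prime n 1.
Qed.

Let sign2_partC_seq S (r : seq nat) :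
  let P := (\prod_(i <- r | i \in (2%N)^') i ^ logn i S)%N in
  odd P /\ sign2 P = \prod_(p <- pmap insub r | odd (p : prime_nat)) sign2 p ^+ logn p S.
Proof.
elim: r => [|i r [IH1 IH2]] /=.
  rewrite !big_nil; split=> //; exact: (sign2X 0 (isT : odd 1)).
rewrite !big_cons; case: insubP => [p _ <-|np] /=.
  rewrite big_cons /= odd_prime_nat -val_eqE /= !inE.
  have [i2|i2] := eqVneq (p : nat) 2%N; first by split.
  have oi : odd p by rewrite odd_prime_nat -val_eqE.
  by rewrite /= oddM oddX oi orbT IH1 sign2M ?oddX ?oi ?orbT // sign2X // IH2.
case: ifP => // _; rewrite (_ : logn i S = 0%N) ?expn0 ?mul1n //.
by rewrite lognE (negbTE np).
Qed.

Let sign2_partC S : (0 < S)%N -> sign2 (S`_(2%N)^')%N =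
  \prod_(p <- primes_upto S.+1 | odd p) sign2 p ^+ logn p S.
Proof.
by move=> S0; rewrite (@widen_partn S.+1) ?leqnSn //; case: (sign2_partC_seq S (index_iota 0 S.+2)).
Qed.

(** The local factor at 2 depends on S beyond its order at 2, so the series of the B_p(p^k) do not
    give the product directly. The sign is multiplicative in the odd part of S and is distributed
    over the odd primes as the powers of [chi p]. *)
Lemma B_euler : exists E, [/\ is_euler_product (D_B R n) E, E two_prime 1%N != 0 &
  forall p, is_rational (E p)].
Proof.
pose chi (p : prime_nat) : R := (if odd p then sign2 p else 1)%:~R.
pose E (p : prime_nat) k := chi p ^+ k * B_loc R p n (p ^ k).
exists (fun (p : prime_nat) k => (E p k)%:C%C); split=> [||p].
- apply: (@local_euler_product (fun p S => B_loc R p n S) E).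
  + by move=> p S S0 po pS; case: (loc_one S0 po pS).
  + move=> p po; rewrite /E !expn0 mul1r; apply: (loc_one _ po _).2 => //.
    by rewrite dvdn1 neq_ltn prime_gt1 ?Defs.primeP // orbT.
  + move=> S S0; pose s (p : prime_nat) : R := (unit_sign n ((S`_p^')%N%:R : padic_int p))%:~R.
    rewrite (eq_bigr (fun p : prime_nat => s p * B_loc R p n (p ^ logn p S))); last first.
      by move=> p _; rewrite B_loc_logn.
    rewrite [RHS]big_split [LHS]big_split; congr (_ * _).
    have m2 : two_prime \in primes_upto S.+1 by rewrite mem_primes_upto.
    (* At odd primes the sign is trivial on units, so only the one at 2 remains. *)
    rewrite (bigD1_seq two_prime) ?primes_upto_uniq //= big1 ?mulr1; last first.
      move=> p p2; rewrite /s unit_sign_odd ?partC_unit //.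
    rewrite /s /=; have := sign2_partC S0.
    rewrite {1}/sign2 ifT => [->|].
      rewrite rmorph_prod big_mkcond; apply: eq_bigr => p _; rewrite /chi.
      by case: ifP => _; rewrite ?rmorphXn ?expr1n.
    by rewrite -[odd _]negbK -dvdn2 -p'natE // part_pnat.
- rewrite (fmorph_eq0 (real_complex R)) /E /chi /= !expr1 mul1r expn1.
  by case: (@loc_two R two_prime n n_odd erefl).
- apply/real_rational/rational_rescale; last by case: (loc_rational R p n_odd).
  rewrite /chi intr_eq0 /sign2; case: (odd p) => //.
  by have [->|->] := @unit_sign1 two_prime n (p%:R).
Qed.

End GlobalSeries.

Theorem theorem1p2 (R : realType) (n : nat) (n_odd : odd n) :
  ((exists E : prime_nat -> power_series R[i], is_euler_product (D_A R n) E) /\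
   (forall E : prime_nat -> power_series R[i], is_euler_product (D_A R n) E ->
      forall p : prime_nat, is_rational (E p))) /\
  ((exists E : prime_nat -> power_series R[i], is_euler_product (D_B R n) E) /\
   (forall E : prime_nat -> power_series R[i], is_euler_product (D_B R n) E ->
      forall p : prime_nat, is_rational (E p))).
Proof.
have [E [aE E2 rE]] := A_euler R n_odd; have [E' [aE' E2' rE']] := B_euler R n_odd.
split; [exact: euler_rational E2 aE rE|exact: euler_rational E2' aE' rE'].
Qed.
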